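(* For every integer $k\ge 2$ and every positive integer $\ell$, there exists a connected $k$-common graph with chromatic number $\ell$.
   Context: All graphs are finite, simple and loopless. A graphon is a measurable function $W:[0,1]^2\to[0,1]$ that is symmetric, i.e. $W(x,y)=W(y,x)$ for all $x,y\in[0,1]$. For a graph $H$ with vertex set $V(H)$ and edge set $E(H)$, the homomorphism density of $H$ in a graphon $W$ is $$t(H,W)=\int_{[0,1]^{V(H)}}\prod_{uv\in E(H)}W(x_u,x_v)\,dx_{V(H)}.$$ Let $e(H)=|E(H)|$. For an integer $k\ge 2$, a graph $H$ is $k$-common if $$t(H,W_1)+\cdots+t(H,W_k)\ge k^{1-e(H)}$$ for all graphons $W_1,\ldots,W_k$ such that $W_1+\cdots+W_k=1$. (Equivalently, the random $k$-edge-coloring of a complete graph asymptotically minimizes the number of monochromatic copies of $H$ among all $k$-edge-colorings.) *)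

(* Defs.v *)
From HB Require Import structures.
From mathcomp Require Import all_boot all_order all_algebra.
From mathcomp Require Import all_classical all_reals all_analysis.

Set Implicit Arguments.
Unset Strict Implicit.
Unset Printing Implicit Defensive.

Import Order.TTheory GRing.Theory Num.Theory.

Local Open Scope classical_set_scope.
Local Open Scope ring_scope.

Record sgraph : Type := SGraph {
  vertex :> finType;
  adj : rel vertex;
  adj_sym : symmetric adj;
  adj_irrefl : irreflexive adj }.

(* The edge {u, v} is represented once, by the ordered pair of its endpoints
   whose first component comes first in the enumeration of the vertices. *)
Definition edges (H : sgraph) : {set H * H} :=
  [set p | adj p.1 p.2 & (enum_rank p.1 < enum_rank p.2)%N].

Definition connected_graph (H : sgraph) : Prop :=
  (0 < #|H|)%N /\ forall u v : H, connect (@adj H) u v.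

Definition colorable (H : sgraph) (c : nat) : bool :=
  [exists f : {ffun H -> 'I_c}, [forall u, forall v, adj u v ==> (f u != f v)]].

Lemma colorable_card (H : sgraph) : exists c, colorable H c.
Proof.
exists #|H|; apply/existsP; exists [ffun u => enum_rank u].
apply/forallP => u; apply/forallP => v; apply/implyP => uv.
rewrite !ffunE; apply/eqP => /enum_rank_inj uvE.
by move: uv; rewrite uvE adj_irrefl.
Qed.

Definition chromatic_number (H : sgraph) : nat := ex_minn (colorable_card H).

(* The canonical sigma-finite structure of a product of sigma-finite measures is
   shadowed in the library by the one of a product of probabilities. *)
Lemma sigma_finite_product d1 d2 (T1 : measurableType d1)
    (T2 : measurableType d2) (R : realType)
    (m1 : {sigma_finite_measure set T1 -> \bar R})
    (m2 : {sigma_finite_measure set T2 -> \bar R}) :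
  sigma_finite setT (m1 \x m2)%E.
Proof.
have /sigma_finiteP[F [TF ndF Foo]] := sigma_finiteT m1.
have /sigma_finiteP[G [TG ndG Goo]] := sigma_finiteT m2.
exists (fun n => F n `*` G n).
  rewrite -setXTT TF TG predeqE => -[x y]; split.
    move=> [/= [n _ Fnx] [k _ Gky]]; exists (maxn n k) => //; split.
    - by move: x Fnx; exact/subsetPset/ndF/leq_maxl.
    - by move: y Gky; exact/subsetPset/ndG/leq_maxr.
  by move=> [n _ []/= ? ?]; split; exists n.
move=> k; have [? ?] := Foo k; have [? ?] := Goo k.
split; first exact: measurableX.
by rewrite product_measure1E// lte_mul_pinfty// ge0_fin_numE.
Qed.

(* Lebesgue measure on R^n, carried by n-tuples: the Dirac mass on the unique
   0-tuple, then the product of the Lebesgue measure on R with the measure on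
   n-tuples, transported along (x, t) |-> x :: t.  lebesgue_tuple_box below
   is the usual characterization on boxes. *)
Section lebesgue_tuple.
Context (R : realType).
Local Notation mR := (measurableTypeR R).
Local Notation mu := (@lebesgue_measure R).

Definition cons_pair (n : nat) (p : mR * n.-tuple mR) : n.+1.-tuple mR :=
  [the n.+1.-tuple mR of p.1 :: p.2].

Lemma measurable_cons_pair n : measurable_fun setT (@cons_pair n).
Proof. exact: measurable_cons. Qed.

Definition lebesgue_nil : set (0.-tuple mR) -> \bar R := \d_ [tuple].

HB.instance Definition _ := Measure.on lebesgue_nil.

Let sigma_finite_nil : sigma_finite setT lebesgue_nil.
Proof.
apply: fin_num_fun_sigma_finite => [|A _]; first by rewrite measure0.
by rewrite /lebesgue_nil diracE.
Qed.

HB.instance Definition _ :=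
  Measure_isSigmaFinite.Build _ _ _ lebesgue_nil sigma_finite_nil.

Section cons_step.
Context (n : nat) (m : {sigma_finite_measure set (n.-tuple mR) -> \bar R}).

Definition lebesgue_cons : set (n.+1.-tuple mR) -> \bar R :=
  pushforward (mu \x m)%E (@cons_pair n).

Let mpre A : measurable A -> measurable (@cons_pair n @^-1` A).
Proof.
by move=> mA; rewrite -[X in measurable X]setTI; exact: measurable_cons_pair.
Qed.

Let lebesgue_cons0 : lebesgue_cons set0 = 0%E.
Proof. by rewrite /lebesgue_cons /pushforward preimage_set0 measure0. Qed.

Let lebesgue_cons_ge0 A : (0 <= lebesgue_cons A)%E.
Proof. by rewrite /lebesgue_cons /pushforward measure_ge0. Qed.

Let lebesgue_cons_sigma_additive : semi_sigma_additive lebesgue_cons.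
Proof.
move=> F mF tF mUF; rewrite /lebesgue_cons /pushforward preimage_bigcup.
apply: measure_semi_sigma_additive.
- by move=> i; exact: mpre.
- apply/trivIsetP => /= i j _ _ ij; rewrite -preimage_setI.
  by move/trivIsetP : tF => /(_ _ _ _ _ ij) ->//; rewrite preimage_set0.
- by rewrite -preimage_bigcup; exact: mpre.
Qed.

HB.instance Definition _ := isMeasure.Build _ _ _ lebesgue_cons
  lebesgue_cons0 lebesgue_cons_ge0 lebesgue_cons_sigma_additive.

Let sigma_finite_cons : sigma_finite setT lebesgue_cons.
Proof.
have [F TF Foo] := sigma_finite_product mu m.
pose uncons (t : n.+1.-tuple mR) : mR * n.-tuple mR :=
  (thead t, [tuple of behead t]).
have munc : measurable_fun setT uncons.
  apply/measurable_fun_pairP; split.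
    exact: (@measurable_tnth _ _ _ ord0).
  exact: measurable_behead.
have consK : cancel (@cons_pair n) uncons.
  by case=> x t; rewrite /uncons /cons_pair theadE; congr pair; exact: val_inj.
exists (fun k => uncons @^-1` F k).
  by rewrite -preimage_bigcup -TF preimage_setT.
move=> k; have [mFk Fkoo] := Foo k; split.
  by rewrite -[X in measurable X]setTI; exact: munc.
rewrite /lebesgue_cons /pushforward -comp_preimage.
by rewrite (_ : uncons \o _ = id) ?preimage_id//; apply/funext => p /=.
Qed.

HB.instance Definition _ :=
  Measure_isSigmaFinite.Build _ _ _ lebesgue_cons sigma_finite_cons.

End cons_step.

Fixpoint lebesgue_tuple (n : nat) :
    {sigma_finite_measure set (n.-tuple mR) -> \bar R} :=
  match n with
  | 0 => lebesgue_nil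
  | n'.+1 => lebesgue_cons (lebesgue_tuple n')
  end.

Lemma lebesgue_tuple_box (n : nat) (A : 'I_n -> set mR) :
  (forall i, measurable (A i)) ->
  lebesgue_tuple n [set t | forall i, A i (tnth t i)] = (\prod_i mu (A i))%E.
Proof.
elim: n A => [|n IHn] A mA.
  rewrite big_ord0 /= /lebesgue_nil diracE mem_set//.
  by case.
rewrite big_ord_recl -IHn//= /lebesgue_cons /pushforward.
rewrite -product_measure1E//; last first.
  rewrite (_ : mkset _ = \bigcap_(i in [set: 'I_n])
      ((fun t : n.-tuple mR => tnth t i) @^-1` A (lift ord0 i))).
    apply: fin_bigcap_measurable; first exact: finite_finset.
    by move=> i _; rewrite -[X in measurable X]setTI; exact: measurable_tnth.
  by apply/seteqP; split=> t /= tA => [i _|i]; exact: tA.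
congr (product_measure1 _ _ _); apply/seteqP; split=> -[x t] /=.
  move=> xtA; split; first by have := xtA ord0; rewrite /cons_pair tnth0.
  by move=> i; have := xtA (lift ord0 i); rewrite /cons_pair tnthS.
move=> [Ax At] i; have [j ->|->] := unliftP ord0 i.
  by rewrite /cons_pair tnthS; exact: At.
by rewrite /cons_pair tnth0.
Qed.

End lebesgue_tuple.

Section graphon.
Context (R : realType).

(* A graphon is carried by a function on R^2; only its restriction to [0, 1]^2
   is constrained, and only this restriction is used. *)
Record graphon : Type := Graphon {
  gfun :> R -> R -> R;
  gfun_measurable :
    measurable_fun
      [set p : measurableTypeR R * measurableTypeR R |
        p.1 \in `[0, 1] /\ p.2 \in `[0, 1]]
      (fun p => gfun p.1 p.2);
  gfun_itv : forall x y : R, x \in `[0, 1] -> y \in `[0, 1] ->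
    gfun x y \in `[0, 1];
  gfun_sym : forall x y : R, x \in `[0, 1] -> y \in `[0, 1] ->
    gfun x y = gfun y x }.

Definition unit_cube (n : nat) : set (n.-tuple (measurableTypeR R)) :=
  [set x | forall i, tnth x i \in `[0, 1]].

(* The coordinate x_v of a point x of the cube is the one of index
   enum_rank v. *)
Definition hom_density (H : sgraph) (W : graphon) : R :=
  \int[lebesgue_tuple R #|H|]_(x in @unit_cube #|H|)
    \prod_(p in edges H) W (tnth x (enum_rank p.1)) (tnth x (enum_rank p.2)).

Definition common (k : nat) (H : sgraph) : Prop :=
  forall W : 'I_k -> graphon,
    (forall x y : R, x \in `[0, 1] -> y \in `[0, 1] ->
      \sum_(i < k) W i x y = 1) ->
    (k%:R : R) ^ (1 - (#|edges H|)%:Z) <= \sum_(i < k) hom_density H (W i).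

End graphon.

(* Main.v *)
Require Import Defs.
From HB Require Import structures.
From mathcomp Require Import all_boot all_order all_algebra ring lra zify.
From mathcomp Require Import archimedean.

(** Write p = 1/k.  The graph H is a K_{n,n} together with n copies of a connected
    triangle-free graph G of chromatic number l (Mycielski's construction), each
    hanging by an edge from one of the n vertices of one side.  It is connected
    and has chromatic number l; the claim is that it is k-common once n is large.

    Finite reduction ([common_of_finite]).  Sampling N points turns graphons into
    matrices W_1, ..., W_k on a finite set X that add up to 1, and the density of
    H in a sample differs from the one in the graphon by O(1/N).  On X the
    density is a K_{n,n}-density [Knn] weighted on one side by g(x), the density
    of G with a pendant edge rooted at x ([fhom_attach]).

    Colours close to p ([common_local]).  Write W_i = p (1 + U_i), so that the U_i
    add up to 0, and suppose that the C_4-density of each U_i is tiny.  Jensen's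
    inequality bounds the density of H below by a power of the weighted
    C_4-density ([Knn_ge_C4]).  Expanding the latter, the linear term is a multiple
    of the edge density of U_i and a quadratic gain proportional to
    dev(U_i) = t(P_3, U_i) + t(C_4, U_i) is left over.  As G has no triangle, every
    subgraph of G with at least two edges is not a clique, and two of its
    nonadjacent vertices show that its density in U_i is O(dev(U_i))
    ([dens_bound]); so the second order errors caused by G are O(dev(U_i)) too.
    The gain enters with a factor of order n, hence beats these errors
    ([local_gain]).  What remains is linear in U_i, and cancels in the sum.

    Some colour far from p.  Now it suffices that a single colour has density at
    least k p^e(H), and as e(H) is about n^2 it suffices to find a colour j, a base
    larger than p whose n^2-th power bounds the K_{n,n}-density of W_j below, and
    losses exp(O(n log n)) only; but the vertices on the side of G must have g_j(x)
    not too small.  Sort the vertices x by the set J(x) of colours with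
    g_i(x) < delta, where delta is a negative power of n.

    If J(x) is empty for almost all x, a large C_4-density of some U_i produces a
    weighted box on which some colour j exceeds p by a constant factor
    ([dense_box]), and Sidorenko's inequality for K_{n,n} on that box concludes
    ([far_dense]).  Otherwise a set T of vertices of positive measure shares a
    nonempty J.  The colours of J contain few cliques inside T, so Ramsey's
    theorem, with bounds that are polynomial in n because only one side is large,
    yields many copies of K_{n,n} in T that the colours of J avoid
    ([ramsey_count]).  On these the other colours, at most k - 1 of them, add up to
    nearly 1, and one of them has a density of about (1/(k-1))^(n^2)
    ([clean_colour]), up to the allowed losses ([far_subset]). *)

Set Implicit Arguments.
Unset Strict Implicit.
Unset Printing Implicit Defensive.

Import Order.TTheory GRing.Theory Num.Theory.
Local Open Scope ring_scope.

(** * Averages over finite types *)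

(** Locked, so that unification never unfolds an average into a quotient. *)
HB.lock Definition avg (R : realFieldType) (T : finType) (f : T -> R) : R :=
  (\sum_x f x) / #|T|%:R.
Arguments avg {R T} f.

Section Average.
Context {R : realFieldType}.

Lemma avgE (T : finType) (f : T -> R) : avg f = (\sum_x f x) / #|T|%:R.
Proof. by rewrite avg.unlock. Qed.

Lemma eq_avg (T : finType) (f g : T -> R) : f =1 g -> avg f = avg g.
Proof. by move=> fg; rewrite !avgE (eq_bigr _ (fun x _ => fg x)). Qed.

Lemma avgD (T : finType) (f g : T -> R) :
  avg (fun x => f x + g x) = avg f + avg g.
Proof. by rewrite !avgE big_split mulrDl. Qed.

Lemma avgB (T : finType) (f g : T -> R) :
  avg (fun x => f x - g x) = avg f - avg g.
Proof. by rewrite !avgE sumrB mulrBl. Qed.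

Lemma avgZ (T : finType) (a : R) (f : T -> R) :
  avg (fun x => a * f x) = a * avg f.
Proof. by rewrite !avgE -mulr_sumr mulrA. Qed.

Lemma avgZr (T : finType) (a : R) (f : T -> R) :
  avg (fun x => f x * a) = avg f * a.
Proof. by rewrite mulrC -avgZ; apply: eq_avg => x; rewrite mulrC. Qed.

Lemma avg_sum (T : finType) (I : Type) (s : seq I) (P : pred I)
    (f : I -> T -> R) :
  avg (fun x => \sum_(i <- s | P i) f i x) = \sum_(i <- s | P i) avg (f i).
Proof.
rewrite avgE exchange_big /= mulr_suml.
by apply: eq_bigr => i _; rewrite avgE.
Qed.

Lemma avg_exchange (S T : finType) (f : S -> T -> R) :
  avg (fun x => avg (f x)) = avg (fun y => avg (f^~ y)).
Proof.
rewrite !avgE; under eq_bigr do rewrite avgE.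
under [in RHS]eq_bigr do rewrite avgE.
rewrite -!mulr_suml exchange_big /= -!mulrA; congr (_ * _).
exact: mulrC.
Qed.

Lemma ler_avg (T : finType) (f g : T -> R) :
  (forall x, f x <= g x) -> avg f <= avg g.
Proof.
by move=> fg; rewrite !avgE ler_wpM2r ?invr_ge0 ?ler0n// ler_sum.
Qed.

Lemma avg_ge0 (T : finType) (f : T -> R) : (forall x, 0 <= f x) -> 0 <= avg f.
Proof.
by move=> f0; rewrite !avgE mulr_ge0 ?invr_ge0 ?ler0n// sumr_ge0.
Qed.

Lemma ler_norm_avg (T : finType) (f : T -> R) :
  `|avg f| <= avg (fun x => `|f x|).
Proof.
rewrite !avgE normrM [`|_^-1|]ger0_norm ?invr_ge0 ?ler0n//.
by rewrite ler_wpM2r ?invr_ge0 ?ler0n// ler_norm_sum.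
Qed.

Lemma avg_cst (T : finType) (a : R) : (0 < #|T|)%N -> avg (fun _ : T => a) = a.
Proof.
move=> T0; rewrite !avgE sumr_const -[a *+ _]mulr_natr mulfK//.
by rewrite pnatr_eq0 -lt0n.
Qed.

Lemma avg_bij (S T : finType) (h : S -> T) (f : T -> R) :
  bijective h -> avg f = avg (fun x => f (h x)).
Proof.
move=> hb; rewrite !avgE (reindex h) ?(bij_eq_card hb)//.
exact: onW_bij.
Qed.

Lemma avg_pair (S T : finType) (f : S * T -> R) :
  avg f = avg (fun x => avg (fun y => f (x, y))).
Proof.
rewrite !avgE; under [in RHS]eq_bigr do rewrite avgE.
rewrite -mulr_suml card_prod natrM invfM mulrA pair_big /=.
by rewrite mulrAC; congr (_ * _ * _); apply: eq_bigr => -[].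
Qed.

Lemma avgM (S T : finType) (f : S -> R) (g : T -> R) :
  avg f * avg g = avg (fun x => avg (fun y => f x * g y)).
Proof.
by rewrite -avgZr; apply: eq_avg => x; rewrite avgZ.
Qed.

(** The coordinates of a uniform random map are independent. *)
Lemma avg_prod (I T : finType) (phi : I -> T -> R) :
  avg (fun f : {ffun I -> T} => \prod_i phi i (f i)) = \prod_i avg (phi i).
Proof.
rewrite avgE; under [in RHS]eq_bigr do rewrite avgE.
rewrite -bigA_distr_bigA /= card_ffun natrX.
by rewrite prodf_div prodr_const.
Qed.

Definition upd (I T : finType) (f : {ffun I -> T}) (z : I) (w : T) :
  {ffun I -> T} := [ffun i => if i == z then w else f i].

(** Resampling one coordinate of a uniform random map does not change its
    law: exchanging the old and the new value is an involution. *)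
Lemma avg_upd (I T : finType) (z : I) (F : {ffun I -> T} -> R) :
  (0 < #|T|)%N -> avg F = avg (fun f => avg (fun w => F (upd f z w))).
Proof.
move=> T0; pose h (p : {ffun I -> T} * T) := (upd p.1 z p.2, p.1 z).
have hK : involutive h.
  move=> [f w]; rewrite /h /= ffunE eqxx; congr pair.
  by apply/ffunP => i; rewrite !ffunE; case: eqP => [->|].
transitivity (avg (fun p : {ffun I -> T} * T => F p.1)).
  by rewrite avg_pair; apply: eq_avg => f; rewrite /= avg_cst.
rewrite (avg_bij _ (inv_bij hK)) avg_pair.
by [].
Qed.

Lemma bernoulli_ineq (x : R) n : 0 <= x -> 1 + n%:R * (x - 1) <= x ^+ n.
Proof.
move=> x0; elim: n => [|n IHn]; first by rewrite mul0r addr0.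
have n0 : (0 : R) <= n%:R by [].
have nx0 : 0 <= n%:R * (x - 1) ^+ 2 by rewrite mulr_ge0// sqr_ge0.
rewrite exprS -natr1.
have [h|h] := leP 0 (1 + n%:R * (x - 1)).
  have : x * (1 + n%:R * (x - 1)) <= x * x ^+ n by rewrite ler_wpM2l.
  by lra.
have : 0 <= x * x ^+ n by rewrite mulr_ge0// exprn_ge0.
have [x1|x1] := leP 1 x; last by lra.
suff : 0 <= n%:R * (x - 1) by lra.
by rewrite mulr_ge0// subr_ge0.
Qed.

(** The graph of a power lies above its tangents; this is the only convexity
    that enters the Jensen inequalities below. *)
Lemma tangent_expn (x m : R) n : 0 <= x -> 0 < m ->
  m ^+ n + n%:R * m ^+ n.-1 * (x - m) <= x ^+ n.
Proof.
move=> x0 m0; case: n => [|n]; first by rewrite !mul0r addr0.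
have := @bernoulli_ineq (x / m) n.+1 (divr_ge0 x0 (ltW m0)).
rewrite expr_div_n ler_pdivlMr ?exprn_gt0// => /(le_trans _); apply.
rewrite le_eqVlt; apply/orP; left; apply/eqP => /=; rewrite exprS; field.
by rewrite gt_eqF.
Qed.

(** Jensen's inequality for a power and an unnormalised weight. *)
Lemma power_mean (T : finType) (w f : T -> R) n :
  (forall x, 0 <= w x) -> (forall x, 0 <= f x) -> 0 < avg w ->
  avg w * (avg (fun x => w x * f x) / avg w) ^+ n <=
  avg (fun x => w x * f x ^+ n).
Proof.
move=> w0 f0 W0; set W := avg w; set m := avg _ / W.
have : 0 <= m.
  apply: divr_ge0; last exact: ltW.
  by apply: avg_ge0 => x; rewrite mulr_ge0.
rewrite le_eqVlt => /predU1P[m0|m0].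
  rewrite -m0; case: n => [|n]; last first.
    by rewrite expr0n /= mulr0; apply: avg_ge0 => x; rewrite mulr_ge0 ?exprn_ge0.
  by rewrite expr0 mulr1; apply: ler_avg => x; rewrite expr0 mulr1.
apply: le_trans (_ : avg (fun x => w x * (m ^+ n + n%:R * m ^+ n.-1 * (f x - m)))
   <= _); last first.
  by apply: ler_avg => x; rewrite ler_wpM2l// tangent_expn.
rewrite (_ : avg _ = avg (fun x => w x * (m ^+ n - n%:R * m ^+ n.-1 * m) +
    n%:R * m ^+ n.-1 * (w x * f x))); last first.
  by apply: eq_avg => x; ring.
rewrite avgD avgZr avgZ -/W (_ : avg (fun x => w x * f x) = m * W); last first.
  by rewrite /m divfK ?gt_eqF.
by rewrite le_eqVlt; apply/orP; left; apply/eqP; ring.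
Qed.

Lemma jensen_sqr (T : finType) (f : T -> R) :
  avg f ^+ 2 <= avg (fun x => f x ^+ 2).
Proof.
have [T0|T0] := posnP #|T|.
  by rewrite !avgE T0 invr0 !mulr0 expr0n.
have: 0 <= avg (fun x => (f x - avg f) ^+ 2) by apply: avg_ge0 => x; exact: sqr_ge0.
rewrite (_ : avg _ = avg (fun x => f x ^+ 2 - (2 * avg f) * f x + avg f ^+ 2)).
  by rewrite avgD avgB avgZ avg_cst//; nra.
by apply: eq_avg => x; ring.
Qed.

End Average.

Section RandomMaps.
Context {R : realFieldType}.

Lemma avg_prod_inj (Y I X : finType) (sigma : Y -> I) (psi : Y -> X -> R) :
  (0 < #|X|)%N -> injective sigma ->
  avg (fun f : {ffun I -> X} => \prod_y psi y (f (sigma y))) = \prod_y avg (psi y).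
Proof.
move=> X0 sI.
transitivity (avg (fun f : {ffun I -> X} => \prod_i \prod_(y | sigma y == i) psi y (f i))).
  apply: eq_avg => f; rewrite (partition_big sigma xpredT)//=.
  by apply: eq_bigr => i _; apply: eq_bigr => y /eqP->.
rewrite (avg_prod (fun i x => \prod_(y | sigma y == i) psi y x)).
rewrite [RHS](partition_big sigma xpredT)//=; apply: eq_bigr => i _.
case: (pickP (fun y => sigma y == i)) => [y /eqP yi|none]; last first.
  rewrite big_pred0// (eq_avg (g := fun=> 1)) ?avg_cst// => x.
  by rewrite big_pred0.
have one : (fun z => sigma z == i) =1 pred1 y.
  by move=> z; rewrite -yi (inj_eq sI).
rewrite (big_pred1 y)//; apply: eq_avg => x.
by rewrite (big_pred1 y).
Qed.

(** The restriction of a uniform random map along an injection is uniform. *)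
Lemma avg_inj (Y I X : finType) (sigma : Y -> I) (phi : {ffun Y -> X} -> R) :
  (0 < #|X|)%N -> injective sigma ->
  avg (fun f : {ffun I -> X} => phi [ffun y => f (sigma y)]) = avg phi.
Proof.
move=> X0 sI.
transitivity (\sum_(h : {ffun Y -> X}) phi h *
   avg (fun f : {ffun I -> X} => \prod_y (h y == f (sigma y))%:R)).
  rewrite -(eq_bigr _ (fun h _ => avgZ (phi h) _)) -avg_sum; apply: eq_avg => f.
  rewrite (bigD1 [ffun y => f (sigma y)])//= big1 ?mulr1 => [|y _]; last first.
    by rewrite ffunE eqxx.
  rewrite big1 ?addr0// => h hf.
  have [y hy] : exists y, h y != f (sigma y).
    apply/existsP; apply: contraR hf => /existsPn H; apply/eqP/ffunP => y.
    by rewrite ffunE; apply/eqP; rewrite -[_ == _]negbK H.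
  by rewrite (bigD1 y)//= (negbTE hy) mul0r mulr0.
rewrite avgE mulr_suml; apply: eq_bigr => h _; congr (_ * _).
rewrite (avg_prod_inj (fun y x => (h y == x)%:R) X0 sI).
rewrite (eq_bigr (fun=> #|X|%:R^-1)) => [|y _].
  by rewrite prodr_const card_ffun natrX exprVn.
rewrite avgE (bigD1 (h y))//= eqxx big1 ?addr0 ?mul1r// => x.
by rewrite eq_sym => /negbTE->.
Qed.

Lemma avg_ffun_sum (A C X : finType) (phi : {ffun A + C -> X} -> R) :
  avg phi = avg (fun x : {ffun A -> X} => avg (fun y : {ffun C -> X} =>
    phi [ffun s => match s with inl a => x a | inr c => y c end])).
Proof.
pose h (p : {ffun A -> X} * {ffun C -> X}) : {ffun A + C -> X} :=
  [ffun s => match s with inl a => p.1 a | inr c => p.2 c end].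
pose h' (f : {ffun A + C -> X}) : {ffun A -> X} * {ffun C -> X} :=
  ([ffun a => f (inl a)], [ffun c => f (inr c)]).
have hb : bijective h.
  exists h' => [[x y]|f]; last by apply/ffunP => -[a|c]; rewrite !ffunE.
  by congr pair; apply/ffunP => a; rewrite !ffunE.
by rewrite (avg_bij _ hb) avg_pair.
Qed.

(** Restricting an average of nonnegative terms to a subset costs the relative
    size of the subset. *)
Lemma avg_sub (S X : finType) (j : S -> X) (phi : X -> R) : injective j ->
  (forall x, 0 <= phi x) ->
  #|S|%:R / #|X|%:R * avg (fun x => phi (j x)) <= avg phi.
Proof.
move=> jI phi0; rewrite !avgE.
have [S0|S0] := posnP #|S|.
  by rewrite S0 !mul0r divr_ge0// sumr_ge0.
rewrite mulrAC mulrCA divff ?mulr1 ?pnatr_eq0 -?lt0n//.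
rewrite ler_wpM2r ?invr_ge0// -(big_imset phi (A := S)) /=; last exact: in2W.
by rewrite [leRHS](bigID (mem (j @: S))) /= lerDl sumr_ge0.
Qed.

Lemma avg_sub_ffun (I S X : finType) (j : S -> X) (phi : {ffun I -> X} -> R) :
  injective j -> (forall f, 0 <= phi f) ->
  (#|S|%:R / #|X|%:R) ^+ #|I| *
     avg (fun f : {ffun I -> S} => phi [ffun i => j (f i)]) <= avg phi.
Proof.
move=> jI phi0; pose J (f : {ffun I -> S}) : {ffun I -> X} := [ffun i => j (f i)].
have JI : injective J.
  by move=> f f' /ffunP E; apply/ffunP => i; apply: jI; have := E i; rewrite !ffunE.
by have := avg_sub JI phi0; rewrite !card_ffun !natrX -expr_div_n.
Qed.

Lemma avg_ffun_option (V X : finType) (phi : {ffun option V -> X} -> R) :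
  avg phi = avg (fun x => avg (fun f : {ffun V -> X} =>
    phi [ffun o => if o is Some v then f v else x])).
Proof.
pose h (p : X * {ffun V -> X}) : {ffun option V -> X} :=
  [ffun o => if o is Some v then p.2 v else p.1].
have hb : bijective h.
  exists (fun f : {ffun option V -> X} => (f None, [ffun v => f (Some v)])).
    by move=> [x f]; congr pair; rewrite ?ffunE//; apply/ffunP => v; rewrite !ffunE.
  by move=> f; apply/ffunP => -[v|]; rewrite !ffunE.
by rewrite (avg_bij _ hb) avg_pair.
Qed.

Lemma avg_curry (A C X : finType) (phi : A -> {ffun C -> X} -> R) :
  avg (fun h : {ffun A * C -> X} => \prod_a phi a [ffun c => h (a, c)]) =
  \prod_a avg (phi a).
Proof.
pose h (f : {ffun A -> {ffun C -> X}}) : {ffun A * C -> X} := [ffun p => f p.1 p.2].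
have hb : bijective h.
  exists (fun f : {ffun A * C -> X} => [ffun a => [ffun c => f (a, c)]]) => f.
    by apply/ffunP => a; apply/ffunP => c; rewrite !ffunE.
  by apply/ffunP => -[a c]; rewrite !ffunE.
rewrite (avg_bij _ hb) -avg_prod; apply: eq_avg => f; apply: eq_bigr => a _.
by congr (phi a _); apply/ffunP => c; rewrite !ffunE.
Qed.

End RandomMaps.

(** * Densities of complete bipartite graphs *)

Section Bipartite.
Context {R : realFieldType} {X : finType}.
Implicit Types (w : X -> X -> R) (f g h : X -> R).

(** The density of K_{n,n} when the n vertices x of one side carry the weight
    g x: independent given the other side y, they contribute an n-th power. *)
Definition Knn n g w : R :=
  avg (fun y : {ffun 'I_n -> X} => (avg (fun x => g x * \prod_b w x (y b))) ^+ n).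

Definition codeg w x x' : R := avg (fun y => w x y * w x' y).

Definition wC4 g w : R :=
  avg (fun x => avg (fun x' => g x * g x' * codeg w x x' ^+ 2)).

Lemma avg_nonempty g : 0 < avg g -> (0 < #|X|)%N.
Proof. by case: posnP => // X0; rewrite avgE X0 invr0 mulr0 ltxx. Qed.

Lemma power_mean1 (T : finType) (f : T -> R) n : (0 < #|T|)%N ->
  (forall x, 0 <= f x) -> avg f ^+ n <= avg (fun x => f x ^+ n).
Proof.
move=> T0 f0; have := @power_mean _ T (fun=> 1) f n (fun=> ler01) f0.
rewrite avg_cst// mul1r divr1 => /(_ ltr01).
by congr (_ ^+ _ <= _); apply: eq_avg => x; rewrite mul1r.
Qed.

(** Jensen's inequality on each side in turn reduces K_{n,n} to K_{2,n} and then
    to C_4; the weights stay on the first side throughout.  With n = 4 s,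
    the exponents are those of the n^2/4 copies of C_4 that make up K_{n,n}. *)
Lemma Knn_ge_C4 g w s : (forall x, 0 <= g x) -> (forall x y, 0 <= w x y) ->
  0 < avg g ->
  (avg g * (wC4 g w / avg g ^+ 2) ^+ s) ^+ (4 * s) <= Knn (4 * s) g w.
Proof.
move=> g0 w0 G0; have X0 := avg_nonempty G0.
set n := (4 * s)%N; set m := (2 * s)%N; set G := avg g; set S := wC4 g w.
have nE : n = (2 * m)%N by rewrite /n /m mulnA.
pose H (y : {ffun 'I_n -> X}) := avg (fun x => g x * \prod_b w x (y b)).
have H2 : avg (fun y => H y ^+ 2) =
    avg (fun p : X * X => g p.1 * g p.2 * (codeg w p.1 p.2 ^+ 2) ^+ m).
  rewrite avg_pair /=.
  transitivity (avg (fun y : {ffun 'I_n -> X} => avg (fun x => avg (fun x' =>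
      g x * g x' * \prod_b (w x (y b) * w x' (y b)))))).
    apply: eq_avg => y; rewrite expr2 avgM; apply: eq_avg => x; apply: eq_avg => x'.
    by rewrite big_split /=; ring.
  rewrite [LHS]avg_exchange; apply: eq_avg => x /=; rewrite [LHS]avg_exchange; apply: eq_avg => x' /=.
  by rewrite avgZ (avg_prod (fun _ z => w x z * w x' z)) prodr_const card_ord -exprM -nE.
have H2ge : G ^+ 2 * (S / G ^+ 2) ^+ m <= avg (fun y => H y ^+ 2).
  have GE : avg (fun p : X * X => g p.1 * g p.2) = G ^+ 2.
    by rewrite avg_pair expr2 avgM.
  rewrite H2; have := @power_mean _ _ (fun p : X * X => g p.1 * g p.2)
    (fun p => codeg w p.1 p.2 ^+ 2) m.
  rewrite GE [avg (fun x => _ * _ ^+ 2)]avg_pair; apply=> [p|p|].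
  - by rewrite mulr_ge0.
  - exact: sqr_ge0.
  - by rewrite exprn_gt0.
have S0 : 0 <= S.
  by apply: avg_ge0 => x; apply: avg_ge0 => x'; rewrite mulr_ge0 ?sqr_ge0 ?mulr_ge0.
apply: (@le_trans _ _ ((G ^+ 2 * (S / G ^+ 2) ^+ m) ^+ m)).
  have expE (a z : R) : (a * z ^+ s) ^+ n = (a ^+ 2 * z ^+ m) ^+ m.
    by rewrite exprMn [RHS]exprMn -!exprM nE /m; congr (_ ^+ _ * _ ^+ _); lia.
  by rewrite expE.
apply: (@le_trans _ _ (avg (fun y => H y ^+ 2) ^+ m)).
  rewrite lerXn2r// nnegrE; first by rewrite mulr_ge0 ?sqr_ge0// exprn_ge0// divr_ge0// sqr_ge0.
  by apply: avg_ge0 => y; rewrite sqr_ge0.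
have -> : Knn n g w = avg (fun y => (H y ^+ 2) ^+ m).
  by apply: eq_avg => y; rewrite -exprM -nE.
apply: power_mean1 => [|y]; last by rewrite sqr_ge0.
by rewrite card_ffun expn_gt0 X0.
Qed.

(** Sidorenko's inequality for K_{n,n} on a weighted box, again by Jensen's
    inequality on each side. *)
Lemma Knn_ge_box f h w n : (forall x, 0 <= f x) -> (forall x, 0 <= h x) ->
  (forall x y, 0 <= w x y) -> 0 < avg f -> 0 < avg h ->
  (avg f * avg h) ^+ n *
    (avg (fun x => f x * avg (fun y => h y * w x y)) / (avg f * avg h)) ^+ (n * n)
  <= avg (fun y : {ffun 'I_n -> X} => (\prod_b h (y b)) *
        (avg (fun x => f x * \prod_b w x (y b))) ^+ n).
Proof.
move=> f0 h0 w0 F0 H0; set F := avg f; set H := avg h; set Q := avg _.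
have HnE : avg (fun y : {ffun 'I_n -> X} => \prod_b h (y b)) = H ^+ n.
  by rewrite (avg_prod (fun _ => h)) prodr_const card_ord.
pose A (y : {ffun 'I_n -> X}) := avg (fun x => f x * \prod_b w x (y b)).
have A0 y : 0 <= A y by apply: avg_ge0 => x; rewrite mulr_ge0// prodr_ge0.
have q0 x : 0 <= avg (fun y => h y * w x y).
  by apply: avg_ge0 => y; rewrite mulr_ge0.
have PM : H ^+ n * (avg (fun y : {ffun 'I_n -> X} => \prod_b h (y b) * A y) /
    H ^+ n) ^+ n <= avg (fun y : {ffun 'I_n -> X} => \prod_b h (y b) * A y ^+ n).
  rewrite -HnE; apply: power_mean => // [y|]; first by rewrite prodr_ge0.
  by rewrite HnE exprn_gt0.
apply: le_trans PM.
have -> : avg (fun y : {ffun 'I_n -> X} => \prod_b h (y b) * A y) =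
    avg (fun x => f x * avg (fun y => h y * w x y) ^+ n).
  transitivity (avg (fun y : {ffun 'I_n -> X} => avg (fun x =>
      f x * \prod_b (h (y b) * w x (y b))))).
    apply: eq_avg => y; rewrite -avgZ; apply: eq_avg => x.
    by rewrite big_split /=; ring.
  rewrite [LHS]avg_exchange; apply: eq_avg => x.
  by rewrite avgZ (avg_prod (fun _ z => h z * w x z)) prodr_const card_ord.
have FQ := power_mean n f0 q0 F0.
rewrite -/F -/Q in FQ.
apply: (@le_trans _ _ (H ^+ n * (F * (Q / F) ^+ n / H ^+ n) ^+ n)).
  rewrite le_eqVlt; apply/orP; left; apply/eqP.
  rewrite (_ : F * (Q / F) ^+ n / H ^+ n = F * (Q / (F * H)) ^+ n); last first.
    by rewrite -mulrA -expr_div_n; congr (_ * _ ^+ _); field; rewrite !gt_eqF.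
  have expE (a b q : R) : (a * b) ^+ n * q ^+ (n * n) = b ^+ n * (a * q ^+ n) ^+ n.
    by rewrite !exprMn -exprM mulrCA mulrA.
  exact: expE.
rewrite ler_wpM2l ?exprn_ge0 ?(ltW H0)// lerXn2r// ?nnegrE.
- apply: divr_ge0; last by rewrite exprn_ge0// ltW.
  apply: mulr_ge0; first exact: ltW.
  apply/exprn_ge0/divr_ge0; last exact: ltW.
  by apply: avg_ge0 => x; rewrite mulr_ge0.
- apply: divr_ge0; last by rewrite exprn_ge0// ltW.
  by apply: avg_ge0 => x; rewrite mulr_ge0 ?exprn_ge0.
- by rewrite ler_wpM2r// invr_ge0 exprn_ge0// ltW.
Qed.

Lemma prod_le_sum_expn n (z : 'I_n -> R) : (0 < n)%N -> (forall a, 0 <= z a) ->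
  \prod_a z a <= \sum_a z a ^+ n.
Proof.
case: n z => // n z _ z0.
pose m := [arg max_(i > (ord0 : 'I_n.+1)) z i]%O.
have zm i : z i <= z m by rewrite /m; case: arg_maxP => // j _; apply.
apply: (@le_trans _ _ (z m ^+ n.+1)).
  rewrite -[X in _ ^+ X]card_ord -prodr_const; apply: ler_prod => i _.
  by rewrite z0 zm.
by rewrite (bigD1 m)//= lerDl sumr_ge0// => i _; rewrite exprn_ge0.
Qed.

(** A mixed K_{n,n}, whose edges are taken in various colours, is dominated by
    the monochromatic ones: a crude form of Hatami's Hölder inequality. *)
Lemma mixed_Knn (C : finType) (w : C -> X -> X -> R) n (phi : 'I_n -> 'I_n -> C) :
  (0 < n)%N -> (forall c x y, 0 <= w c x y) ->
  (forall c x y, w c x y = w c y x) ->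
  avg (fun x : {ffun 'I_n -> X} => avg (fun y : {ffun 'I_n -> X} =>
    \prod_a \prod_b w (phi a b) (x a) (y b)))
  <= \sum_a \sum_b Knn n (fun=> 1) (w (phi a b)).
Proof.
move=> n0 w0 wC; rewrite avg_exchange.
apply: (@le_trans _ _ (\sum_a avg (fun y : {ffun 'I_n -> X} =>
    avg (fun x => \prod_b w (phi a b) x (y b)) ^+ n))).
  rewrite -avg_sum; apply: ler_avg => y.
  rewrite (avg_prod (fun a x => \prod_b w (phi a b) x (y b))).
  by apply: prod_le_sum_expn => // a; apply: avg_ge0 => x; rewrite prodr_ge0.
apply: ler_sum => a _.
have -> : avg (fun y : {ffun 'I_n -> X} =>
    avg (fun x => \prod_b w (phi a b) x (y b)) ^+ n) =
  avg (fun x : {ffun 'I_n -> X} =>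
    \prod_b avg (fun y => \prod_a' w (phi a b) (x a') y)).
  transitivity (avg (fun y : {ffun 'I_n -> X} => avg (fun x : {ffun 'I_n -> X} =>
      \prod_a' \prod_b w (phi a b) (x a') (y b)))).
    apply: eq_avg => y.
    by rewrite (avg_prod (fun _ x => \prod_b w (phi a b) x (y b))) prodr_const card_ord.
  rewrite [LHS]avg_exchange; apply: eq_avg => x.
  rewrite -(avg_prod (fun b y => \prod_a' w (phi a b) (x a') y)).
  by apply: eq_avg => y; rewrite exchange_big.
rewrite /Knn -avg_sum; apply: ler_avg => x.
apply: (le_trans (prod_le_sum_expn n0 _)) => [b|].
  by apply: avg_ge0 => y; rewrite prodr_ge0.
apply: ler_sum => b _; rewrite lerXn2r// ?nnegrE.
- by apply: avg_ge0 => y; rewrite prodr_ge0.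
- by apply: avg_ge0 => y; rewrite mul1r prodr_ge0.
- apply: ler_avg => y; rewrite mul1r le_eqVlt; apply/orP; left; apply/eqP.
  by apply: eq_bigr => a' _; rewrite wC.
Qed.

End Bipartite.

(** * Densities of graphs in a small perturbation *)

Section Densities.
Context {R : realFieldType} {V X : finType}.
Implicit Types (E F : {set V * V}) (w : X -> X -> R) (f : {ffun V -> X}).

(** Every edge is listed in exactly one of its two directions, so that a product
    over E runs once over each edge. *)
Definition oriented E := forall u v, (u, v) \in E -> u != v /\ (v, u) \notin E.

Definition wt E w f : R := \prod_(p in E) w (f p.1) (f p.2).
Definition dens E w : R := avg (wt E w).
Definition rdens E w r x : R := avg (fun f => wt E w (upd f r x)).

Lemma avg_rdens E w r : (0 < #|X|)%N -> avg (rdens E w r) = dens E w.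
Proof. by move=> X0; rewrite /dens (avg_upd r _ X0) avg_exchange. Qed.

Lemma orientedS E F : F \subset E -> oriented E -> oriented F.
Proof.
move=> /subsetP FE oE u v /FE/oE[-> vu]; split=> //.
by apply: contra vu => /FE.
Qed.

Definition inc (z : V) (p : V * V) := (p.1 == z) || (p.2 == z).
Definition other (z : V) (p : V * V) := if p.1 == z then p.2 else p.1.
Definition linked F u v := ((u, v) \in F) || ((v, u) \in F).

Lemma linked_neq F u v : oriented F -> linked F u v -> u != v.
Proof. by move=> oF /orP[/oF[]//|/oF[]]; rewrite eq_sym. Qed.

Lemma linkedS E F u v : F \subset E -> linked F u v -> linked E u v.
Proof. by move=> /subsetP FE /orP[] /FE; rewrite /linked => -> //; rewrite orbT. Qed.

Lemma other_linked F z p : p \in F -> inc z p -> linked F z (other z p).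
Proof.
case: p => a b pF; rewrite /inc /other /linked /=.
by have [<-|_ /= /eqP<-] := eqVneq a z; rewrite pF ?orbT.
Qed.

Lemma other_inj F z : oriented F -> {in [pred p in F | inc z p] &, injective (other z)}.
Proof.
move=> oF [a b] [c d]; rewrite !inE /inc /other /= => /andP[abF abz] /andP[cdF cdz].
case: (eqVneq a z) (eqVneq c z) abz cdz abF cdF => [->|az] [->|cz] //=.
- by move=> _ _ _ _ ->.
- by move=> _ /eqP-> zb cz' bc; move: (oF _ _ zb) => [_]; rewrite bc cz'.
- by move=> /eqP-> _ az' zd ad; move: (oF _ _ zd) => [_]; rewrite -ad az'.
- by move=> /eqP-> /eqP-> _ _ ->.
Qed.

(** Two vertices of F that are joined by no edge of F exist unless F is a
    clique, and a clique with two edges contains a triangle. *)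
Lemma unlinked_vertices E F : oriented E -> F \subset E ->
  (forall a b c, linked E a b -> linked E b c -> ~~ linked E a c) ->
  (1 < #|F|)%N ->
  exists z z', [/\ z != z', ~~ linked F z z',
    exists2 p, p \in F & inc z p & exists2 p, p \in F & inc z' p].
Proof.
move=> oE FE tE /card_gt1P[[a b] [[c d] [abF cdF ne]]].
have oF := orientedS FE oE.
have ab : linked F a b by rewrite /linked abF.
have cd : linked F c d by rewrite /linked cdF.
have [x [xa xb [q qF qx]]] : exists x, [/\ x != a, x != b & exists2 p, p \in F & inc x p].
  have [ca|ca] := eqVneq c a; last have [cb|cb] := eqVneq c b.
  - subst c; exists d; split; last by exists (a, d) => //; rewrite /inc eqxx orbT.
    + by rewrite eq_sym (linked_neq oF cd).
    + by apply: contra ne => /eqP->.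
  - subst c; exists d; split; last by exists (b, d) => //; rewrite /inc eqxx orbT.
    + by apply: contraTneq cdF => ->; case: (oF _ _ abF).
    + by rewrite eq_sym (linked_neq oF cd).
  - by exists c; split=> //; exists (c, d) => //; rewrite /inc eqxx.
have [ax|ax] := boolP (linked F a x); last first.
  exists a, x; split=> //; first by rewrite eq_sym.
    by exists (a, b) => //; rewrite /inc eqxx.
  by exists q.
exists b, x; split=> //; first by rewrite eq_sym.
- apply/negP => /(linkedS FE) bx; move: (tE _ _ _ (linkedS FE ab) bx).
  by rewrite (linkedS FE ax).
- by exists (a, b) => //; rewrite /inc eqxx orbT.
- by exists q.
Qed.

Section Bounds.
Variables (U : X -> X -> R) (B : R).
Hypotheses (X0 : (0 < #|X|)%N) (B1 : 1 <= B).
Hypotheses (UC : forall x y, U x y = U y x) (UB : forall x y, `|U x y| <= B).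

Definition deg x : R := avg (U x).

(** The squared degrees and the density of C_4 in U: together they dominate the
    density in U of every graph with two nonadjacent vertices of positive degree. *)
Definition dev : R :=
  avg (fun x => deg x ^+ 2) + avg (fun x => avg (fun x' => codeg U x x' ^+ 2)).

Let B0 : 0 <= B. Proof. exact: le_trans ler01 B1. Qed.

Lemma sqr_deg_ge0 : 0 <= avg (fun x => deg x ^+ 2).
Proof. by apply: avg_ge0 => x; rewrite sqr_ge0. Qed.

Lemma sqr_codeg_ge0 : 0 <= avg (fun x => avg (fun x' => codeg U x x' ^+ 2)).
Proof. by apply: avg_ge0 => x; apply: avg_ge0 => y; rewrite sqr_ge0. Qed.

Lemma dev_ge0 : 0 <= dev.
Proof. by rewrite addr_ge0 ?sqr_deg_ge0 ?sqr_codeg_ge0. Qed.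

Lemma codeg_bound x y : `|codeg U x y| <= B ^+ 2.
Proof.
apply: le_trans (ler_norm_avg _) _; rewrite -[leRHS](@avg_cst _ X _ X0).
by apply: ler_avg => z; rewrite normrM expr2 ler_pM.
Qed.

Lemma avg_codeg : avg (fun x => avg (codeg U x)) = avg (fun x => deg x ^+ 2).
Proof.
transitivity (avg (fun x => avg (fun z => U x z * deg z))).
  apply: eq_avg => x; rewrite /codeg avg_exchange; apply: eq_avg => z.
  by rewrite avgZ; congr (_ * _); apply: eq_avg => y.
rewrite avg_exchange; apply: eq_avg => z.
by rewrite avgZr expr2; congr (_ * _); apply: eq_avg => y.
Qed.

Lemma avg_codeg_expn r : (0 < r)%N ->
  avg (fun x => avg (fun y => codeg U x y ^+ r)) <= B ^+ (2 * r) * dev.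
Proof.
case: r => [//|[_|r _]].
  rewrite (_ : avg _ = avg (fun x => deg x ^+ 2)).
    apply: (@le_trans _ _ dev); first by rewrite lerDl sqr_codeg_ge0.
    by rewrite ler_peMl ?dev_ge0// exprn_ege1.
  by rewrite -avg_codeg.
apply: (@le_trans _ _ (B ^+ (2 * r) * dev)); last first.
  by rewrite ler_wpM2r ?dev_ge0// ler_weXn2l//; lia.
apply: (@le_trans _ _ (B ^+ (2 * r) *
    avg (fun x => avg (fun y => codeg U x y ^+ 2)))); last first.
  by rewrite ler_wpM2l ?exprn_ge0// lerDr sqr_deg_ge0.
rewrite -avgZ; apply: ler_avg => x; rewrite -avgZ; apply: ler_avg => y.
rewrite -addn2 exprD ler_wpM2r ?sqr_ge0//.
apply: le_trans (ler_norm _) _; rewrite normrX exprM lerXn2r ?nnegrE//.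
  by rewrite exprn_ge0.
exact: codeg_bound.
Qed.

Definition staravg F z f : R :=
  avg (fun x => \prod_(p in F | inc z p) U x (f (other z p))).

Lemma wt_upd F z f x : oriented F ->
  wt F U (upd f z x) = (\prod_(p in F | ~~ inc z p) U (f p.1) (f p.2)) *
                       \prod_(p in F | inc z p) U x (f (other z p)).
Proof.
move=> oF; rewrite /wt (bigID (inc z)) /= mulrC; congr (_ * _).
  apply: eq_bigr => p /andP[_]; rewrite negb_or => /andP[p1 p2].
  by rewrite !ffunE (negbTE p1) (negbTE p2).
apply: eq_bigr => -[a b] /andP[abF abz]; rewrite !ffunE /other /=.
have [az|az] := eqVneq a z.
  by subst z; rewrite eq_sym (negbTE (oF _ _ abF).1).
by move: abz; rewrite /inc /= (negbTE az) /= => bz; rewrite bz UC.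
Qed.

(** Squaring doubles z: the neighbours of z become common neighbours of its two
    copies, which leaves a power of the codegree. *)
Lemma staravg_sqr F z : oriented F -> (exists2 p, p \in F & inc z p) ->
  avg (fun f => staravg F z f ^+ 2) <=
  B ^+ (2 * #|[set p in F | inc z p]|) * dev.
Proof.
move=> oF [p0 p0F zp0]; set I := [set p in F | inc z p].
have I0 : (0 < #|I|)%N by apply/card_gt0P; exists p0; rewrite inE p0F.
apply: le_trans (avg_codeg_expn I0); rewrite le_eqVlt; apply/orP; left; apply/eqP.
transitivity (avg (fun x => avg (fun y => avg (fun f =>
    \prod_(p in F | inc z p) (U x (f (other z p)) * U y (f (other z p))))))).
  transitivity (avg (fun f => avg (fun x => avg (fun y =>
    \prod_(p in F | inc z p) (U x (f (other z p)) * U y (f (other z p))))))).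
    apply: eq_avg => f; rewrite expr2 avgM.
    by apply: eq_avg => x; apply: eq_avg => y; rewrite big_split.
  by rewrite [LHS]avg_exchange; apply: eq_avg => x; rewrite [LHS]avg_exchange.
apply: eq_avg => x; apply: eq_avg => y.
have injI : {in I &, injective (other z)}.
  move=> p q; rewrite !inE => pI qI; exact: (other_inj oF pI qI).
transitivity (avg (fun f : {ffun V -> X} =>
    \prod_v (if v \in other z @: I then U x (f v) * U y (f v) else 1))).
  apply: eq_avg => f; rewrite -big_mkcond big_imset//=.
  by apply: eq_bigl => p; rewrite inE.
rewrite (avg_prod (fun v t => if v \in other z @: I then U x t * U y t else 1)).
rewrite (bigID (mem (other z @: I))) /= [X in _ * X]big1 ?mulr1; last first.
  by move=> v /negbTE->; rewrite avg_cst.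
rewrite (eq_bigr (fun=> codeg U x y)) ?prodr_const ?card_in_imset//.
by move=> v ->.
Qed.

Lemma prod_bound (P : pred (V * V)) f :
  `|\prod_(p | P p) U (f p.1) (f p.2)| <= B ^+ #|[set p | P p]|.
Proof.
rewrite normr_prod -prodr_const (eq_bigl (fun p => p \in [set p | P p])); last first.
  by move=> p; rewrite inE.
by apply: ler_prod => p _; rewrite normr_ge0 UB.
Qed.

Lemma card_inc F z :
  (#|[set p | (p \in F) && ~~ inc z p]| + #|[set p in F | inc z p]| = #|F|)%N.
Proof.
rewrite addnC -cardsUI (_ : _ :&: _ = set0) ?cards0 ?addn0.
  by apply: eq_card => p; rewrite !inE -andb_orr orbN andbT.
by apply/setP => p; rewrite !inE; case: (inc z p); rewrite ?andbF.
Qed.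

(** A nonempty F has an edge with an endpoint z other than the root; Jensen's
    inequality isolates the edges at z. *)
Lemma rdens_sqr F r : oriented F -> (0 < #|F|)%N ->
  avg (fun x => rdens F U r x ^+ 2) <= B ^+ (2 * #|F|) * dev.
Proof.
move=> oF /card_gt0P[[a b] abF].
have [z zr zF] : exists2 z, z != r & exists2 p, p \in F & inc z p.
  have [ar|ar] := eqVneq a r.
    exists b; last by exists (a, b) => //; rewrite /inc eqxx orbT.
    by rewrite eq_sym -ar; case: (oF _ _ abF).
  by exists a => //; exists (a, b) => //; rewrite /inc eqxx.
pose P f := \prod_(p in F | ~~ inc z p) U (f p.1) (f p.2).
have rE x : rdens F U r x = avg (fun f => P (upd f r x) * staravg F z (upd f r x)).
  rewrite /rdens (avg_upd z _ X0); apply: eq_avg => f.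
  rewrite /staravg -avgZ; apply: eq_avg => t; rewrite -wt_upd//; congr (wt _ _ _).
  apply/ffunP => v; rewrite !ffunE.
  by case: (eqVneq v r) (eqVneq v z) => [->|//] [rz|//]; rewrite -rz eqxx in zr.
apply: (@le_trans _ _ (avg (fun f => (P f * staravg F z f) ^+ 2))).
  rewrite [leRHS](avg_upd r _ X0) avg_exchange; apply: ler_avg => x.
  by rewrite rE; exact: jensen_sqr.
apply: (@le_trans _ _ (avg (fun f =>
    B ^+ (2 * #|[set p | (p \in F) && ~~ inc z p]|) * staravg F z f ^+ 2))).
  apply: ler_avg => f; rewrite exprMn ler_wpM2r ?sqr_ge0// mulnC exprM.
  by rewrite -real_normK ?num_real// lerXn2r ?nnegrE ?exprn_ge0// prod_bound.
rewrite avgZ -(card_inc F z) mulnDr exprD -mulrA ler_wpM2l ?exprn_ge0//.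
exact: staravg_sqr.
Qed.

(** Averaging first over the positions of two unlinked vertices separates the
    edges at one from the edges at the other. *)
Lemma dens_bound F z z' : oriented F -> z != z' -> ~~ linked F z z' ->
  (exists2 p, p \in F & inc z p) -> (exists2 p, p \in F & inc z' p) ->
  `|dens F U| <= B ^+ (2 * #|F|) * dev.
Proof.
move=> oF zz' Nzz' zF z'F.
pose P f := \prod_(p | [&& p \in F, ~~ inc z p & ~~ inc z' p]) U (f p.1) (f p.2).
have dE : dens F U = avg (fun f => P f * (staravg F z f * staravg F z' f)).
  rewrite /dens (avg_upd z _ X0).
  transitivity (avg (fun f =>
      (\prod_(p in F | ~~ inc z p) U (f p.1) (f p.2)) * staravg F z f)).
    by apply: eq_avg => f; rewrite -avgZ; apply: eq_avg => t; rewrite wt_upd.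
  rewrite (avg_upd z' _ X0); apply: eq_avg => f.
  rewrite mulrA -[RHS]avgZ; apply: eq_avg => t.
  have -> : staravg F z (upd f z' t) = staravg F z f.
    apply: eq_avg => x; apply: eq_bigr => p /andP[pF zp]; rewrite ffunE ifN//.
    by apply: contra Nzz' => /eqP<-; exact: other_linked.
  rewrite [RHS]mulrAC; congr (_ * _).
  have oF' : oriented [set p in F | ~~ inc z p].
    by apply: orientedS oF; apply/subsetP => p; rewrite inE => /andP[].
  transitivity (wt [set p in F | ~~ inc z p] U (upd f z' t)).
    by apply: eq_bigl => p; rewrite inE.
  rewrite wt_upd//; congr (_ * _).
    by rewrite /P; apply: eq_bigl => p; rewrite inE andbA.
  apply: eq_bigl => p; rewrite inE.
  have [pF|] //= := boolP (p \in F); case z'p : (inc z' p); rewrite ?andbF// andbT.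
  apply/negP => zp; move/negP: Nzz'; apply; move: pF zp z'p; case: p => a b abF.
  rewrite /inc /linked /=.
  move=> /orP[]/eqP ez /orP[]/eqP ez'; rewrite -ez -ez' ?abF ?orbT//;
    by move: zz'; rewrite -ez -ez' eqxx.
have cB : B ^+ #|[set p | [&& p \in F, ~~ inc z p & ~~ inc z' p]]| <=
    B ^+ (2 * #|[set p | (p \in F) && ~~ inc z p]|).
  rewrite ler_weXn2l//; apply: (@leq_trans #|[set p | (p \in F) && ~~ inc z p]|).
    by apply: subset_leq_card; apply/subsetP => p; rewrite !inE => /and3P[-> ->].
  by rewrite leq_pmull.
have cB' : B ^+ #|[set p | [&& p \in F, ~~ inc z p & ~~ inc z' p]]| <=
    B ^+ (2 * #|[set p | (p \in F) && ~~ inc z' p]|).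
  rewrite ler_weXn2l//; apply: (@leq_trans #|[set p | (p \in F) && ~~ inc z' p]|).
    by apply: subset_leq_card; apply/subsetP => p; rewrite !inE => /and3P[-> _ ->].
  by rewrite leq_pmull.
set b := B ^+ #|_| in cB cB'.
have b0 : 0 <= b by rewrite exprn_ge0.
have s0 : 0 <= avg (fun f => staravg F z f ^+ 2) by apply: avg_ge0 => f; rewrite sqr_ge0.
have s0' : 0 <= avg (fun f => staravg F z' f ^+ 2) by apply: avg_ge0 => f; rewrite sqr_ge0.
have Sz := staravg_sqr oF zF; have Sz' := staravg_sqr oF z'F.
have Bz y : B ^+ (2 * #|F|) * dev = B ^+ (2 * #|[set p | (p \in F) && ~~ inc y p]|) *
    (B ^+ (2 * #|[set p in F | inc y p]|) * dev).
  by rewrite -(card_inc F y) mulnDr exprD mulrA.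
apply: (@le_trans _ _ (avg (fun f => b / 2 * staravg F z f ^+ 2 +
                                     b / 2 * staravg F z' f ^+ 2))).
  rewrite dE; apply: le_trans (ler_norm_avg _) _; apply: ler_avg => f.
  rewrite normrM; apply: (@le_trans _ _ (b * `|staravg F z f * staravg F z' f|)).
    by rewrite ler_wpM2r// /b; exact: prod_bound.
  rewrite -mulrDr -mulrA ler_wpM2l// normrM.
  rewrite -(real_normK (num_real (staravg F z f))) -(real_normK (num_real (staravg F z' f))).
  by have := sqr_ge0 (`|staravg F z f| - `|staravg F z' f|); nra.
rewrite avgD !avgZ.
have : b * avg (fun f => staravg F z f ^+ 2) <= B ^+ (2 * #|F|) * dev.
  by rewrite (Bz z); apply: ler_pM.
have : b * avg (fun f => staravg F z' f ^+ 2) <= B ^+ (2 * #|F|) * dev.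
  by rewrite (Bz z'); apply: ler_pM.
by lra.
Qed.

End Bounds.
End Densities.

(** * Expansion of densities around a constant *)

Section Expansion.
Context {R : realFieldType} {V X : finType}.
Implicit Types (E F : {set V * V}) (U : X -> X -> R) (f : {ffun V -> X}).

Definition shift1 U : X -> X -> R := fun x y => 1 + U x y.

Lemma wt_shift1 E U f : wt E (shift1 U) f = \sum_(F : {set V * V} | F \subset E) wt F U f.
Proof.
pose u p := if p \in E then U (f p.1) (f p.2) else 0.
transitivity (\prod_p (u p + 1)).
  rewrite /wt big_mkcond; apply: eq_bigr => p _; rewrite /u /shift1.
  by case: ifP; rewrite ?add0r// addrC.
rewrite bigA_distr [RHS]big_mkcond; apply: eq_bigr => F _.
have [FE|FE] := boolP (F \subset E).
  rewrite /wt [RHS]big_mkcond; apply: eq_bigr => p _; case: ifP => // pF.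
  by rewrite /u (subsetP FE).
have [p pF pE] := subsetPn FE.
by rewrite (bigD1 p)//= pF /u (negbTE pE) mul0r.
Qed.

Lemma sqr_sum_le (I : finType) (a : I -> R) :
  (\sum_i a i) ^+ 2 <= #|I|%:R * \sum_i a i ^+ 2.
Proof.
have [I0|I0] := posnP #|I|.
  by rewrite I0 mul0r big1 ?expr0n// => i; have := card0_eq I0 i.
have := jensen_sqr a; rewrite !avgE expr_div_n ler_pdivrMr ?exprn_gt0 ?ltr0n//.
suff -> : (\sum_i a i ^+ 2) / #|I|%:R * #|I|%:R ^+ 2 = #|I|%:R * \sum_i a i ^+ 2 by [].
by field; rewrite pnatr_eq0 -lt0n.
Qed.

Variables (U : X -> X -> R) (B : R) (E : {set V * V}) (r : V).
Hypotheses (X0 : (0 < #|X|)%N) (B1 : 1 <= B).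
Hypotheses (UC : forall x y, U x y = U y x) (UB : forall x y, `|U x y| <= B).
Hypotheses (oE : oriented E)
  (tE : forall a b c, linked E a b -> linked E b c -> ~~ linked E a c).

(** A crude constant: all that matters is that it depends on B and E alone. *)
Definition expansion_cst : R := #|{set V * V}|%:R ^+ 2 * B ^+ (2 * #|E|).

Let M : R := #|{set V * V}|%:R.
Let M1 : 1 <= M.
Proof. by rewrite /M ler1n; apply/card_gt0P; exists set0. Qed.
Let B0 : 0 <= B. Proof. exact: le_trans ler01 B1. Qed.

Lemma expansion_cst_ge1 : 1 <= expansion_cst.
Proof. by rewrite /expansion_cst mulr_ege1 ?exprn_ege1. Qed.

Lemma powB_mono F : F \subset E -> B ^+ (2 * #|F|) * dev U <= B ^+ (2 * #|E|) * dev U.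
Proof.
move=> FE; rewrite ler_wpM2r ?dev_ge0// ler_weXn2l// leq_mul2l.
by rewrite subset_leq_card// orbT.
Qed.

Lemma dens1 p : p \in E -> dens [set p] U = avg (deg U).
Proof.
case: p => a b /oE[ab _]; rewrite /dens (avg_upd a _ X0).
transitivity (avg (fun f : {ffun V -> X} => deg U (f b))).
  apply: eq_avg => f; apply: eq_avg => x.
  by rewrite /wt big_set1 /= !ffunE eqxx eq_sym (negbTE ab) UC.
rewrite (avg_upd b _ X0) -[RHS](@avg_cst _ {ffun V -> X}) ?card_ffun ?expn_gt0 ?X0//.
by apply: eq_avg => f; apply: eq_avg => x; rewrite ffunE eqxx.
Qed.

Definition excess x := rdens E (shift1 U) r x - 1.

Lemma excess_sum x : excess x =
  \sum_(F : {set V * V}) (if (F \subset E) && (F != set0) then rdens F U r x else 0).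
Proof.
rewrite /excess /rdens; under eq_avg => f do rewrite wt_shift1.
rewrite avg_sum (bigD1 set0) ?sub0set//=.
have -> : avg (fun f : {ffun V -> X} => wt set0 U (upd f r x)) = 1.
  rewrite (eq_avg (g := fun=> 1)) ?avg_cst ?card_ffun ?expn_gt0 ?X0// => f.
  by rewrite /wt big_set0.
by rewrite addrAC subrr add0r big_mkcond.
Qed.

(** No linear term here: already the contribution of a single edge, rooted, has
    a square mean of order dev. *)
Lemma excess_sqr : avg (fun x => excess x ^+ 2) <= expansion_cst * dev U.
Proof.
pose c := B ^+ (2 * #|E|) * dev U.
have c0 : 0 <= c by rewrite mulr_ge0 ?exprn_ge0 ?dev_ge0.
apply: (@le_trans _ _ (M * \sum_(F : {set V * V}) c)); last first.
  by rewrite sumr_const -mulr_natl -/M /expansion_cst -/M /c; lra.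
apply: (@le_trans _ _ (M * avg (fun x => \sum_(F : {set V * V})
   (if (F \subset E) && (F != set0) then rdens F U r x else 0) ^+ 2))).
  by rewrite -avgZ; apply: ler_avg => x; rewrite excess_sum; exact: sqr_sum_le.
rewrite ler_wpM2l ?(le_trans ler01)// avg_sum; apply: ler_sum => F _.
case: (boolP ((F \subset E) && (F != set0))) => [/andP[FE F0]|_]; last by rewrite expr0n avg_cst.
apply: le_trans (powB_mono FE); apply: rdens_sqr => //.
  exact: orientedS oE.
by rewrite card_gt0.
Qed.

(** The single edges of E contribute the linear term.  A larger subgraph is no
    clique, since E has no triangle, so dev controls its density. *)
Lemma excess_avg :
  `|avg excess - #|E|%:R * avg (deg U)| <= expansion_cst * dev U.
Proof.
pose c := B ^+ (2 * #|E|) * dev U.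
have c0 : 0 <= c by rewrite mulr_ge0 ?exprn_ge0 ?dev_ge0.
have -> : avg excess - #|E|%:R * avg (deg U) = \sum_(F : {set V * V})
    (if (F \subset E) && (1 < #|F|)%N then dens F U else 0).
  have -> : avg excess = \sum_(F : {set V * V})
      (if (F \subset E) && (F != set0) then dens F U else 0).
    rewrite (eq_avg excess_sum) avg_sum; apply: eq_bigr => F _.
    by case: ifP => _; rewrite ?avg_rdens// avg_cst.
  have -> : #|E|%:R * avg (deg U) = \sum_(F : {set V * V})
      (if (F \subset E) && (#|F| == 1%N) then dens F U else 0).
    rewrite -big_mkcond /= (eq_bigl (mem [set [set p] | p in E])); last first.
      move=> F; apply/andP/imsetP => [[FE /cards1P[p Fp]]|[p pE ->]].
        by exists p => //; rewrite -sub1set -Fp.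
      by rewrite sub1set pE cards1.
    rewrite big_imset /=; last by move=> p q _ _ /set1_inj.
    by rewrite (eq_bigr _ dens1) sumr_const mulr_natl.
  rewrite -sumrB; apply: eq_bigr => F _; rewrite -card_gt0.
  by case: (F \subset E); case: #|F| => [|[|n]]; rewrite /= ?subr0 ?subrr.
apply: le_trans (ler_norm_sum _ _ _) _.
apply: (@le_trans _ _ (\sum_(F : {set V * V}) c)); last first.
  rewrite sumr_const -mulr_natl -/M /expansion_cst -/M -mulrA -/c expr2.
  by rewrite ler_wpM2r// ler_peMr// (le_trans ler01).
apply: ler_sum => F _; case: ifPn => [/andP[FE F1]|_]; last by rewrite normr0.
apply: le_trans (powB_mono FE).
have [z [z' [zz' Nzz' zF z'F]]] := unlinked_vertices oE FE tE F1.
by apply: (dens_bound X0 B1 UC UB _ zz') => //; exact: orientedS oE.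
Qed.

End Expansion.

(** * Matrices close to a constant *)

Section Local.
Context {R : realFieldType}.

Lemma young (T : finType) (f g : T -> R) (l : R) : 0 < l ->
  `|avg (fun x => f x * g x)| <=
  (l * avg (fun x => f x ^+ 2) + l^-1 * avg (fun x => g x ^+ 2)) / 2.
Proof.
move=> l0; apply: le_trans (ler_norm_avg _) _.
rewrite -!avgZ -avgD -avgZr; apply: ler_avg => x.
rewrite normrM -(real_normK (num_real (f x))) -(real_normK (num_real (g x))).
set a := `|f x|; set b := `|g x|.
have : 0 <= l^-1 * (l * a - b) ^+ 2 by rewrite mulr_ge0 ?sqr_ge0// invr_ge0 ltW.
have -> : l^-1 * (l * a - b) ^+ 2 = l * a ^+ 2 - 2 * (a * b) + l^-1 * b ^+ 2.
  by field; rewrite gt_eqF.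
by lra.
Qed.

Lemma cauchy_schwarz (T : finType) (f g : T -> R) :
  avg (fun x => f x * g x) ^+ 2 <= avg (fun x => f x ^+ 2) * avg (fun x => g x ^+ 2).
Proof.
set A := avg (fun x => f x ^+ 2); set Q := avg (fun x => g x ^+ 2).
set P := avg _.
have A0 : 0 <= A by apply: avg_ge0 => x; rewrite sqr_ge0.
have Q0 : 0 <= Q by apply: avg_ge0 => x; rewrite sqr_ge0.
have quad t : 0 <= A - 2 * t * P + t ^+ 2 * Q.
  have : 0 <= avg (fun x => (f x - t * g x) ^+ 2) by apply: avg_ge0 => x; rewrite sqr_ge0.
  rewrite (_ : avg _ = A - 2 * t * P + t ^+ 2 * Q)//.
  by rewrite /A /P /Q -!avgZ -avgB -avgD; apply: eq_avg => x; ring.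
have [Qz|Qn] := eqVneq Q 0.
  have [-> | Pn] := eqVneq P 0; first by rewrite expr0n mulr_ge0.
  have := quad ((A + 1) / (2 * P)); rewrite Qz mulr0 addr0.
  rewrite (_ : 2 * _ * P = A + 1); first by lra.
  by field.
have Qp : 0 < Q by rewrite lt0r Qn.
have := quad (P / Q).
have -> : A - 2 * (P / Q) * P + (P / Q) ^+ 2 * Q = (A * Q - P ^+ 2) / Q by field.
by rewrite pmulr_lge0 ?invr_gt0// subr_ge0.
Qed.

Context {X : finType}.
Variables (U : X -> X -> R) (B e : R).
Hypotheses (X0 : (0 < #|X|)%N) (B1 : 1 <= B) (e0 : 0 < e).
Hypotheses (UC : forall x y, U x y = U y x) (UB : forall x y, `|U x y| <= B).
Hypothesis t4 : avg (fun x => avg (fun y => codeg U x y ^+ 2)) <= e ^+ 4.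

Definition op (f : X -> R) x := avg (fun z => U x z * f z).

(** The density of C_4 is the fourth power of the Schatten 4-norm, which bounds
    the operator norm. *)
Lemma op_norm (f : X -> R) :
  avg (fun x => op f x ^+ 2) <= e ^+ 2 * avg (fun x => f x ^+ 2).
Proof.
set N := avg (fun x => f x ^+ 2).
have N0 : 0 <= N by apply: avg_ge0 => x; rewrite sqr_ge0.
have -> : avg (fun x => op f x ^+ 2) =
    avg (fun p : X * X => (f p.1 * f p.2) * codeg U p.1 p.2).
  rewrite avg_pair /=.
  transitivity (avg (fun x => avg (fun z => avg (fun z' =>
     (U x z * f z) * (U x z' * f z'))))).
    by apply: eq_avg => x; rewrite expr2 avgM.
  rewrite [LHS]avg_exchange; apply: eq_avg => z.
  rewrite [LHS]avg_exchange; apply: eq_avg => z'.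
  by rewrite /codeg -avgZ; apply: eq_avg => x; rewrite (UC z) (UC z'); ring.
set P := avg _; have [P0|P0] := leP P 0.
  by apply: le_trans P0 _; rewrite mulr_ge0 ?sqr_ge0.
rewrite -ler_sqr ?nnegrE ?(ltW P0) ?(mulr_ge0 (sqr_ge0 e) N0)//.
apply: le_trans (cauchy_schwarz _ _) _.
rewrite [X in _ * X]avg_pair /= [X in X * _](_ : _ = N ^+ 2); last first.
  rewrite avg_pair /= expr2 avgM; apply: eq_avg => x; apply: eq_avg => y.
  by rewrite exprMn.
by rewrite exprMn [leRHS]mulrC -exprM ler_wpM2l ?sqr_ge0.
Qed.

Variables (gam : X -> R) (C q : R).
Hypotheses (C1 : 1 <= C) (q0 : 0 <= q).
Let y := dev U.
Let d := deg U.
Let xb := avg d.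
Hypothesis gam2 : avg (fun x => gam x ^+ 2) <= C * y.
Hypothesis gamq : `|avg gam - q * xb| <= C * y.
Hypotheses (eC : e * C * B ^+ 2 <= 1 / 2000) (eqs : e * (q + 1) <= 1 / 8).

(** The density, rooted at a pendant vertex, of a graph with a pendant edge. *)
Definition pend x := avg (fun u => shift1 U x u * (1 + gam u)).
Hypothesis pend0 : forall x, 0 <= pend x.

Let y0 : 0 <= y. Proof. exact: dev_ge0. Qed.
Let D2 := avg (fun x => d x ^+ 2).
Let T4 := avg (fun x => avg (fun y => codeg U x y ^+ 2)).
Let G2 := avg (fun x => gam x ^+ 2).
Let g := pend.
Let G := avg g.
Let gb := avg gam.

Let D20 : 0 <= D2. Proof. exact: sqr_deg_ge0. Qed.
Let T40 : 0 <= T4. Proof. exact: sqr_codeg_ge0. Qed.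
Let G20 : 0 <= G2. Proof. by apply: avg_ge0 => x; rewrite sqr_ge0. Qed.
Let yE : y = D2 + T4. Proof. by []. Qed.

Let eC' : e * C <= 1 / 2000.
Proof.
apply: le_trans eC; rewrite ler_peMr ?exprn_ege1//.
by rewrite mulr_ge0 ?(ltW e0)// (le_trans ler01).
Qed.
Let e_small : e <= 1 / 2000.
Proof. by apply: le_trans eC'; rewrite ler_peMr// ltW. Qed.

Let dE x : d x = op (fun=> 1) x.
Proof. by apply: eq_avg => z; rewrite mulr1. Qed.

Let D2e : D2 <= e ^+ 2.
Proof.
have := op_norm (fun=> 1); rewrite [avg (fun=> 1 ^+ 2)]avg_cst// expr1n mulr1.
by congr (_ <= _); apply: eq_avg => x; rewrite dE.
Qed.

Let xb2 : xb ^+ 2 <= D2. Proof. exact: jensen_sqr. Qed.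

Let xbe : `|xb| <= e.
Proof.
rewrite -ler_sqr ?nnegrE ?(ltW e0)// real_normK ?num_real//.
exact: le_trans xb2 D2e.
Qed.

Let ye : y <= 2 * e ^+ 2.
Proof.
have : T4 <= e ^+ 2.
  apply: (le_trans t4); rewrite ler_wiXn2l ?(ltW e0)//.
  by apply: le_trans e_small _; lra.
by move: D2e; rewrite yE; lra.
Qed.

Let gd := avg (fun x => gam x * d x).
Let dU := avg (fun x => d x * op d x).
Let gU := avg (fun x => gam x * op d x).

Let gd_le : `|gd| <= C * y.
Proof.
apply: (le_trans (young gam d ltr01)); rewrite invr1 !mul1r.
have : y <= C * y by rewrite ler_peMl.
by move: gam2 T40 yE; rewrite -/D2 -/G2 => *; lra.
Qed.

Let opd : avg (fun x => op d x ^+ 2) <= e ^+ 2 * D2.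
Proof. exact: op_norm. Qed.

Let dU_le : `|dU| <= e * D2.
Proof.
apply: (le_trans (young d (op d) e0)); rewrite -/D2.
have : e^-1 * avg (fun x => op d x ^+ 2) <= e^-1 * (e ^+ 2 * D2).
  by rewrite ler_wpM2l// invr_ge0 ltW.
by rewrite [X in _ <= X](_ : _ = e * D2); [lra|field; rewrite gt_eqF].
Qed.

Let gU_le : `|gU| <= e * (C * y).
Proof.
apply: (le_trans (young gam (op d) e0)); rewrite -/G2.
have : e^-1 * avg (fun x => op d x ^+ 2) <= e^-1 * (e ^+ 2 * D2).
  by rewrite ler_wpM2l// invr_ge0 ltW.
rewrite [X in _ <= X](_ : _ = e * D2); last by field; rewrite gt_eqF.
have : e * D2 <= e * (C * y).
  rewrite ler_wpM2l ?(ltW e0)//; apply: (@le_trans _ _ y); last by rewrite ler_peMl.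
  by rewrite yE lerDl.
have : e * G2 <= e * (C * y) by rewrite ler_wpM2l ?(ltW e0).
by lra.
Qed.

Let gE x : g x = 1 + d x + gb + op gam x.
Proof.
rewrite /g /pend /shift1.
rewrite (_ : avg _ = avg (fun u => 1 + U x u + gam u + U x u * gam u)).
  by rewrite !avgD avg_cst.
by apply: eq_avg => u; ring.
Qed.

Let op_adj (f h : X -> R) :
  avg (fun x => op f x * h x) = avg (fun x => f x * op h x).
Proof.
transitivity (avg (fun x => avg (fun z => U x z * f z * h x))).
  by apply: eq_avg => x; rewrite avgZr.
rewrite [LHS]avg_exchange; apply: eq_avg => z.
by rewrite -avgZ; apply: eq_avg => x; rewrite (UC x z); ring.
Qed.

Let GE : G = 1 + xb + gb + gd.
Proof.
rewrite /G (eq_avg gE) !avgD !avg_cst//; congr (_ + _).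
transitivity (avg (fun x => op gam x * 1)); first by apply: eq_avg => x; rewrite mulr1.
by rewrite op_adj; apply: eq_avg => x; rewrite dE.
Qed.

Let G_near : `|G - 1 - (q + 1) * xb| <= 2 * C * y.
Proof.
rewrite (_ : G - 1 - _ = (gb - q * xb) + gd); last by rewrite GE; ring.
by apply: le_trans (ler_normD _ _) _; move: gamq gd_le; rewrite -/gb; lra.
Qed.

Let Cy_small : C * y <= e / 1000.
Proof.
apply: (@le_trans _ _ (C * (2 * e ^+ 2))).
  by rewrite ler_wpM2l// (le_trans ler01).
rewrite (_ : C * _ = 2 * e * (e * C)); last by ring.
have : e * (e * C) <= e * (1 / 2000) by rewrite ler_wpM2l// ltW.
by lra.
Qed.

Let G_bounds : 1 / 2 <= G <= 2.
Proof.
have : `|(q + 1) * xb| <= 1 / 8.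
  rewrite normrM [`|q + 1|]ger0_norm ?addr_ge0// mulrC.
  by apply: le_trans eqs; rewrite ler_wpM2r// addr_ge0.
move: G_near Cy_small e_small; rewrite !ler_norml => /andP[h1 h2] h3 h4 /andP[h5 h6].
by apply/andP; split; lra.
Qed.

Let K := avg (fun x => (g x - 1) ^+ 2).
Let K0 : 0 <= K. Proof. by apply: avg_ge0 => x; rewrite sqr_ge0. Qed.
Let K_le : K <= 9 * C * y.
Proof.
have opg : avg (fun x => op gam x ^+ 2) <= C * y.
  apply: (le_trans (op_norm gam)); apply: le_trans gam2.
  rewrite -/G2 ler_piMl// expr_le1//; last exact: ltW.
  by apply: le_trans e_small _; lra.
have gb2 : gb ^+ 2 <= C * y by apply: le_trans gam2; exact: jensen_sqr.
apply: (@le_trans _ _ (avg (fun x => 3 * d x ^+ 2 + 3 * gb ^+ 2 + 3 * op gam x ^+ 2))).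
  apply: ler_avg => x; rewrite gE.
  have := sqr_ge0 (d x - gb); have := sqr_ge0 (d x - op gam x).
  by have := sqr_ge0 (gb - op gam x); nra.
rewrite !avgD !avgZ avg_cst// -/D2.
have : D2 <= C * y.
  by apply: (@le_trans _ _ y); [rewrite yE lerDl | rewrite ler_peMl].
by move: opg gb2; lra.
Qed.

Let gdE : avg (fun x => g x * d x) = xb + D2 + gb * xb + gU.
Proof.
transitivity (avg (fun x => d x + d x ^+ 2 + gb * d x + op gam x * d x)).
  by apply: eq_avg => x; rewrite gE; ring.
by rewrite !avgD avgZ op_adj.
Qed.

(* The pendant edge correlates the weight g with the degrees; the correlation is
   the variance of the degrees, which is nonnegative, up to errors that the
   operator norm makes small. *)
Let gd_ge : G * xb - 2 * e * (C * y) <= avg (fun x => g x * d x).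
Proof.
rewrite gdE GE.
have : `|xb * gd| <= e * (C * y) by rewrite normrM ler_pM.
rewrite ler_norml => /andP[_ h].
move: gU_le; rewrite ler_norml => /andP[h' _].
have := xb2; lra.
Qed.

Definition degw x := avg (fun z => g z * U z x).
Definition codegw x x' := avg (fun z => g z * (U z x * U z x')).

Let S := wC4 g (shift1 U).

(* Expanding the square of the codegree exchanges the two sides of C_4: the
   weights are averaged out and the unweighted side carries a square. *)
Let SE : S = avg (fun p : X * X => (G + degw p.1 + degw p.2 + codegw p.1 p.2) ^+ 2).
Proof.
rewrite avg_pair /= /S /wC4.
transitivity (avg (fun x => avg (fun x' => avg (fun y => avg (fun y' =>
  (g x * (shift1 U x y * shift1 U x y')) * (g x' * (shift1 U x' y * shift1 U x' y'))))))).
  apply: eq_avg => x; apply: eq_avg => x'.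
  rewrite expr2 /codeg avgM -avgZ; apply: eq_avg => z; rewrite -avgZ.
  by apply: eq_avg => z'; ring.
transitivity (avg (fun y => avg (fun y' => avg (fun x => avg (fun x' =>
  (g x * (shift1 U x y * shift1 U x y')) * (g x' * (shift1 U x' y * shift1 U x' y'))))))).
  transitivity (avg (fun x => avg (fun y => avg (fun x' => avg (fun y' =>
  (g x * (shift1 U x y * shift1 U x y')) * (g x' * (shift1 U x' y * shift1 U x' y'))))))).
    by apply: eq_avg => x; rewrite [LHS]avg_exchange.
  rewrite [LHS]avg_exchange; apply: eq_avg => z.
  transitivity (avg (fun x => avg (fun y' => avg (fun x' =>
  (g x * (shift1 U x z * shift1 U x y')) * (g x' * (shift1 U x' z * shift1 U x' y')))))).
    by apply: eq_avg => x; rewrite [LHS]avg_exchange.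
  by rewrite [LHS]avg_exchange.
apply: eq_avg => z; apply: eq_avg => z'; rewrite -avgM -expr2; congr (_ ^+ 2).
rewrite /G /degw /codegw -!avgD; apply: eq_avg => x.
by rewrite /shift1; ring.
Qed.

Let avg_degw : avg degw = avg (fun x => g x * d x).
Proof.
by rewrite /degw avg_exchange; apply: eq_avg => x; rewrite avgZ.
Qed.

Let avg_codegw : 0 <= avg (fun p : X * X => codegw p.1 p.2).
Proof.
rewrite avg_pair /=.
have -> : avg (fun x => avg (codegw x)) = avg (fun z => g z * d z ^+ 2).
  transitivity (avg (fun x => avg (fun z => g z * (U z x * d z)))).
    apply: eq_avg => x; rewrite /codegw avg_exchange; apply: eq_avg => z.
    by rewrite avgZ avgZ.
  rewrite avg_exchange; apply: eq_avg => z.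
  by rewrite avgZ avgZr expr2.
by apply: avg_ge0 => z; rewrite mulr_ge0 ?sqr_ge0.
Qed.

(* The quadratic form a below carries the gain; the weights perturb it by h. *)
Let a (p : X * X) := d p.1 + d p.2 + codeg U p.1 p.2.
Let h1 x := degw x - d x.
Let h2 (p : X * X) := codegw p.1 p.2 - codeg U p.1 p.2.

Let avg_fst (f : X -> R) : avg (fun p : X * X => f p.1) = avg f.
Proof. by rewrite avg_pair; apply: eq_avg => x /=; rewrite avg_cst. Qed.
Let avg_snd (f : X -> R) : avg (fun p : X * X => f p.2) = avg f.
Proof. by rewrite avg_pair /= avg_cst. Qed.

Let codeg_op x : avg (fun z => codeg U x z) = op d x.
Proof.
rewrite /codeg avg_exchange; apply: eq_avg => z.
by rewrite avgZ; congr (_ * _); apply: eq_avg => t; rewrite UC.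
Qed.

Let codegC x x' : codeg U x x' = codeg U x' x.
Proof. by apply: eq_avg => z; rewrite mulrC. Qed.

Let a_ge : y <= avg (fun p => a p ^+ 2).
Proof.
have -> : avg (fun p => a p ^+ 2) = 2 * D2 + T4 + 2 * xb ^+ 2 + 4 * dU.
  transitivity (avg (fun p : X * X => d p.1 ^+ 2 + d p.2 ^+ 2 + codeg U p.1 p.2 ^+ 2
     + 2 * (d p.1 * d p.2) + 2 * (d p.1 * codeg U p.1 p.2) + 2 * (d p.2 * codeg U p.1 p.2))).
    by apply: eq_avg => p; rewrite /a; ring.
  rewrite !avgD !avgZ (avg_fst (fun x => d x ^+ 2)) (avg_snd (fun x => d x ^+ 2)) -/D2.
  rewrite [avg (fun p : X * X => codeg _ _ _ ^+ 2)]avg_pair /= -/T4.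
  have -> : avg (fun p : X * X => d p.1 * d p.2) = xb ^+ 2.
    by rewrite avg_pair expr2 avgM.
  have -> : avg (fun p : X * X => d p.1 * codeg U p.1 p.2) = dU.
    by rewrite avg_pair; apply: eq_avg => x /=; rewrite avgZ codeg_op.
  have -> : avg (fun p : X * X => d p.2 * codeg U p.1 p.2) = dU.
    rewrite avg_pair avg_exchange; apply: eq_avg => x; rewrite /= avgZ -codeg_op.
    by congr (_ * _); apply: eq_avg => z; rewrite codegC.
  by ring.
move: dU_le; rewrite ler_norml => /andP[h _].
have : e * D2 <= 1 / 2000 * D2 by rewrite ler_wpM2r.
have := D20; have := sqr_ge0 xb; rewrite yE; lra.
Qed.

Let h1_le : avg (fun x => h1 x ^+ 2) <= e ^+ 2 * (9 * C * y).
Proof.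
have -> : avg (fun x => h1 x ^+ 2) = avg (fun x => op (fun z => g z - 1) x ^+ 2).
  apply: eq_avg => x; congr (_ ^+ 2); rewrite /h1 /degw /d /deg /op -avgB.
  by apply: eq_avg => z; rewrite (UC z); ring.
by apply: (le_trans (op_norm _)); rewrite ler_wpM2l ?sqr_ge0.
Qed.

(* The weights g x - 1 are small on average only, so they are separated from the
   codegrees by Young's inequality, and y <= 2 e^2 absorbs the square of their
   second moment. *)
Let h2_le : avg (fun p => h2 p ^+ 2) <= y / 24.
Proof.
have -> : avg (fun p => h2 p ^+ 2) =
    avg (fun p : X * X => ((g p.1 - 1) * (g p.2 - 1)) * codeg U p.1 p.2 ^+ 2).
  transitivity (avg (fun z => avg (fun z' => avg (fun x => avg (fun x' =>
     ((g x - 1) * (U x z * U x z')) * ((g x' - 1) * (U x' z * U x' z'))))))).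
    rewrite avg_pair; apply: eq_avg => z; apply: eq_avg => z'.
    rewrite -avgM -expr2; congr (_ ^+ 2); rewrite /h2 /codegw /codeg /= -avgB.
    by apply: eq_avg => x; rewrite (UC z) (UC z'); ring.
  transitivity (avg (fun x => avg (fun x' => avg (fun z => avg (fun z' =>
     ((g x - 1) * (U x z * U x z')) * ((g x' - 1) * (U x' z * U x' z'))))))).
    transitivity (avg (fun z => avg (fun x => avg (fun z' => avg (fun x' =>
     ((g x - 1) * (U x z * U x z')) * ((g x' - 1) * (U x' z * U x' z'))))))).
      by apply: eq_avg => z; rewrite [LHS]avg_exchange.
    rewrite [LHS]avg_exchange; apply: eq_avg => x.
    transitivity (avg (fun z => avg (fun x' => avg (fun z' =>
     ((g x - 1) * (U x z * U x z')) * ((g x' - 1) * (U x' z * U x' z')))))).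
      by apply: eq_avg => z; rewrite [LHS]avg_exchange.
    by rewrite [LHS]avg_exchange.
  rewrite avg_pair; apply: eq_avg => x; apply: eq_avg => x' /=.
  rewrite expr2 /codeg avgM -avgZ; apply: eq_avg => z; rewrite -avgZ.
  by apply: eq_avg => z'; ring.
set l := 24 * B ^+ 4.
have B4 : 0 < B ^+ 4 by rewrite exprn_gt0// (lt_le_trans ltr01).
have l0 : 0 < l by rewrite mulr_gt0.
apply: (le_trans (ler_norm _)).
apply: (le_trans (young (fun p : X * X => (g p.1 - 1) * (g p.2 - 1))
                        (fun p => codeg U p.1 p.2 ^+ 2) l0)).
rewrite (_ : avg (fun p : X * X => ((g p.1 - 1) * (g p.2 - 1)) ^+ 2) = K ^+ 2); last first.
  rewrite avg_pair expr2 /K avgM; apply: eq_avg => x; apply: eq_avg => x'.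
  by rewrite exprMn.
have c4 : avg (fun p : X * X => (codeg U p.1 p.2 ^+ 2) ^+ 2) <= B ^+ 4 * T4.
  rewrite avg_pair /= /T4 -avgZ; apply: ler_avg => x; rewrite -avgZ.
  apply: ler_avg => x'; rewrite [leLHS]expr2 ler_wpM2r ?sqr_ge0//.
  rewrite -(real_normK (num_real _)) (_ : 4 = 2 * 2)%N// exprM.
  by rewrite lerXn2r ?nnegrE ?exprn_ge0 ?normr_ge0 ?(le_trans ler01)// codeg_bound.
have : l^-1 * avg (fun p : X * X => (codeg U p.1 p.2 ^+ 2) ^+ 2) <= T4 / 24.
  apply: (@le_trans _ _ (l^-1 * (B ^+ 4 * T4))).
    by rewrite ler_wpM2l// invr_ge0 ltW.
  rewrite le_eqVlt; apply/orP; left; apply/eqP; rewrite /l.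
  by field; rewrite gt_eqF// (lt_le_trans ltr01).
have Cy0 : 0 <= C * y by rewrite mulr_ge0// (le_trans ler01).
have : l * K ^+ 2 <= y / 24.
  apply: (@le_trans _ _ (l * ((9 * C * y) * (9 * C * y)))).
    by rewrite ler_wpM2l ?(ltW l0)// expr2 ler_pM.
  apply: (@le_trans _ _ (l * ((9 * C * y) * (9 * C * (2 * e ^+ 2))))).
    rewrite ler_wpM2l ?(ltW l0)// ler_wpM2l//; first by rewrite -mulrA mulr_ge0.
    by rewrite ler_wpM2l// mulr_ge0// (le_trans ler01).
  have -> : l * ((9 * C * y) * (9 * C * (2 * e ^+ 2))) =
      3888 * (e * C * B ^+ 2) ^+ 2 * y by rewrite /l; ring.
  have : (e * C * B ^+ 2) ^+ 2 <= (1 / 2000) ^+ 2.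
    have eCB0 : 0 <= e * C * B ^+ 2.
      by rewrite !mulr_ge0 ?exprn_ge0 ?(ltW e0)// (le_trans ler01).
    by rewrite lerXn2r ?nnegrE//; lra.
  move=> h; have : (e * C * B ^+ 2) ^+ 2 * y <= (1 / 2000) ^+ 2 * y by rewrite ler_wpM2r.
  by have := y0; lra.
by move: D20; rewrite yE; lra.
Qed.

Let quad_ge : y / 4 <= avg (fun p : X * X => (degw p.1 + degw p.2 + codegw p.1 p.2) ^+ 2).
Proof.
apply: (@le_trans _ _ (avg (fun p : X * X => 1 / 2 * a p ^+ 2 -
    (3 * h1 p.1 ^+ 2 + 3 * h1 p.2 ^+ 2 + 3 * h2 p ^+ 2)))); last first.
  apply: ler_avg => p.
  have -> : degw p.1 + degw p.2 + codegw p.1 p.2 = a p + (h1 p.1 + h1 p.2 + h2 p).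
    by rewrite /a /h1 /h2; ring.
  move: (a p) (h1 p.1) (h1 p.2) (h2 p) => A b b' c.
  have := sqr_ge0 (A + 2 * (b + b' + c)); have := sqr_ge0 (b - b').
  by have := sqr_ge0 (b - c); have := sqr_ge0 (b' - c); nra.
rewrite avgB !avgD !avgZ (avg_fst (fun x => h1 x ^+ 2)) (avg_snd (fun x => h1 x ^+ 2)).
have : e ^+ 2 * (9 * C * y) <= y / 200.
  rewrite (_ : _ * _ = 9 * e * (e * C) * y); last by ring.
  have : e * (e * C) <= 1 / 2000 * (1 / 2000).
    rewrite ler_pM ?(ltW e0)//; first by rewrite mulr_ge0 ?(ltW e0)// (le_trans ler01).
  move=> h; have : e * (e * C) * y <= 1 / 2000 * (1 / 2000) * y by rewrite ler_wpM2r.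
  by move: y0; lra.
by move: a_ge h1_le h2_le y0; lra.
Qed.

(* With y = dev U, the second order gain y / 32 is what the argument is after. *)
Let S_ge : G ^+ 2 * (1 + 4 * xb + y / 32) <= S.
Proof.
have SE' : S = G ^+ 2 + 4 * G * avg (fun x => g x * d x)
    + 2 * G * avg (fun p : X * X => codegw p.1 p.2)
    + avg (fun p : X * X => (degw p.1 + degw p.2 + codegw p.1 p.2) ^+ 2).
  rewrite SE.
  transitivity (avg (fun p : X * X => G ^+ 2 + 2 * G * degw p.1 + 2 * G * degw p.2 +
     2 * G * codegw p.1 p.2 + (degw p.1 + degw p.2 + codegw p.1 p.2) ^+ 2)).
    by apply: eq_avg => p; ring.
  rewrite !avgD !avgZ (avg_fst degw) (avg_snd degw) avg_degw avg_cst.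
    by ring.
  by rewrite card_prod muln_gt0 X0.
rewrite SE'; move/andP: G_bounds => [Gl Gu].
have : 0 <= 2 * G * avg (fun p : X * X => codegw p.1 p.2).
  by rewrite mulr_ge0//; lra.
have : 4 * G * (G * xb - 2 * e * (C * y)) <= 4 * G * avg (fun x => g x * d x).
  by rewrite ler_wpM2l//; lra.
have : G * (e * C * y) <= 2 * (1 / 2000 * y).
  apply: ler_pM => //; first lra.
    by rewrite !mulr_ge0 ?(ltW e0)// (le_trans ler01).
  by rewrite ler_wpM2r.
have : G ^+ 2 * y <= 4 * y.
  rewrite ler_wpM2r// expr2 (_ : 4 = 2 * 2); last by ring.
  by rewrite ler_pM//; lra.
by move: quad_ge y0; lra.
Qed.

Hypothesis shift0 : forall x z, 0 <= shift1 U x z.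

(** Bernoulli's inequality linearises both powers; the quadratic gain in S,
    multiplied by s, absorbs all error terms once s is large. *)
Lemma local_gain s : 256 * C <= s%:R ->
  1 + (4 * s)%:R * ((q + 1 + 4 * s%:R) * avg (deg U)) <=
  Knn (4 * s) pend (shift1 U).
Proof.
move=> sC; move/andP: G_bounds => [Gl Gu].
have G0 : 0 < G by lra.
have s0 : (0 : R) <= s%:R by [].
apply: (le_trans _ (Knn_ge_C4 s pend0 shift0 G0)); rewrite -/S -/G -/g -/d -/xb.
set Q := S / G ^+ 2.
have Q_ge : 1 + 4 * xb + y / 32 <= Q.
  by rewrite ler_pdivlMr ?exprn_gt0// mulrC S_ge.
have S0 : 0 <= S.
  by apply: avg_ge0 => x; apply: avg_ge0 => x'; rewrite mulr_ge0 ?sqr_ge0 ?mulr_ge0 ?pend0.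
have Q0 : 0 <= Q by rewrite divr_ge0// exprn_ge0// ltW.
have P_ge : 1 + s%:R * (4 * xb + y / 32) <= Q ^+ s.
  apply: le_trans (bernoulli_ineq s Q0); rewrite lerD2l ler_wpM2l//; lra.
have Z_ge : 1 + (q + 1 + 4 * s%:R) * xb <= G * Q ^+ s.
  apply: (@le_trans _ _ (G * (1 + s%:R * (4 * xb + y / 32)))); last first.
    by rewrite ler_wpM2l// ltW.
  have sy0 : 0 <= s%:R * y by rewrite mulr_ge0.
  have xG : s%:R * (xb - 2 * (e * C * y)) <= s%:R * (xb * G).
    rewrite ler_wpM2l//; set eta := G - 1 - (q + 1) * xb.
    have -> : xb * G = xb + (q + 1) * xb ^+ 2 + xb * eta by rewrite /eta; ring.
    have : `|xb * eta| <= e * (2 * C * y) by rewrite normrM ler_pM.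
    rewrite ler_norml => /andP[h _].
    have : 0 <= (q + 1) * xb ^+ 2 by rewrite mulr_ge0 ?sqr_ge0// addr_ge0.
    by lra.
  have yG : 1 / 2 * (s%:R * y) <= G * (s%:R * y) by rewrite ler_wpM2r.
  have eCs : e * C * (s%:R * y) <= 1 / 2000 * (s%:R * y) by rewrite ler_wpM2r.
  have sCy : 256 * C * y <= s%:R * y by rewrite ler_wpM2r.
  move: G_near; rewrite ler_norml => /andP[h _].
  by lra.
have Z0 : 0 <= G * Q ^+ s by rewrite mulr_ge0 ?exprn_ge0// ltW.
apply: le_trans (bernoulli_ineq _ Z0); rewrite lerD2l ler_wpM2l//; lra.
Qed.

End Local.

(** * Off-diagonal Ramsey numbers *)

Local Open Scope nat_scope.

Section Ramsey.
Variables (I T : finType) (e : I -> rel T).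
Hypothesis eC : forall i x y, e i x y = e i y x.

Definition mono i (Q : {set T}) :=
  [forall x in Q, forall y in Q, (x != y) ==> e i x y].
Definition clean (Q : {set T}) :=
  [forall x in Q, forall y in Q, (x != y) ==> [forall i, ~~ e i x y]].

Lemma monoP i (Q : {set T}) :
  reflect {in Q &, forall x y, x != y -> e i x y} (mono i Q).
Proof.
apply: (iffP forall_inP) => [H x y xQ yQ xy|H x xQ].
  by move/forall_inP: (H x xQ) => /(_ y yQ)/implyP; apply.
by apply/forall_inP => y yQ; apply/implyP; apply: H.
Qed.

Lemma cleanP (Q : {set T}) :
  reflect {in Q &, forall x y, x != y -> forall i, ~~ e i x y} (clean Q).
Proof.
apply: (iffP forall_inP) => [H x y xQ yQ xy i|H x xQ].
  by move/forall_inP: (H x xQ) => /(_ y yQ)/implyP/(_ xy)/forallP.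
by apply/forall_inP => y yQ; apply/implyP => xy; apply/forallP; apply: H.
Qed.

Lemma subset_card_eq (Q : {set T}) m : m <= #|Q| ->
  exists2 P : {set T}, P \subset Q & #|P| = m.
Proof.
move=> mQ; exists [set x in take m (enum Q)].
  by apply/subsetP => x; rewrite inE => /mem_take; rewrite mem_enum.
rewrite cardsE; have /card_uniqP-> : uniq (take m (enum Q)) by rewrite take_uniq ?enum_uniq.
by rewrite size_takel// -cardE.
Qed.

(** When no vertex has many neighbours in any colour, a largest clean set
    together with its neighbourhoods covers everything. *)
Lemma clean_greedy (A : {set T}) m M : 0 < #|I| -> 0 < M ->
  (forall v i, v \in A -> #|[set x in A | (x != v) && e i v x]| < M) ->
  #|I| * m * M <= #|A| -> exists2 Q : {set T}, Q \subset A & clean Q /\ #|Q| = m.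
Proof.
move=> I0 M0 degM Abig.
have c0 : (set0 \subset A) && clean set0.
  by rewrite sub0set; apply/cleanP => x y; rewrite inE.
have [Q /andP[QA cQ] Qmax] := @arg_maxnP _ set0 (fun Q : {set T} => (Q \subset A) && clean Q)
  (fun Q => #|Q|) c0.
have [mQ|Qm] := leqP m #|Q|.
  have [P PQ Pm] := subset_card_eq mQ.
  exists P; first exact: subset_trans QA.
  split=> //; apply/cleanP => x y xP yP; move/cleanP: cQ; apply;
  exact: (subsetP PQ).
exfalso; move: Abig; apply/negP; rewrite -ltnNge.
have cover x : x \in A -> 1 <= \sum_(v in Q) ((x == v) + \sum_i ((x != v) && e i v x)).
  move=> xA; have [xQ|xQ] := boolP (x \in Q).
    by rewrite (bigD1 x)//= eqxx.
  have : ~~ ((x |: Q \subset A) && clean (x |: Q)).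
    apply/negP => H; have := Qmax _ H; rewrite cardsU1 xQ; lia.
  rewrite subUset sub1set xA QA /= => /cleanP H.
  have [v vQ [i evx]] : exists2 v, v \in Q & exists i, e i v x.
    case: (boolP [exists v in Q, exists i, e i v x]) => [/exists_inP[v vQ /existsP]|].
      by exists v.
    move=> /exists_inPn Hn; case: H => y z /setU1P[->|yQ] /setU1P[->|zQ] yz i.
    - by rewrite eqxx in yz.
    - by rewrite eC; have /existsPn := Hn z zQ; apply.
    - by have /existsPn := Hn y yQ; apply.
    - by move/cleanP: cQ; apply.
  rewrite (bigD1 v)//= (bigD1 i)//= evx andbT.
  by case: eqVneq.
apply: (@leq_ltn_trans (\sum_(x in A) \sum_(v in Q) ((x == v) + \sum_i ((x != v) && e i v x)))).
  by rewrite -sum1_card; apply: leq_sum.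
rewrite exchange_big /=.
apply: (@leq_ltn_trans (\sum_(v in Q) #|I| * M)).
  apply: leq_sum => v vQ; rewrite big_split exchange_big /=.
  have vA := subsetP QA v vQ.
  have -> : \sum_(x in A) (x == v) = 1.
    rewrite (bigD1 v)//= eqxx big1 ?addn0// => x /andP[_ /negbTE->//].
  apply: (@leq_trans (1 + \sum_(i : I) M.-1)).
    rewrite leq_add2l; apply: leq_sum => i _.
    rewrite -ltnS prednK//; apply: leq_trans (degM v i vA).
    rewrite ltnS -sum1_card big_mkcond [leqRHS]big_mkcond /=.
    by apply: leq_sum => x _; rewrite inE; case: (x \in A) => //=; case: (_ && _).
  rewrite sum_nat_const; case: M M0 {degM} => // M _ /=.
  by rewrite mulnS leq_add2r.
by rewrite sum_nat_const mulnCA mulnA ltn_mul2r M0 ltn_mul2l I0.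
Qed.

(** Off-diagonal Ramsey numbers grow polynomially in m, since a vertex of large
    degree in colour i reduces the clique wanted in colour i by one vertex. *)
Lemma ramsey_offdiag m S (s : I -> nat) (A : {set T}) :
  0 < #|I| -> 0 < m -> \sum_i s i <= S -> (#|I| * m) ^ S <= #|A| ->
  (exists i, exists2 Q : {set T}, Q \subset A & mono i Q /\ #|Q| = s i) \/
  (exists2 Q : {set T}, Q \subset A & clean Q /\ #|Q| = m).
Proof.
move=> I0 m0; elim: S s A => [|S IHS] s A sS Abig.
  left; case/card_gt0P: I0 => i _; exists i, set0; first exact: sub0set.
  split; first by apply/monoP => x y; rewrite inE.
  by rewrite cards0; move: sS; rewrite (bigD1 i)//=; lia.
case: (boolP [exists v in A, exists i,
    (#|I| * m) ^ S <= #|[set x in A | (x != v) && e i v x]|]); last first.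
  move=> /exists_inPn H; right; apply: (@clean_greedy A m ((#|I| * m) ^ S)) => //.
  - by rewrite expn_gt0 muln_gt0 I0 m0.
  - by move=> v i vA; rewrite ltnNge; have /existsPn := H v vA; apply.
  - by rewrite -expnS.
move=> /exists_inP[v vA /existsP[i big]]; set A' := [set x in _ | _] in big.
have A'A : A' \subset A by apply/subsetP => x; rewrite inE => /andP[].
case: (posnP (s i)) => [si0|si0].
  left; exists i, set0; first exact: sub0set.
  by rewrite cards0 si0; split=> //; apply/monoP => x y; rewrite inE.
pose s' j := if j == i then (s i).-1 else s j.
have s'S : \sum_j s' j <= S.
  move: sS; rewrite (bigD1 i)//= [X in _ -> X <= _](bigD1 i)//= {1}/s' eqxx.
  have -> : \sum_(j | j != i) s' j = \sum_(j | j != i) s j.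
    by apply: eq_bigr => j /negbTE ji; rewrite /s' ji.
  by lia.
case: (IHS s' A' s'S big) => [[j [Q QA' [jQ Qj]]]|[Q QA' Qc]]; last first.
  by right; exists Q => //; exact: subset_trans A'A.
left; exists j; move: Qj; rewrite /s'; case: eqVneq => [ji|ji] Qj; last first.
  by exists Q => //; exact: subset_trans A'A.
have vQ : v \notin Q.
  by apply/negP => /(subsetP QA'); rewrite inE eqxx /= andbF.
exists (v |: Q); first by rewrite subUset sub1set vA (subset_trans QA').
split; last by rewrite cardsU1 vQ Qj ji add1n prednK.
have ev x : x \in Q -> e j v x.
  by move=> /(subsetP QA'); rewrite inE ji => /and3P[].
apply/monoP => x y /setU1P[->|xQ] /setU1P[->|yQ] xy.
- by rewrite eqxx in xy.
- exact: ev.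
- by rewrite eC ev.
- by move/monoP: jQ; apply.
Qed.

End Ramsey.

Local Open Scope ring_scope.

(** * Colours that are rare inside a set *)

Section RamseyTuples.
Context {R : realFieldType}.
Variables (I X Y Z : finType) (c : I -> rel X).
Hypothesis cC : forall i x y, c i x y = c i y x.
Hypotheses (X0 : (0 < #|X|)%N) (I0 : (0 < #|I|)%N) (Z0 : (0 < #|Z|)%N).

Definition mono_map i (z : {ffun Y -> X}) :=
  [forall a, forall b, (a != b) ==> c i (z a) (z b)].
Definition clean_map (z : {ffun Z -> X}) :=
  [forall a, forall b, (a != b) ==> [forall i, ~~ c i (z a) (z b)]].

(** Polynomial in the size of Z, which makes the loss negligible against the
    n^2-th powers to come. *)
Definition ramsey_bound : nat := (#|I| * #|Z|) ^ (#|I| * #|Y|).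
Let N := ramsey_bound.

Lemma inj_into (S T : finType) (Q : {set T}) : #|Q| = #|S| ->
  exists2 sigma : {ffun S -> T}, injective sigma & forall s, sigma s \in Q.
Proof.
move=> QS; exists [ffun s => enum_val (cast_ord (esym QS) (enum_rank s))] => [s t|s].
  by rewrite !ffunE => /enum_val_inj/cast_ord_inj/enum_rank_inj.
by rewrite ffunE enum_valP.
Qed.

(** Every N-tuple contains a monochromatic or a clean subtuple; averaging over
    all N-tuples turns this into a count. *)
Lemma ramsey_count :
  1 <= \sum_i N%:R ^+ #|Y| * avg (fun z => (mono_map i z)%:R)
       + N%:R ^+ #|Z| * avg (fun z => (clean_map z)%:R) :> R.
Proof.
pose M f := \sum_i \sum_(s : {ffun Y -> 'I_N} | injectiveb s)
  (mono_map i [ffun y => f (s y)])%:R : R.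
pose C f := \sum_(s : {ffun Z -> 'I_N} | injectiveb s)
  (clean_map [ffun y => f (s y)])%:R : R.
have MC (f : {ffun 'I_N -> X}) : 1 <= M f + C f.
  pose e i a b := c i (f a) (f b).
  have eC i a b : e i a b = e i b a by exact: cC.
  have M0 : 0 <= M f by apply: sumr_ge0 => i _; apply: sumr_ge0.
  have C0 : 0 <= C f by apply: sumr_ge0.
  case: (@ramsey_offdiag _ _ e eC #|Z| (#|I| * #|Y|) (fun=> #|Y|) setT I0 Z0).
  - by rewrite sum_nat_const.
  - by rewrite cardsT card_ord.
  - move=> [i [Q _ [/monoP iQ /inj_into[s sI sQ]]]].
    have : 1 <= M f; last by lra.
    have sb : injectiveb s by exact/injectiveP.
    rewrite /M (bigD1 i)//= (bigD1 s)//=.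
    rewrite (_ : mono_map _ _); last first.
      apply/forallP => a; apply/forallP => b; apply/implyP => ab.
      by rewrite !ffunE; apply: iQ; rewrite ?(inj_eq sI).
    rewrite -addrA lerDl addr_ge0//; first exact: sumr_ge0.
    by apply: sumr_ge0 => j _; apply: sumr_ge0.
  - move=> [Q _ [/cleanP iQ /inj_into[s sI sQ]]].
    have : 1 <= C f; last by lra.
    have sb : injectiveb s by exact/injectiveP.
    rewrite /C (bigD1 s)//=.
    rewrite (_ : clean_map _); last first.
      apply/forallP => a; apply/forallP => b; apply/implyP => ab.
      by apply/forallP => i; rewrite !ffunE; apply: iQ; rewrite ?(inj_eq sI).
    by rewrite lerDl; apply: sumr_ge0.
have bound (S : finType) (P : {ffun S -> X} -> bool) :
    avg (fun f : {ffun 'I_N -> X} => \sum_(s : {ffun S -> 'I_N} | injectiveb s)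
      (P [ffun y => f (s y)])%:R)
    <= N%:R ^+ #|S| * avg (fun z => (P z)%:R) :> R.
  rewrite avg_sum.
  rewrite (eq_bigr (fun=> avg (fun z => (P z)%:R))) => [|s /injectiveP sI]; last first.
    exact: (avg_inj (fun z => (P z)%:R) X0 sI).
  apply: (@le_trans _ _ (\sum_(s : {ffun S -> 'I_N}) avg (fun z => (P z)%:R))).
    rewrite [leRHS](bigID (fun s : {ffun S -> 'I_N} => injectiveb s)) /= lerDl.
    by apply: sumr_ge0 => s _; apply: avg_ge0.
  by rewrite sumr_const card_ffun card_ord -[leLHS]mulr_natl (natrX R N).
have NX : (0 < #|{ffun 'I_N -> X}|)%N by rewrite card_ffun expn_gt0 X0.
rewrite -[leLHS](avg_cst 1 NX); apply: (le_trans (ler_avg MC)).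
rewrite avgD; apply: lerD; last exact: (bound Z clean_map).
by rewrite /M avg_sum; apply: ler_sum => i _; exact: (bound Y (mono_map i)).
Qed.

End RamseyTuples.

Section Far.
Context {R : realFieldType} {V X : finType} {k : nat}.
Variables (W : 'I_k -> X -> X -> R) (E : {set V * V}) (r : V).
Hypotheses (X0 : (0 < #|X|)%N) (k2 : (1 < k)%N).
Hypotheses (WC : forall i x y, W i x y = W i y x) (oE : oriented E).
Hypotheses (W0 : forall i x y, 0 <= W i x y) (W1 : forall x y, \sum_i W i x y = 1).

(** The density of the graph E together with a pendant edge at the vertex r,
    rooted at the new vertex. *)
Definition pendens (w : X -> X -> R) x := avg (fun u => w x u * rdens E w r u).

Lemma wt_ge0 (w : X -> X -> R) (f : {ffun V -> X}) :
  (forall x y, 0 <= w x y) -> 0 <= wt E w f.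
Proof. by move=> w0; apply: prodr_ge0. Qed.

Lemma rdens_ge0 (w : X -> X -> R) x :
  (forall x y, 0 <= w x y) -> 0 <= rdens E w r x.
Proof. by move=> w0; apply: avg_ge0 => f; exact: wt_ge0. Qed.

Lemma pendens_ge0 (w : X -> X -> R) x :
  (forall x y, 0 <= w x y) -> 0 <= pendens w x.
Proof. by move=> w0; apply: avg_ge0 => u; rewrite mulr_ge0 ?rdens_ge0. Qed.

Lemma pendensE (w : X -> X -> R) x :
  pendens w x = avg (fun f : {ffun V -> X} => w x (f r) * wt E w f).
Proof.
rewrite (avg_upd r _ X0) avg_exchange; apply: eq_avg => u.
by rewrite /rdens -avgZ; apply: eq_avg => f; rewrite ffunE eqxx.
Qed.

Section Subset.
Variables (T : {set X}) (J : {set 'I_k}) (eta del : R) (n : nat).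
Let X' : finType := {x | x \in T}.
Let tau : R := #|T|%:R / #|X|%:R.
Let N : nat := (k * (n + n)) ^ (k * #|V|.+1).
Hypotheses (T0 : (0 < #|T|)%N) (J0 : J != set0) (n0 : (0 < n)%N).
Hypotheses (eta0 : 0 < eta) (eta1 : k%:R * eta < 1) (del0 : 0 <= del).
Hypotheses (lowJ : forall x i, x \in T -> i \in J -> pendens (W i) x <= del)
  (highJ : forall x i, x \in T -> i \notin J -> del <= pendens (W i) x).
Hypothesis del_small :
  k%:R * N%:R ^+ #|V|.+1 * del <= 1 / 2 * (tau ^+ #|V| * eta ^+ #|E|.+1).

Let w i (x y : X') := W i (val x) (val y).
Let c i (x y : X') := (i \in J) && (eta <= w i x y).
Let cC i x y : c i x y = c i y x. Proof. by rewrite /c /w WC. Qed.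
Let X'E : #|X'| = #|T|. Proof. by rewrite card_sig; apply: eq_card. Qed.
Let X'0 : (0 < #|X'|)%N. Proof. by rewrite X'E. Qed.
Let tau0 : 0 < tau. Proof. by rewrite divr_gt0 ?ltr0n. Qed.

(** A colour i of J has few monochromatic cliques inside T, since each of them
    contains a copy of E with its pendant edge rooted in T. *)
Lemma mono_pendens i : i \in J ->
  tau ^+ #|V| * eta ^+ #|E|.+1 *
    avg (fun z : {ffun option V -> X'} => (mono_map c i z)%:R) <= del.
Proof.
move=> iJ; rewrite avg_ffun_option -[leRHS](@avg_cst _ X' _ X'0) -avgZ.
apply: ler_avg => x; apply: le_trans (lowJ (valP x) iJ).
rewrite pendensE -mulrA.
apply: le_trans (@avg_sub_ffun R V X' X val (fun f => W i (val x) (f r) * wt E (W i) f)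
  val_inj (fun f => mulr_ge0 (W0 _ _ _) (wt_ge0 f (W0 i)))).
rewrite X'E -/tau.
rewrite ler_wpM2l ?exprn_ge0 ?(ltW tau0)// -avgZ; apply: ler_avg => f.
case: (boolP (mono_map _ _ _)) => [/forallP m|_]; last first.
  by rewrite mulr0 mulr_ge0 ?wt_ge0.
have ge_eta a b : a != b -> eta <= W i
    (val ([ffun o => if o is Some v then f v else x] a : X'))
    (val ([ffun o => if o is Some v then f v else x] b : X')).
  by move=> ab; move/forallP: (m a) => /(_ b)/implyP/(_ ab)/andP[].
rewrite mulr1 exprS ler_pM ?exprn_ge0 ?(ltW eta0)//.
  by have := ge_eta None (Some r) isT; rewrite !ffunE.
rewrite /wt -prodr_const; apply: ler_prod => -[u v] uvE; rewrite (ltW eta0) /=.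
by have := ge_eta (Some u) (Some v) (oE uvE).1; rewrite !ffunE.
Qed.

(** Few monochromatic cliques in the colours of J force many clean tuples, on
    whose pairs the colours of J all have weight below eta. *)
Lemma clean_pairs : 1 / 2 <= N%:R ^+ (n + n) *
  avg (fun z : {ffun 'I_n + 'I_n -> X'} => (clean_map c z)%:R) :> R.
Proof.
have I0 : (0 < #|'I_k|)%N by rewrite card_ord (ltn_trans _ k2).
have Z0 : (0 < #|{: 'I_n + 'I_n}|)%N by rewrite card_sum !card_ord addn_gt0 n0.
have := @ramsey_count R 'I_k X' (option V) ('I_n + 'I_n)%type c cC X'0 I0 Z0.
rewrite /ramsey_bound card_option card_sum !card_ord -/N.
have : \sum_i N%:R ^+ #|V|.+1 *
   avg (fun z : {ffun option V -> X'} => (mono_map c i z)%:R) <= 1 / 2 :> R.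
  have pos : 0 < tau ^+ #|V| * eta ^+ #|E|.+1 by rewrite mulr_gt0 ?exprn_gt0.
  apply: (@le_trans _ _ (\sum_(i < k) (N%:R ^+ #|V|.+1 *
      (del / (tau ^+ #|V| * eta ^+ #|E|.+1))))).
    apply: ler_sum => i _; rewrite ler_wpM2l ?exprn_ge0//.
    have [iJ|iJ] := boolP (i \in J).
      by rewrite ler_pdivlMr// mulrC mono_pendens.
    rewrite (eq_avg (g := fun=> 0)) ?avg_cst ?divr_ge0// ?(ltW pos)//.
      by rewrite card_ffun expn_gt0 X'0.
    move=> z; case: (boolP (mono_map _ _ _)) => // /forallP/(_ None)/forallP/(_ (Some r)).
    by rewrite /c (negbTE iJ).
  by rewrite sumr_const card_ord -[leLHS]mulr_natl mulrA [leLHS]mulrA ler_pdivrMr.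
by lra.
Qed.

Let beta : R := (1 - k%:R * eta) / k.-1%:R.

(** On a clean K_{n,n} the colours outside J add up to almost 1 on each pair.
    Expanding the product over the pairs gives mixed copies of K_{n,n} in at
    most k - 1 colours, one of which must then be dense. *)
Lemma clean_colour : exists2 i, i \notin J &
  beta ^+ (n * n) / (4 * (n * n)%:R * N%:R ^+ (n + n)) <= Knn n (fun=> 1) (w i).
Proof.
set kap := _ / _.
have k1 : (0 : R) < k.-1%:R by rewrite ltr0n; lia.
have N0 : (0 : R) < N%:R by rewrite ltr0n expn_gt0 muln_gt0 addn_gt0 n0; lia.
have nn0 : (0 : R) < (n * n)%:R by rewrite ltr0n muln_gt0 n0.
have be0 : 0 < 1 - k%:R * eta by rewrite subr_gt0.
have [/existsP[i /andP[iJ ?]]|/existsPn none] := boolP [exists i,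
    (i \notin J) && (kap <= Knn n (fun=> 1) (w i))]; first by exists i.
exfalso; pose C : finType := {i | i \notin J}.
have low (i : C) : Knn n (fun=> 1) (w (val i)) <= kap.
  by have := none (val i); rewrite (valP i) /= -ltNge => /ltW.
have cardC : (#|C| <= k.-1)%N.
  have [i iJ] := set0Pn _ J0.
  rewrite card_sig -ltnS prednK; last by lia.
  rewrite -[leqRHS]card_ord; apply/proper_card/properP; split; first exact/subsetP.
  by exists i => //; rewrite inE iJ.
have avgE : avg (fun x : {ffun 'I_n -> X'} => avg (fun y : {ffun 'I_n -> X'} =>
    \prod_a \prod_b \sum_(i : C) w (val i) (x a) (y b))) <=
    (k.-1%:R ^+ (n * n)) * ((n * n)%:R * kap).
  have -> : avg (fun x : {ffun 'I_n -> X'} => avg (fun y : {ffun 'I_n -> X'} =>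
      \prod_a \prod_b \sum_(i : C) w (val i) (x a) (y b))) =
    \sum_(phi : {ffun 'I_n * 'I_n -> C}) avg (fun x : {ffun 'I_n -> X'} =>
      avg (fun y : {ffun 'I_n -> X'} => \prod_a \prod_b w (val (phi (a, b))) (x a) (y b))).
    rewrite -avg_sum; apply: eq_avg => x; rewrite -avg_sum; apply: eq_avg => y.
    rewrite pair_bigA /= (bigA_distr_bigA (fun p i => w (val i) (x p.1) (y p.2))) /=.
    by apply: eq_bigr => phi _; rewrite pair_bigA /=; apply: eq_bigr => -[].
  have kap0 : 0 <= kap.
    by rewrite divr_ge0 ?mulr_ge0 ?exprn_ge0 ?divr_ge0 ?(ltW be0) ?(ltW k1).
  apply: (@le_trans _ _ (\sum_(phi : {ffun 'I_n * 'I_n -> C}) (n * n)%:R * kap)).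
    apply: ler_sum => phi _.
    apply: le_trans (mixed_Knn (fun a b => phi (a, b)) n0
      (w := fun i : C => w (val i)) _ _) _.
    - by move=> *; exact: W0.
    - by move=> *; exact: WC.
    - apply: (@le_trans _ _ (\sum_(a < n) \sum_(b < n) kap)).
        by apply: ler_sum => a _; apply: ler_sum => b _; exact: low.
      by rewrite !sumr_const !card_ord -mulrnA mulr_natl.
  rewrite sumr_const card_ffun card_prod !card_ord -[leLHS]mulr_natl natrX.
  apply: ler_wpM2r; first by rewrite mulr_ge0.
  by rewrite lerXn2r ?nnegrE// ler_nat.
have avg_ge : (1 - k%:R * eta) ^+ (n * n) *
    avg (fun z : {ffun 'I_n + 'I_n -> X'} => (clean_map c z)%:R) <=
    avg (fun x : {ffun 'I_n -> X'} => avg (fun y : {ffun 'I_n -> X'} =>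
      \prod_a \prod_b \sum_(i : C) w (val i) (x a) (y b))).
  rewrite avg_ffun_sum -avgZ; apply: ler_avg => x; rewrite -avgZ; apply: ler_avg => y.
  case: (boolP (clean_map _ _)) => [/forallP cl|_]; last first.
    rewrite mulr0; do 2!(apply: prodr_ge0 => ? _); apply: sumr_ge0 => *; exact: W0.
  have -> : (1 - k%:R * eta) ^+ (n * n) = \prod_(p : 'I_n * 'I_n) (1 - k%:R * eta).
    by rewrite prodr_const card_prod !card_ord.
  rewrite mulr1 pair_bigA /=.
  apply: ler_prod => -[a b] _; rewrite (ltW be0) /=.
  rewrite -[X in X - _](W1 (val (x a)) (val (y b))) (bigID (mem J)) /= addrAC.
  have -> : \sum_(i : C) w (val i) (x a) (y b) = \sum_(i | i \notin J) W i (val (x a)) (val (y b)).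
    by rewrite -(big_sub (fun i => i \notin J) (fun i => W i (val (x a)) (val (y b)))).
  rewrite gerDr subr_le0.
  apply: (@le_trans _ _ (\sum_(i in J) eta)).
    apply: ler_sum => i iJ.
    move/forallP: (cl (inl a)) => /(_ (inr b))/implyP/(_ isT)/forallP/(_ i).
    by rewrite /c iJ !ffunE /= -ltNge => /ltW.
  rewrite sumr_const -[leLHS]mulr_natl ler_wpM2r ?(ltW eta0)// ler_nat.
  by rewrite -[leqRHS]card_ord max_card.
have Cl := clean_pairs.
have P0 : 0 < (1 - k%:R * eta) ^+ (n * n) by rewrite exprn_gt0.
have := le_trans avg_ge avgE.
have -> : k.-1%:R ^+ (n * n) * ((n * n)%:R * kap) =
    (1 - k%:R * eta) ^+ (n * n) / N%:R ^+ (n + n) / 4.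
  rewrite /kap /beta expr_div_n; field.
  by rewrite !expf_neq0 ?gt_eqF// ltr0n.
move: Cl; set cl := avg _ => Cl.
rewrite -!mulrA ler_pM2l// => /(ler_wpM2l (exprn_ge0 (n + n) (ltW N0))).
rewrite mulrA divff; last by rewrite gt_eqF// exprn_gt0.
by lra.
Qed.

Lemma Knn_subset i : i \notin J ->
  (tau ^+ 2 * del) ^+ n * Knn n (fun=> 1) (w i) <= Knn n (pendens (W i)) (W i).
Proof.
move=> iJ.
have A0 (y : {ffun 'I_n -> X}) : 0 <= avg (fun x => pendens (W i) x * \prod_b W i x (y b)).
  by apply: avg_ge0 => x; rewrite mulr_ge0 ?pendens_ge0 ?prodr_ge0.
apply: le_trans (@avg_sub_ffun R 'I_n X' X val (fun y : {ffun 'I_n -> X} =>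
  avg (fun x => pendens (W i) x * \prod_b W i x (y b)) ^+ n) val_inj
  (fun y => exprn_ge0 n (A0 y))).
rewrite X'E card_ord -/tau.
rewrite expr2 -mulrA exprMn -mulrA ler_wpM2l ?exprn_ge0 ?(ltW tau0)//.
rewrite /Knn -avgZ; apply: ler_avg => y; rewrite -exprMn.
have td0 : 0 <= tau * del by rewrite mulr_ge0 ?(ltW tau0).
have P0 : 0 <= avg (fun x => 1 * \prod_b w i x (y b)).
  by apply: avg_ge0 => x; rewrite mul1r; apply: prodr_ge0 => b _; exact: W0.
rewrite lerXn2r ?nnegrE ?A0//; first by rewrite mulr_ge0.
apply: le_trans (@avg_sub R X' X val (fun x =>
  pendens (W i) x * \prod_b W i x ([ffun b => val (y b)] b)) val_inj
  (fun x => mulr_ge0 (pendens_ge0 x (W0 i)) (prodr_ge0 _ (fun b _ => W0 i _ _)))).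
rewrite X'E -/tau.
rewrite -mulrA ler_wpM2l ?(ltW tau0)// -avgZ; apply: ler_avg => x.
rewrite mul1r; under [in leRHS]eq_bigr do rewrite ffunE.
rewrite ler_wpM2r ?highJ ?(valP x)//.
by apply: prodr_ge0 => b _; exact: W0.
Qed.

(** Colours of J are nearly absent inside T, so the others are too dense. *)
Lemma far_subset : exists i,
  (tau ^+ 2 * del) ^+ n * (beta ^+ (n * n) / (4 * (n * n)%:R * N%:R ^+ (n + n)))
  <= Knn n (pendens (W i)) (W i).
Proof.
have [i iJ h] := clean_colour; exists i; apply: le_trans (Knn_subset iJ).
by rewrite ler_wpM2l// exprn_ge0// mulr_ge0 ?exprn_ge0 ?(ltW tau0).
Qed.

End Subset.
End Far.

(** * Boxes on which a colour is too dense *)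

Section DenseBox.
Context {R : realFieldType} {X : finType} {k : nat}.
Variables (U : 'I_k -> X -> X -> R) (B : R).
Hypotheses (X0 : (0 < #|X|)%N) (B1 : 1 <= B).
Hypotheses (UB : forall i x y, `|U i x y| <= B).
Hypotheses (U0 : forall x y, \sum_i U i x y = 0).

Definition boxavg (w : X -> X -> R) (f h : X -> R) :=
  avg (fun x => f x * avg (fun y => h y * w x y)).

Definition unit_valued (f : X -> R) := forall x, 0 <= f x <= 1.

Let B0 : 0 < B. Proof. exact: lt_le_trans B1. Qed.

Lemma split_sign (f : X -> R) : (forall x, `|f x| <= B) -> exists fp fm,
  [/\ unit_valued fp, unit_valued fm & forall x, f x = B * (fp x - fm x)].
Proof.
move=> fB; exists (fun x => if 0 <= f x then f x / B else 0),
  (fun x => if 0 <= f x then 0 else - f x / B).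
split=> x; have := fB x; rewrite ler_norml => /andP[fl fu].
- by case: ifPn => [f0|_]; rewrite ?lexx ?ler01 ?divr_ge0 ?(ltW B0)// ler_pdivrMr// mul1r.
- case: ifPn => [_|]; rewrite ?lexx ?ler01// -ltNge => f0.
  by rewrite divr_ge0 ?oppr_ge0 ?(ltW f0) ?(ltW B0)// ler_pdivrMr// mul1r lerNl.
- by case: ifPn => _; field; rewrite gt_eqF.
Qed.

(** The average defining t(C_4, U) has a large term, which is the average of U
    against a product of two rows of U.  Splitting the rows by sign gives a
    weighted box where U i0 is far from 0; as the colours add up to 0, some
    colour is then too dense on it. *)
Lemma dense_box i0 (c : R) : 0 < c ->
  c < avg (fun x => avg (fun y => codeg (U i0) x y ^+ 2)) ->
  exists j f h, [/\ unit_valued f, unit_valued h &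
    c / (4 * k%:R * B ^+ 3) <= boxavg (U j) f h].
Proof.
move=> c0 c4.
pose u := U i0.
have t4E : avg (fun x => avg (fun y => codeg u x y ^+ 2)) =
    avg (fun x' => avg (fun y' => u x' y' * boxavg u (fun x => u x y') (fun y => u x' y))).
  transitivity (avg (fun x => avg (fun x' => avg (fun y => avg (fun y' =>
      (u x y * u x' y) * (u x y' * u x' y')))))).
    by apply: eq_avg => x; apply: eq_avg => x'; rewrite expr2 avgM.
  rewrite [LHS]avg_exchange; apply: eq_avg => x'.
  transitivity (avg (fun x => avg (fun y' => avg (fun y =>
      (u x y * u x' y) * (u x y' * u x' y'))))).
    by apply: eq_avg => x; rewrite [LHS]avg_exchange.
  rewrite [LHS]avg_exchange; apply: eq_avg => y'.
  rewrite /boxavg -avgZ; apply: eq_avg => x; rewrite -!avgZ; apply: eq_avg => y.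
  by ring.
have [x' [y' big]] : exists x' y', c / B < `|boxavg u (fun x => u x y') (fun y => u x' y)|.
  case: (boolP [exists x', exists y', c / B < `|boxavg u (fun x => u x y') (fun y => u x' y)|]).
    by move=> /existsP[x' /existsP[y' ?]]; exists x', y'.
  move=> /existsPn none; exfalso; move: c4; rewrite -/u t4E; apply/negP; rewrite -leNgt.
  rewrite -[leRHS](@avg_cst _ X _ X0); apply: ler_avg => x'.
  rewrite -[leRHS](@avg_cst _ X _ X0); apply: ler_avg => y'.
  apply: le_trans (ler_norm _) _; rewrite normrM.
  have := none x' => /existsPn/(_ y'); rewrite -leNgt => h.
  rewrite -[leRHS](divfK (lt0r_neq0 B0)) [leRHS]mulrC; apply: ler_pM => //; exact: UB.
have [fp [fm [fp1 fm1 fE]]] := @split_sign (fun x => u x y') (fun x => UB _ _ _).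
have [hp [hm [hp1 hm1 hE]]] := @split_sign (fun y => u x' y) (fun y => UB _ _ _).
have bE : boxavg u (fun x => u x y') (fun y => u x' y) =
    B ^+ 2 * (boxavg u fp hp - boxavg u fp hm - boxavg u fm hp + boxavg u fm hm).
  rewrite /boxavg -!avgB -avgD -avgZ; apply: eq_avg => x.
  rewrite (fE x) (_ : avg _ = B * (avg (fun y => hp y * u x y) - avg (fun y => hm y * u x y))).
    by ring.
  by rewrite -avgB -avgZ; apply: eq_avg => y; rewrite (hE y); ring.
pose d := c / (4 * B ^+ 3).
have [f [h [f1 h1 fh]]] : exists f h, [/\ unit_valued f, unit_valued h & d < `|boxavg u f h|].
  case: (ltP d `|boxavg u fp hp|) => [|l1]; first by exists fp, hp.
  case: (ltP d `|boxavg u fp hm|) => [|l2]; first by exists fp, hm.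
  case: (ltP d `|boxavg u fm hp|) => [|l3]; first by exists fm, hp.
  case: (ltP d `|boxavg u fm hm|) => [|l4]; first by exists fm, hm.
  exfalso; move: big; apply/negP; rewrite -leNgt bE normrM ger0_norm ?sqr_ge0//.
  rewrite (_ : c / B = B ^+ 2 * (4 * d)); last by rewrite /d; field; rewrite gt_eqF.
  rewrite ler_wpM2l ?sqr_ge0//; move: l1 l2 l3 l4; rewrite !ler_norml.
  move=> /andP[? ?] /andP[? ?] /andP[? ?] /andP[? ?].
  by apply/andP; split; lra.
have d0 : 0 < d by rewrite divr_gt0// mulr_gt0// exprn_gt0.
have k1 : (0 < k)%N by exact: leq_ltn_trans (ltn_ord i0).
have kp : (0 : R) < k%:R by rewrite ltr0n.
have dE : c / (4 * k%:R * B ^+ 3) = d / k%:R by rewrite /d; field; rewrite !gt_eqF.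
have dk : d / k%:R <= d.
  by rewrite ler_pdivrMr// ler_peMr ?(ltW d0)// ler1n.
have sum0 : \sum_j boxavg (U j) f h = 0.
  rewrite /boxavg -avg_sum (eq_avg (g := fun=> 0)) ?avg_cst// => x.
  rewrite -mulr_sumr -avg_sum (eq_avg (g := fun=> 0)) ?avg_cst ?mulr0// => y.
  by rewrite -mulr_sumr U0 mulr0.
case: (boolP [exists j, d / k%:R <= boxavg (U j) f h]) => [/existsP[j jd]|/existsPn none].
  by exists j, f, h; rewrite dE.
exfalso; have low j : boxavg (U j) f h <= d / k%:R.
  by have := none j; rewrite -ltNge => /ltW.
have neg : boxavg u f h < - d.
  move: fh; case: (lerP 0 (boxavg u f h)) => [b0|b0]; last by rewrite ltrNr ltr0_norm.
  by rewrite ger0_norm// ltNge (le_trans (low i0)).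
have : \sum_j boxavg (U j) f h < 0; last by rewrite sum0 ltxx.
rewrite (bigD1 i0)//= -/u.
apply: (@lt_le_trans _ _ (- d + \sum_(j | j != i0) d / k%:R)).
  by rewrite ltr_leD// ler_sum.
apply: (@le_trans _ _ (- d + \sum_(j < k) d / k%:R)).
  rewrite lerD2l [leRHS](bigD1 i0)//= lerDr divr_ge0// ltW//.
  by rewrite sumr_const card_ord -[_ *+ k]mulr_natr divfK ?gt_eqF// addNr.
Qed.

End DenseBox.

Section Growth.
Context {R : archiRealFieldType}.

(** Bernoulli's inequality for t ^ (n / (D + 1)), raised to the power D + 1. *)
Lemma exp_beats_power (t c : R) D : 1 < t -> 0 < c ->
  exists n0, forall n, (n0 <= n)%N -> n%:R ^+ D <= c * t ^+ n.
Proof.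
move=> t1 c0; set a := t - 1; have a0 : 0 < a by rewrite subr_gt0.
pose K := (a / (2 * D.+1%:R)) ^+ D.+1.
have K0 : 0 < K by rewrite exprn_gt0// divr_gt0// mulr_gt0// ltr0n.
pose n1 := Num.bound (c * K)^-1; exists (maxn n1 D.+1) => n.
rewrite geq_max => /andP[n1n Dn].
have q0 : (0 : R) <= (n %/ D.+1)%:R by [].
have step : K * n%:R ^+ D.+1 <= t ^+ n.
  apply: (@le_trans _ _ ((t ^+ (n %/ D.+1)) ^+ D.+1)); last first.
    by rewrite -exprM ler_weXn2l ?(ltW t1)// leq_trunc_div.
  have an0 : 0 <= a / (2 * D.+1%:R) * n%:R.
    by apply: mulr_ge0 => //; apply: divr_ge0; rewrite ?mulr_ge0 ?(ltW a0).
  have tq0 : 0 <= t ^+ (n %/ D.+1) by rewrite exprn_ge0// (le_trans ler01 (ltW t1)).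
  rewrite /K -exprMn lerXn2r ?nnegrE//.
  apply: (@le_trans _ _ ((n %/ D.+1)%:R * a)); last first.
     by apply: le_trans (bernoulli_ineq _ (le_trans ler01 (ltW t1))); rewrite lerDr.
  rewrite mulrAC ler_pdivrMr ?mulr_gt0 ?ltr0n//.
  rewrite [a * _]mulrC mulrAC ler_wpM2r ?(ltW a0)// mulrCA -!natrM ler_nat.
  have := divn_eq n D.+1; have := ltn_pmod n (ltn0Sn D).
  have : (0 < n %/ D.+1)%N by rewrite divn_gt0.
  set u := (n %/ D.+1)%N; set v := (n %% D.+1)%N => u0 vD ->.
  rewrite -/u mulnC; nia.
apply: (@le_trans _ _ (c * (K * n%:R ^+ D.+1))); last by rewrite ler_wpM2l// ltW.
rewrite mulrA exprSr mulrCA -[leLHS]mulr1 ler_wpM2l ?exprn_ge0//.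
rewrite -ler_pdivrMl ?mulr_gt0// mulr1; apply: (@le_trans _ _ n1%:R); last by rewrite ler_nat.
by apply/ltW/archi_boundP; rewrite invr_ge0 mulr_ge0 ?(ltW c0) ?(ltW K0).
Qed.

End Growth.

(** * The inequality on finite sets *)

Section Scaling.
Context {R : realFieldType} {V X : finType}.
Variables (E : {set V * V}) (r : V) (p : R) (U W : X -> X -> R).
Hypotheses (p0 : 0 < p) (WU : forall x y, W x y = p * (1 + U x y)).

Lemma pendens_scale x : pendens E r W x = p ^+ #|E|.+1 * pend U (excess U E r) x.
Proof.
rewrite /pendens /pend -[RHS]avgZ; apply: eq_avg => u.
have -> : rdens E W r u = p ^+ #|E| * rdens E (shift1 U) r u.
  rewrite /rdens -avgZ; apply: eq_avg => f; rewrite /wt -prodr_const -big_split /=.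
  by apply: eq_bigr => e _; rewrite WU.
by rewrite /excess WU exprS /shift1; ring.
Qed.

Lemma Knn_scale n : Knn n (pendens E r W) W =
  p ^+ (n * n + n * #|E|.+1) * Knn n (pend U (excess U E r)) (shift1 U).
Proof.
rewrite /Knn -avgZ; apply: eq_avg => y.
have -> : p ^+ (n * n + n * #|E|.+1) = (p ^+ (n + #|E|.+1)) ^+ n.
  by rewrite -exprM mulnDl [(_.+1 * n)%N]mulnC.
rewrite -exprMn; congr (_ ^+ n); rewrite -avgZ; apply: eq_avg => x.
rewrite pendens_scale; under eq_bigr do rewrite WU.
by rewrite big_split /= prodr_const card_ord exprD /shift1; ring.
Qed.

End Scaling.

Lemma norm_dev_le (R : realFieldType) (b w : R) : 1 <= b -> 0 <= w -> w <= 1 ->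
  `|b * w - 1| <= b.
Proof.
move=> b1 w0 w1; have b0 : 0 <= b by exact: le_trans ler01 b1.
have h1 : b * w <= b * 1 by rewrite ler_wpM2l.
have h2 : 0 <= b * w by rewrite mulr_ge0.
by rewrite ler_norml; apply/andP; split; lra.
Qed.

(** This and the next lemmas do the bookkeeping for the choice of n, with all
    powers abstracted. *)
Lemma sparse_size (R : realFieldType) (t c b Q P m T Nv N2 : R) :
  0 < b -> 0 < Q -> 0 < Nv -> 0 < N2 -> Nv * N2 = Q * P ->
  P * m <= t * c / (4 * b * Q) * T -> 4 * b * m <= t * (c / Nv) * T / N2.
Proof.
move=> b0 Q0 Nv0 N20 NE.
have bQ : 0 < 4 * b * Q by rewrite mulr_gt0// mulr_gt0.
rewrite mulrAC ler_pdivlMr// => h; rewrite ler_pdivlMr//.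
rewrite (_ : t * (c / Nv) * T = t * c * T / Nv) ?ler_pdivlMr//; last by ring.
apply: le_trans h; rewrite le_eqVlt; apply/orP; left; apply/eqP.
by rewrite -mulrA [N2 * Nv]mulrC NE; ring.
Qed.

Lemma dense_size (R : realFieldType) (c e b Q P T Nv : R) :
  0 < b -> 0 < Q -> 0 < Nv -> Nv = Q * P ->
  P <= c * e / (b * Q) * T -> b <= c / Nv * e * T.
Proof.
move=> b0 Q0 Nv0 NE.
have bQ : 0 < b * Q by rewrite mulr_gt0.
rewrite mulrAC ler_pdivlMr// => h.
rewrite (_ : c / Nv * e * T = c * e * T / Nv) ?ler_pdivlMr//; last by ring.
by apply: le_trans h; rewrite NE le_eqVlt; apply/orP; left; apply/eqP; ring.
Qed.

Lemma sparse_power (R : realFieldType) (a t p M N : R) n : 0 < M -> 0 < N ->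
  a ^+ n * ((p * t) ^+ (n * n) / (4 * M * N ^+ (n + n))) =
  p ^+ (n * n) * ((a * t ^+ n / N ^+ 2) ^+ n / (4 * M)).
Proof.
move=> M0 N0; rewrite expr_div_n [(p * t) ^+ _]exprMn [(a * _) ^+ _]exprMn -!exprM addnn -mul2n.
by field; rewrite !gt_eqF ?exprn_gt0.
Qed.

Lemma dense_power (R : realFieldType) (a t p : R) n :
  a ^+ n * (p * t) ^+ (n * n) = p ^+ (n * n) * (a * t ^+ n) ^+ n.
Proof. by rewrite [(p * t) ^+ _]exprMn [(a * _) ^+ _]exprMn -exprM mulrCA. Qed.

Section FiniteCommon.
Context {R : archiRealFieldType} {V : finType} {k : nat}.
Variables (E : {set V * V}) (r : V).
Hypotheses (k2 : (1 < k)%N) (oE : oriented E).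
Hypothesis tE : forall a b c, linked E a b -> linked E b c -> ~~ linked E a c.

Let B : R := k%:R.
Let p : R := k%:R^-1.
Let q := #|E|.
Let C : R := expansion_cst B E.
Let eps : R := (2000 * C * B ^+ 2 * (q.+1)%:R)^-1.

Let B1 : 1 <= B. Proof. by rewrite ler1n ltnW. Qed.
Let B0 : 0 < B. Proof. exact: lt_le_trans B1. Qed.
Let p0 : 0 < p. Proof. by rewrite invr_gt0. Qed.
Let C1 : 1 <= C. Proof. exact: expansion_cst_ge1. Qed.
Let C0 : 0 < C. Proof. exact: lt_le_trans C1. Qed.
Let eps0 : 0 < eps.
Proof.
rewrite invr_gt0; apply: mulr_gt0; last by rewrite ltr0n.
by apply: mulr_gt0; [exact: mulr_gt0 | exact: exprn_gt0].
Qed.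

Let Q0 : (0 : R) < (q.+1)%:R. Proof. by rewrite ltr0n. Qed.

Let epsC : eps * C * B ^+ 2 <= 1 / 2000.
Proof.
rewrite /eps; move: (q.+1)%:R Q0 (ler1n R q.+1) C B C0 B0 => Q Qp Q1 c b cp bp.
have -> : (2000 * c * b ^+ 2 * Q)^-1 * c * b ^+ 2 = (2000 * Q)^-1.
  by field; rewrite !gt_eqF.
by rewrite mul1r lef_pV2 ?posrE ?mulr_gt0// ler_peMr// Q1.
Qed.

Let epsq : eps * (q%:R + 1) <= 1 / 8.
Proof.
rewrite natr1 /eps; move: (q.+1)%:R Q0 C B C1 B1 => Q Qp c b c1 b1.
have cp : 0 < c by exact: lt_le_trans c1.
have bp : 0 < b by exact: lt_le_trans b1.
have -> : (2000 * c * b ^+ 2 * Q)^-1 * Q = (2000 * c * b ^+ 2)^-1.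
  by field; rewrite !gt_eqF.
apply: (@le_trans _ _ 2000^-1); last by lra.
by rewrite lef_pV2 ?posrE ?mulr_gt0// -mulrA ler_peMr// mulr_ege1 ?exprn_ege1.
Qed.

Section Space.
Context {X : finType}.
Variables (W : 'I_k -> X -> X -> R).
Hypotheses (X0 : (0 < #|X|)%N) (WC : forall i x y, W i x y = W i y x).
Hypotheses (W0 : forall i x y, 0 <= W i x y) (W1 : forall x y, \sum_i W i x y = 1).

Let U i x y := k%:R * W i x y - 1.
Let WU i x y : W i x y = p * (1 + U i x y).
Proof. by rewrite /U /p addrC subrK mulrA mulVf ?mul1r ?gt_eqF. Qed.
Let UC i x y : U i x y = U i y x. Proof. by rewrite /U WC. Qed.
Let Wle1 i x y : W i x y <= 1.
Proof. by rewrite -(W1 x y) (bigD1 i)//= lerDl sumr_ge0. Qed.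
Let UB i x y : `|U i x y| <= B. Proof. exact: norm_dev_le. Qed.
Let U0 x y : \sum_i U i x y = 0.
Proof. by rewrite sumrB -mulr_sumr W1 sumr_const card_ord mulr1 subrr. Qed.

(** All colours are close to the constant 1 / k: the first order terms cancel in
    the sum over the colours. *)
Lemma common_local s : 256 * C <= s%:R ->
  (forall i, avg (fun x => avg (fun y => codeg (U i) x y ^+ 2)) <= eps ^+ 4) ->
  k%:R * p ^+ ((4 * s) * (4 * s) + (4 * s) * q.+1) <=
  \sum_i Knn (4 * s) (pendens E r (W i)) (W i).
Proof.
move=> sC small; set n := (4 * s)%N.
have low i : p ^+ (n * n + n * q.+1) *
    (1 + n%:R * ((q%:R + 1 + 4 * s%:R) * avg (deg (U i)))) <=
    Knn n (pendens E r (W i)) (W i).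
  rewrite (Knn_scale E r (WU i)) ler_wpM2l ?exprn_ge0 ?(ltW p0)//.
  have sh0 x y : 0 <= shift1 (U i) x y by rewrite /shift1 /U addrC subrK mulr_ge0.
  apply: (local_gain X0 B1 eps0 (UC i) (UB i) (small i) C1 _ _ _ epsC epsq) => //.
  - exact: (excess_sqr r X0 B1 (UC i) (UB i) oE).
  - exact: (excess_avg r X0 B1 (UC i) (UB i) oE tE).
  - move=> x; apply: avg_ge0 => u; apply: mulr_ge0 => //.
    rewrite /excess addrC subrK; apply: avg_ge0 => f; apply: prodr_ge0 => e _.
    exact: sh0.
apply: le_trans (ler_sum _ (fun i _ => low i)).
rewrite -mulr_sumr big_split /= sumr_const card_ord -!mulr_sumr.
have -> : \sum_i avg (deg (U i)) = 0.
  rewrite -avg_sum (eq_avg (g := fun=> 0)) ?avg_cst// => x.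
  by rewrite /deg -avg_sum (eq_avg (g := fun=> 0)) ?avg_cst.
by rewrite !mulr0 addr0 mulrC.
Qed.

Section FarFromConstant.
Variables (n : nat) (eps1 eta del : R).
Let tau0 : R := eps1 / (2 ^+ k.+1 * B).
Let N : nat := (k * (n + n)) ^ (k * #|V|.+1).
Hypotheses (n0 : (0 < n)%N) (eps10 : 0 < eps1).
Hypotheses (eta0 : 0 < eta) (eta1 : k%:R * eta < 1) (del0 : 0 < del).
Hypothesis del_small :
  k%:R * N%:R ^+ #|V|.+1 * del <= 1 / 2 * (tau0 ^+ #|V| * eta ^+ #|E|.+1).

Let low x := [set i | pendens E r (W i) x < del].

Lemma far_sparse (J : {set 'I_k}) : J != set0 ->
  tau0 * #|X|%:R <= #|[set x | low x == J]|%:R ->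
  exists i, (tau0 ^+ 2 * del) ^+ n *
    (((1 - k%:R * eta) / k.-1%:R) ^+ (n * n) / (4 * (n * n)%:R * N%:R ^+ (n + n)))
    <= Knn n (pendens E r (W i)) (W i).
Proof.
move=> J0 Tbig; set T := [set x | low x == J] in Tbig.
have Xp : (0 : R) < #|X|%:R by rewrite ltr0n.
have tau00 : 0 < tau0 by rewrite divr_gt0// mulr_gt0// exprn_gt0.
have T0 : (0 < #|T|)%N by rewrite -(ltr0n R); apply: lt_le_trans Tbig; rewrite mulr_gt0.
have tT : tau0 <= #|T|%:R / #|X|%:R by rewrite ler_pdivlMr.
have lowJ x i : x \in T -> i \in J -> pendens E r (W i) x <= del.
  by rewrite inE => /eqP<-; rewrite inE => /ltW.
have highJ x i : x \in T -> i \notin J -> del <= pendens E r (W i) x.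
  by rewrite inE => /eqP<-; rewrite inE -leNgt.
have small : k%:R * N%:R ^+ #|V|.+1 * del <=
    1 / 2 * ((#|T|%:R / #|X|%:R) ^+ #|V| * eta ^+ #|E|.+1).
  apply: (le_trans del_small); rewrite ler_wpM2l//; first by rewrite divr_ge0.
  rewrite ler_wpM2r ?exprn_ge0 ?(ltW eta0)// lerXn2r ?nnegrE ?(ltW tau00)//.
  by apply: le_trans tT; exact: ltW.
have [i h] := @far_subset R V X k W E r X0 k2 WC oE W0 W1 T J eta del n
  T0 J0 n0 eta0 eta1 (ltW del0) lowJ highJ small.
exists i; apply: le_trans h; rewrite ler_wpM2r//.
  apply: divr_ge0; last by rewrite !mulr_ge0 ?exprn_ge0.
  by apply/exprn_ge0/divr_ge0 => //; rewrite subr_ge0 ltW.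
rewrite lerXn2r ?nnegrE ?(mulr_ge0 (sqr_ge0 _) (ltW del0))//.
rewrite ler_wpM2r ?(ltW del0)// lerXn2r ?nnegrE ?(ltW tau00)//.
by rewrite divr_ge0.
Qed.

(** Almost every vertex sees many copies of E in every colour, so the box where
    the colour j is too dense may be restricted to such vertices. *)
Lemma far_dense (j : 'I_k) (f h : X -> R) : unit_valued f -> unit_valued h ->
  eps1 <= boxavg (U j) f h ->
  (forall J : {set 'I_k}, J != set0 ->
     #|[set x | low x == J]|%:R <= tau0 * #|X|%:R) ->
  (del * (eps1 / (2 * B))) ^+ n * (p * (1 + eps1 / 2)) ^+ (n * n)
  <= Knn n (pendens E r (W j)) (W j).
Proof.
move=> f1 h1 fh Tsmall.
have Xp : (0 : R) < #|X|%:R by rewrite ltr0n.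
pose f' x := if low x == set0 then f x else 0.
have f'0 x : 0 <= f' x by rewrite /f'; case: ifP => // _; case/andP: (f1 x).
have f'1 x : f' x <= 1 by rewrite /f'; case: ifP => // _; case/andP: (f1 x).
have h0 x : 0 <= h x by case/andP: (h1 x).
have hle x : h x <= 1 by case/andP: (h1 x).
pose bad x : R := (low x != set0)%:R.
have bad_small : avg bad <= eps1 / (2 * B).
  have -> : avg bad = \sum_(J : {set 'I_k} | J != set0) #|[set x | low x == J]|%:R / #|X|%:R.
    rewrite avgE -mulr_suml; congr (_ / _).
    transitivity (\sum_x \sum_(J : {set 'I_k} | J != set0) (low x == J)%:R : R).
      apply: eq_bigr => x _; rewrite /bad; case: (boolP (low x != set0)) => [l0|].
        rewrite (bigD1 (low x))//= eqxx big1 ?addr0// => J /andP[_].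
        by rewrite eq_sym => /negbTE->.
      rewrite negbK => /eqP->; rewrite big1// => J.
      by rewrite eq_sym => /negbTE->.
    rewrite exchange_big /=; apply: eq_bigr => J _.
    rewrite -sum1_card natr_sum [RHS]big_mkcond; apply: eq_bigr => x _.
    by rewrite inE; case: eqP.
  apply: (@le_trans _ _ (\sum_(J : {set 'I_k}) tau0)).
    rewrite big_mkcond; apply: ler_sum => J _; case: ifP => [J0|_].
      by rewrite ler_pdivrMr// Tsmall.
    by rewrite divr_ge0 ?mulr_ge0 ?exprn_ge0 ?(ltW B0) ?(ltW eps10).
  have set2k : #|{set 'I_k}| = (2 ^ k)%N.
    by rewrite -cardsT -powersetT card_powerset cardsT card_ord.
  rewrite sumr_const set2k -[leLHS]mulr_natl natrX /tau0 exprS.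
  rewrite le_eqVlt; apply/orP; left; apply/eqP; field.
  by rewrite !gt_eqF ?exprn_gt0.
have fh' : eps1 / 2 <= boxavg (U j) f' h.
  have : boxavg (U j) f h - boxavg (U j) f' h <= B * avg bad.
    rewrite /boxavg -avgB -avgZ; apply: ler_avg => x; rewrite -mulrBl /f' /bad.
    case: eqP => [_|_]; first by rewrite subrr mul0r mulr0.
    rewrite subr0 mulr1; case/andP: (f1 x) => fx0 fx1.
    apply: le_trans (ler_norm _) _; rewrite normrM ger0_norm//.
    rewrite -[leRHS]mul1r ler_pM//; apply: le_trans (ler_norm_avg _) _.
    rewrite -[leRHS](@avg_cst _ X _ X0); apply: ler_avg => y.
    by rewrite normrM ger0_norm// -[leRHS]mul1r ler_pM.
  have : B * avg bad <= eps1 / 2.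
    apply: (@le_trans _ _ (B * (eps1 / (2 * B)))); first by rewrite ler_wpM2l// ltW.
    by rewrite le_eqVlt; apply/orP; left; apply/eqP; field; rewrite gt_eqF.
  by lra.
set F := avg f'; set H := avg h.
have F0 : 0 <= F by exact: avg_ge0.
have H0 : 0 <= H by exact: avg_ge0.
have F1 : F <= 1 by rewrite -(@avg_cst R X 1 X0); exact: ler_avg.
have H1 : H <= 1 by rewrite -(@avg_cst R X 1 X0); exact: ler_avg.
have FH_ge : eps1 / (2 * B) <= F * H.
  have : boxavg (U j) f' h <= B * (F * H).
    rewrite /F /H avgM -avgZ; apply: ler_avg => x; rewrite -!avgZ; apply: ler_avg => y.
    rewrite [leRHS]mulrCA ler_wpM2l// [leRHS]mulrC ler_wpM2l//.
    by apply: le_trans (ler_norm _) (UB _ _ _).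
  move=> hb; have -> : eps1 / (2 * B) = (eps1 / 2) / B by field; rewrite gt_eqF.
  by rewrite ler_pdivrMr// [leRHS]mulrC (le_trans fh').
have FH0 : 0 < F * H by apply: lt_le_trans FH_ge; rewrite divr_gt0// mulr_gt0.
have F00 : 0 < F by rewrite lt0r F0 andbT; apply: contraTneq FH0 => ->; rewrite mul0r ltxx.
have H00 : 0 < H by rewrite lt0r H0 andbT; apply: contraTneq FH0 => ->; rewrite mulr0 ltxx.
have FH1 : F * H <= 1 by rewrite -[leRHS]mulr1 ler_pM.
have Wbox : boxavg (W j) f' h = p * (F * H + boxavg (U j) f' h).
  rewrite /F /H avgM /boxavg -avgD -avgZ; apply: eq_avg => x.
  rewrite -!avgZ -avgD -avgZ; apply: eq_avg => y.
  by rewrite (WU j); ring.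
have ratio : p * (1 + eps1 / 2) <= boxavg (W j) f' h / (F * H).
  rewrite ler_pdivlMr// Wbox -mulrA ler_wpM2l ?(ltW p0)//.
  have : eps1 / 2 * (F * H) <= eps1 / 2 * 1 by rewrite ler_wpM2l// divr_ge0// ltW.
  by lra.
have := Knn_ge_box n f'0 h0 (W0 j) F00 H00; rewrite -/F -/H -/(boxavg (W j) f' h) => box.
apply: (@le_trans _ _ (del ^+ n * ((F * H) ^+ n * (boxavg (W j) f' h / (F * H)) ^+ (n * n)))).
  rewrite exprMn -mulrA ler_wpM2l ?exprn_ge0 ?(ltW del0)//.
  apply: ler_pM.
  - by rewrite exprn_ge0// divr_ge0 ?mulr_ge0 ?(ltW B0) ?(ltW eps10).
  - by rewrite exprn_ge0// mulr_ge0 ?(ltW p0)// addr_ge0// divr_ge0// ltW.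
  - by rewrite lerXn2r ?nnegrE ?(ltW FH0) ?divr_ge0 ?mulr_ge0 ?(ltW B0) ?(ltW eps10).
  - rewrite lerXn2r ?nnegrE//; first by rewrite mulr_ge0 ?(ltW p0)// addr_ge0// divr_ge0// ltW.
    apply: le_trans ratio; rewrite mulr_ge0 ?(ltW p0)// addr_ge0// divr_ge0// ltW//.
apply: (@le_trans _ _ (del ^+ n * avg (fun y : {ffun 'I_n -> X} => (\prod_b h (y b)) *
        (avg (fun x => f' x * \prod_b W j x (y b))) ^+ n))).
  by rewrite ler_wpM2l ?exprn_ge0 ?(ltW del0).
rewrite /Knn -avgZ; apply: ler_avg => y.
have hp1 : \prod_b h (y b) <= 1.
  rewrite -[leRHS](@expr1n R #|'I_n|) -prodr_const.
  by apply: ler_prod => b _; rewrite h0 hle.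
have a0 : 0 <= avg (fun x => f' x * \prod_b W j x (y b)).
  by apply: avg_ge0 => x; rewrite mulr_ge0// prodr_ge0.
apply: (@le_trans _ _ (del ^+ n * (avg (fun x => f' x * \prod_b W j x (y b))) ^+ n)).
  rewrite ler_wpM2l ?exprn_ge0 ?(ltW del0)// -[leRHS]mul1r ler_wpM2r// exprn_ge0//.
rewrite -exprMn lerXn2r ?nnegrE ?mulr_ge0 ?(ltW del0)//.
  by apply: avg_ge0 => x; rewrite mulr_ge0 ?pendens_ge0 ?prodr_ge0.
rewrite -avgZ; apply: ler_avg => x; rewrite mulrA ler_wpM2r ?prodr_ge0//.
rewrite /f'; case: eqP => [l0|_]; last by rewrite mulr0 pendens_ge0.
have : j \notin low x by rewrite l0 inE.
rewrite inE -leNgt => /(le_trans _); apply; rewrite ler_piMr ?(ltW del0)//.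
by case/andP: (f1 x).
Qed.

End FarFromConstant.
End Space.

Lemma Knn_ge0 (X : finType) (g : X -> R) (w : X -> X -> R) n :
  (forall x, 0 <= g x) -> (forall x y, 0 <= w x y) -> 0 <= Knn n g w.
Proof.
move=> g0 w0; apply: avg_ge0 => y; apply/exprn_ge0/avg_ge0 => x.
by rewrite mulr_ge0// prodr_ge0.
Qed.

(** The order of the choices matters: eps depends on E and k, then eps1 and tau0 on
    eps; n, chosen last, is large in terms of all of them. *)
Lemma common_finite : exists2 n, (0 < n)%N &
  forall (X : finType) (W : 'I_k -> X -> X -> R), (0 < #|X|)%N ->
    (forall i x y, W i x y = W i y x) -> (forall i x y, 0 <= W i x y) ->
    (forall x y, \sum_i W i x y = 1) ->
    k%:R * p ^+ (n * n + n * q.+1) <= \sum_i Knn n (pendens E r (W i)) (W i).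
Proof.
pose v := #|V|.+1.
pose eps1 : R := eps ^+ 4 / (4 * k%:R * B ^+ 3).
pose tau0 : R := eps1 / (2 ^+ k.+1 * B).
pose eta : R := (2 * k%:R * k%:R)^-1.
pose c0 : R := tau0 ^+ #|V| * eta ^+ q.+1 / (2 * k%:R).
pose e2 : R := eps1 / (2 * B).
pose th1 : R := (k%:R - 1 / 2) / k.-1%:R.
pose th2 : R := 1 + eps1 / 2.
pose K := (k * v * (v + 2))%N; pose K' := (k * v * v)%N.
pose cA : R := tau0 ^+ 2 * c0 / (4 * k%:R * (2 * k%:R) ^+ K).
pose cB : R := c0 * e2 / (k%:R * (2 * k%:R) ^+ K').
have kp : (0 : R) < k%:R by exact: B0.
have k0 : (0 < k)%N by exact: ltnW.
have k1p : (0 : R) < k.-1%:R by rewrite ltr0n -ltnS prednK.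
have kE : k%:R = k.-1%:R + 1 :> R by rewrite natr1 prednK// ltnW.
have k2p : (0 : R) < 2 * k%:R by exact: mulr_gt0.
have B2p : 0 < 2 * B by exact: mulr_gt0.
have eps1p : 0 < eps1.
  apply: divr_gt0; first exact: exprn_gt0.
  by apply: mulr_gt0; [exact: mulr_gt0 | exact: exprn_gt0].
have tau0p : 0 < tau0.
  by apply: divr_gt0 => //; apply: mulr_gt0 => //; exact: exprn_gt0.
have etap : 0 < eta by rewrite invr_gt0; exact: mulr_gt0.
have c0p : 0 < c0.
  by apply: divr_gt0 => //; apply: mulr_gt0; exact: exprn_gt0.
have e2p : 0 < e2 by exact: divr_gt0.
have th1p : 1 < th1 by rewrite ltr_pdivlMr// kE; lra.
have th2p : 1 < th2 by rewrite /th2; lra.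
have dAp : 0 < 4 * k%:R * (2 * k%:R) ^+ K :> R.
  by apply: mulr_gt0; [exact: mulr_gt0 | exact: exprn_gt0].
have dBp : 0 < k%:R * (2 * k%:R) ^+ K' :> R.
  by apply: mulr_gt0 => //; exact: exprn_gt0.
have cAp : 0 < cA.
  by apply: divr_gt0 => //; apply: mulr_gt0 => //; exact: exprn_gt0.
have cBp : 0 < cB by apply: divr_gt0 => //; exact: mulr_gt0.
have [n1 growA] := exp_beats_power (K + 2) th1p cAp.
have [n2 growB] := exp_beats_power K' th2p cBp.
pose s := maxn (maxn n1 n2) (Num.bound (256 * C)).+1.
pose n := (4 * s)%N; pose N := ((k * (n + n)) ^ (k * v))%N.
have s0 : (0 < s)%N by rewrite /s leq_max orbT.
have n0 : (0 < n)%N by rewrite /n muln_gt0.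
have sn : (s <= n)%N by rewrite /n leq_pmull.
have n1n : (n1 <= n)%N by apply: leq_trans sn; rewrite /s !leq_max leqnn.
have n2n : (n2 <= n)%N by apply: leq_trans sn; rewrite /s !leq_max leqnn orbT.
have sC : 256 * C <= s%:R.
  apply: (@le_trans _ _ (Num.bound (256 * C))%:R); last by rewrite ler_nat /s leq_max leqnSn orbT.
  by apply/ltW/archi_boundP; rewrite mulr_ge0// ltW.
have N0 : (0 : R) < N%:R by rewrite ltr0n expn_gt0 muln_gt0 addn_gt0 n0 k0.
have NE j : N%:R ^+ j = (2 * k%:R) ^+ (k * v * j) * n%:R ^+ (k * v * j) :> R.
  rewrite -exprMn /N natrX -exprM natrM natrD; congr (_ ^+ _); ring.
pose del : R := c0 / N%:R ^+ v.
have delp : 0 < del by rewrite divr_gt0 ?exprn_gt0.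
have del_small : k%:R * N%:R ^+ #|V|.+1 * del <= 1 / 2 * (tau0 ^+ #|V| * eta ^+ #|E|.+1).
  rewrite le_eqVlt; apply/orP; left; apply/eqP; rewrite /del /c0 -/v -/q.
  by field; rewrite !gt_eqF ?exprn_gt0.
have eta1 : k%:R * eta < 1.
  have -> : k%:R * eta = (2 * k%:R)^-1 by rewrite /eta; field; rewrite gt_eqF.
  by rewrite invf_lt1 ?mulr_gt0//; move: B1; rewrite /B; lra.
have power_ge (x : R) : 1 <= x -> x <= x ^+ n.
  by move=> x1; rewrite -[leLHS]expr1 ler_weXn2l.
have np : (0 : R) < n%:R by rewrite ltr0n.
have k1 : 1 <= k%:R :> R by exact: B1.
exists n => // X W X0 WC W0 W1.
have Kge i : 0 <= Knn n (pendens E r (W i)) (W i).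
  by apply: Knn_ge0 => // x; apply: pendens_ge0.
have one i x : x <= Knn n (pendens E r (W i)) (W i) ->
    x <= \sum_i Knn n (pendens E r (W i)) (W i).
  by move=> /le_trans; apply; rewrite (bigD1 i)//= lerDl sumr_ge0.
have pp : k%:R * p ^+ (n * n + n * q.+1) <= k%:R * p ^+ (n * n).
  rewrite ler_wpM2l// ler_wiXn2l ?(ltW p0) ?leq_addr//.
  by rewrite invf_le1.
pose U i x y := k%:R * W i x y - 1.
have [small|] := boolP [forall i, avg (fun x => avg (fun y => codeg (U i) x y ^+ 2)) <= eps ^+ 4].
  by apply: common_local => // i; exact: (forallP small i).
move=> /forallPn[i0]; rewrite -ltNge => far.
have [|||j [f [h [f1 h1 fh]]]] := @dense_box R X k U B X0 B1 _ _ i0 _ _ far.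
- move=> i x y.
  have Wle1 : W i x y <= 1 by rewrite -(W1 x y) (bigD1 i)//= lerDl sumr_ge0.
  exact: norm_dev_le.
- by move=> x y; rewrite sumrB -mulr_sumr W1 sumr_const card_ord mulr1 subrr.
- by rewrite exprn_gt0.
have [/existsP[J /andP[J0 big]]|/existsPn Tsmall] := boolP [exists J : {set 'I_k},
    (J != set0) && (tau0 * #|X|%:R <=
      #|[set x | [set i | pendens E r (W i) x < del] == J]|%:R)].
  have [i hi] := @far_sparse X W X0 WC W0 W1 n eps1 eta del n0 eps1p etap eta1 delp del_small J J0 big.
  apply: (one i); apply: le_trans hi; apply: (le_trans pp); rewrite -/tau0 -/N.
  have -> : (1 - k%:R * eta) / k.-1%:R = p * th1.
    by rewrite /th1 /eta /p; field; rewrite !gt_eqF.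
  pose x := tau0 ^+ 2 * del * th1 ^+ n / N%:R ^+ 2.
  have nn0 : (0 : R) < (n * n)%:R by rewrite ltr0n muln_gt0 n0.
  rewrite (sparse_power _ _ _ _ nn0 N0) -/x.
  rewrite mulrC ler_wpM2l ?exprn_ge0 ?(ltW p0)// ler_pdivlMr; last by rewrite mulr_gt0.
  have xbig : 4 * k%:R * n%:R ^+ 2 <= x.
    apply: (sparse_size kp _ _ _ _ (P := n%:R ^+ K) (Q := (2 * k%:R) ^+ K)).
    - exact: exprn_gt0.
    - exact: exprn_gt0.
    - exact: exprn_gt0.
    - by rewrite -exprD NE.
    - by rewrite -exprD; exact: growA.
  apply: (@le_trans _ _ x).
    apply: le_trans xbig; rewrite natrM expr2 le_eqVlt; apply/orP; left; apply/eqP.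
    by ring.
  apply: power_ge; apply: le_trans xbig.
  rewrite -mulrA mulr_ege1 ?mulr_ege1 ?exprn_ege1 ?ler1n//.
apply: (one j); have Tsmall' (J : {set 'I_k}) : J != set0 ->
    #|[set x | [set i | pendens E r (W i) x < del] == J]|%:R <= tau0 * #|X|%:R.
  by move=> J0; have := Tsmall J; rewrite J0 /= -ltNge => /ltW.
have := @far_dense X W X0 W0 W1 n eps1 del eps1p delp j f h f1 h1 fh Tsmall'.
apply: le_trans; apply: (le_trans pp); rewrite -/e2 -/th2.
pose x := del * e2 * th2 ^+ n.
rewrite dense_power -/x mulrC ler_wpM2l ?exprn_ge0 ?(ltW p0)//.
have xbig : k%:R <= x.
  apply: (dense_size kp _ _ _ (P := n%:R ^+ K') (Q := (2 * k%:R) ^+ K')).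
  - exact: exprn_gt0.
  - exact: exprn_gt0.
  - exact: NE.
  - exact: growB.
apply: (le_trans xbig); apply: power_ge; exact: le_trans xbig.
Qed.

End FiniteCommon.

(** * Mycielski graphs and hanging copies *)

Local Open Scope nat_scope.

Section Colouring.

Lemma colorableP (G : sgraph) c :
  reflect (exists f : G -> 'I_c, forall u v, adj u v -> f u != f v) (colorable G c).
Proof.
apply: (iffP existsP) => [[f fP]|[f fP]].
  by exists f => u v; move/forallP: fP => /(_ u)/forallP/(_ v)/implyP.
exists (finfun f); apply/forallP => u; apply/forallP => v; apply/implyP => uv.
by rewrite !ffunE fP.
Qed.

Lemma chromatic_numberP (G : sgraph) l : colorable G l ->
  (forall c, colorable G c -> l <= c) -> chromatic_number G = l.
Proof.
move=> Gl lmin; rewrite /chromatic_number; case: ex_minnP => m Gm mmin.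
by apply/eqP; rewrite eqn_leq mmin// lmin.
Qed.

Definition triangle_free (G : sgraph) :=
  forall a b c : G, adj a b -> adj b c -> ~~ adj a c.

Definition has_neighbour (G : sgraph) := forall u : G, exists v, adj u v.

End Colouring.

Section Mycielski.
Variable G : sgraph.

Definition myc_adj : rel (option (G + G)) := fun x y =>
  match x, y with
  | Some (inl u), Some (inl v) => adj u v
  | Some (inl u), Some (inr v) => adj u v
  | Some (inr u), Some (inl v) => adj u v
  | Some (inr _), None => true
  | None, Some (inr _) => true
  | _, _ => false
  end.

Lemma myc_sym : symmetric myc_adj.
Proof. by move=> [[u|u]|] [[v|v]|] //=; exact: adj_sym. Qed.

Lemma myc_irrefl : irreflexive myc_adj.
Proof. by move=> [[u|u]|] //=; exact: adj_irrefl. Qed.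

(** Mycielski's construction: a shadow of each vertex and an apex joined to all
    the shadows. *)
Definition mycielski := SGraph myc_sym myc_irrefl.

Lemma myc_triangle_free : triangle_free G -> triangle_free mycielski.
Proof. by move=> tG [[a|a]|] [[b|b]|] [[c|c]|] //=; exact: tG. Qed.

Lemma myc_neighbour : (0 < #|G|) -> has_neighbour G -> has_neighbour mycielski.
Proof.
move=> /card_gt0P[x0 _] nG [[u|u]|].
- by have [v uv] := nG u; exists (Some (inl v)).
- by exists None.
- by exists (Some (inr x0)).
Qed.

Lemma myc_connected : has_neighbour G -> connected_graph mycielski.
Proof.
move=> nG; split; first by apply/card_gt0P; exists None.
have toapex x : connect (@adj mycielski) x None.
  case: x => [[u|u]|]; rewrite ?connect0//; last exact: connect1.
  have [v uv] := nG u.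
  by apply: (@connect_trans _ _ (Some (inr v))); apply: connect1.
move=> u v; apply: connect_trans (toapex u) _.
by rewrite sym_connect_sym//; exact: myc_sym.
Qed.

Lemma myc_colorable c : colorable G c -> colorable mycielski c.+1.
Proof.
move=> /colorableP[f fP]; apply/colorableP.
exists (fun x : mycielski => match x with
  | Some (inl u) => lift ord_max (f u)
  | Some (inr u) => lift ord_max (f u)
  | None => ord_max end).
move=> [[u|u]|] [[v|v]|] //=; rewrite ?(inj_eq (@lift_inj _ _)) ?neq_lift//.
- exact: fP.
- exact: fP.
- exact: fP.
- by rewrite eq_sym neq_lift.
Qed.

(** A vertex coloured like the apex may take the colour of its shadow, which
    frees the colour of the apex. *)
Lemma myc_uncolorable c : colorable mycielski c -> exists2 c', c = c'.+1 & colorable G c'.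
Proof.
move=> /colorableP[f fP]; case: c f fP => [|c] f fP; first by case: (f None).
exists c => //; apply/colorableP; pose a := f None.
pose g v := if f (Some (inl v)) == a then f (Some (inr v)) else f (Some (inl v)).
have ga v : a != g v.
  by rewrite /g; case: ifPn => [_|]; [exact: fP | rewrite eq_sym].
have gP u v : adj u v -> g u != g v.
  move=> uv; rewrite /g.
  case: (eqVneq (f (Some (inl u))) a) => [ua|_];
    case: (eqVneq (f (Some (inl v))) a) => [va|_]; try exact: fP.
  by have := fP (Some (inl u)) (Some (inl v)) uv; rewrite ua va eqxx.
exists (fun v => s2val (unlift_some (ga v))) => u v /gP.
apply: contra => /eqP E; apply/eqP.
by rewrite (s2valP (unlift_some (ga u))) E -(s2valP (unlift_some (ga v))).
Qed.

End Mycielski.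

Lemma K2_sym : symmetric (fun x y : bool => x != y).
Proof. by move=> x y; rewrite eq_sym. Qed.
Lemma K2_irrefl : irreflexive (fun x y : bool => x != y).
Proof. by move=> x; rewrite eqxx. Qed.
Definition K2 := SGraph K2_sym K2_irrefl.

Lemma triangle_free_chromatic l : 1 < l -> exists G : sgraph,
  [/\ connected_graph G, triangle_free G, colorable G l &
      forall c, colorable G c -> l <= c].
Proof.
suff : forall m, exists G : sgraph, [/\ has_neighbour G, connected_graph G,
    triangle_free G, colorable G m.+2 & forall c, colorable G c -> m.+2 <= c].
  by move=> H; case: l => [|[|m]] // _; have [G [_ *]] := H m; exists G.
elim=> [|m [G [nG cG tG Gm Gmin]]].
  exists K2; split.
  - by move=> u; exists (~~ u); case: u.
  - split; first by rewrite card_bool.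
    by move=> u v; have [->|uv] := eqVneq u v; [exact: connect0 | exact: connect1].
  - by move=> [] [] [].
  - apply/colorableP; exists (fun b : bool => if b then ord0 else ord_max).
    by move=> [] [].
  - move=> c /colorableP[f fP]; have := fP true false isT.
    by case: c f {fP} => [|[|c]] f //; rewrite ?(ord1 (f true)) ?(ord1 (f false)) ?eqxx//;
      case: (f true).
exists (mycielski G); split.
- exact: myc_neighbour (proj1 cG) nG.
- exact: myc_connected.
- exact: myc_triangle_free.
- exact: myc_colorable.
- by move=> c /myc_uncolorable[c' -> /Gmin].
Qed.

Section Edges.
Variable G : sgraph.

Lemma edges_oriented : oriented (edges G).
Proof.
move=> u v; rewrite !inE /= => /andP[uv ruv]; split.
  by apply: contraTneq uv => ->; rewrite adj_irrefl.
by rewrite negb_and -leqNgt (ltnW ruv) orbT.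
Qed.

Lemma linked_edges u v : linked (edges G) u v = adj u v.
Proof.
rewrite /linked !inE /= [adj v u]adj_sym -andb_orr.
case uv : (adj u v) => //=; rewrite -neq_ltn (inj_eq val_inj) (inj_eq enum_rank_inj).
by apply: contraTneq uv => ->; rewrite adj_irrefl.
Qed.

(** The edges of a graph are oriented along the enumeration of its vertices; an
    explicit graph is easier to list with another orientation. *)
Lemma big_edges (R : Type) (idx : R) (op : Monoid.com_law idx) (E : {set G * G})
    (w : G -> G -> R) :
  oriented E -> (forall u v, linked E u v = adj u v) -> (forall u v, w u v = w v u) ->
  \big[op/idx]_(p in edges G) w p.1 p.2 = \big[op/idx]_(p in E) w p.1 p.2.
Proof.
move=> oE EG wC.
pose h (p : G * G) := if p \in edges G then p else (p.2, p.1).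
have hE p : p \in E -> h p \in edges G.
  case: p => u v uvE; rewrite /h; case: ifPn => // uvG /=.
  have : linked (edges G) u v by rewrite linked_edges -EG /linked uvE.
  by rewrite /linked (negbTE uvG).
have hI : {in E &, injective h}.
  move=> [u v] [u' v'] uE u'E; rewrite /h; case: ifP; case: ifP => _ _ //= [].
  - by move=> uE' vE'; move: (oE _ _ u'E).2; rewrite -uE' -vE' uE.
  - by move=> vE' uE'; move: (oE _ _ u'E).2; rewrite -uE' -vE' uE.
  - by move=> -> ->.
have im : edges G = h @: E.
  apply/setP => p; apply/idP/imsetP => [pG|[q qE ->]]; last exact: hE.
  case: p pG => u v uvG.
  have : linked E u v by rewrite EG -linked_edges /linked uvG.
  case/orP => uvE; first by exists (u, v); rewrite // /h uvG.
  exists (v, u) => //; rewrite /h ifN//.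
  exact: (edges_oriented uvG).2.
rewrite im big_imset//=; apply: eq_bigr => -[u v] _; rewrite /h; case: ifP => //= _.
Qed.

End Edges.

Section Attach.
Variables (G : sgraph) (r : G) (n : nat).

Definition att_adj : rel ('I_n + 'I_n * option G) := fun x y =>
  match x, y with
  | inl _, inr (_, None) => true
  | inr (_, None), inl _ => true
  | inr (a, None), inr (a', Some v) => (a == a') && (v == r)
  | inr (a, Some u), inr (a', None) => (a == a') && (u == r)
  | inr (a, Some u), inr (a', Some v) => (a == a') && adj u v
  | _, _ => false
  end.

Lemma att_sym : symmetric att_adj.
Proof. by move=> [b|[a [u|]]] [b'|[a' [u'|]]] //=; rewrite eq_sym // adj_sym. Qed.

Lemma att_irrefl : irreflexive att_adj.
Proof. by move=> [b|[a [u|]]] //=; rewrite adj_irrefl andbF. Qed.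

(** K_{n,n} with a copy of G hanging by an edge from each vertex of one side. *)
Definition attach := SGraph att_sym att_irrefl.

(** The edges of attach, oriented; the index (a, None) stands for the edge by
    which the copy of G hangs. *)
Definition att_edge (t : ('I_n * 'I_n) + ('I_n * option (G * G))) : attach * attach :=
  match t with
  | inl (a, b) => (inr (a, None), inl b)
  | inr (a, None) => (inr (a, None), inr (a, Some r))
  | inr (a, Some p) => (inr (a, Some p.1), inr (a, Some p.2))
  end.

Definition att_index := [set t : ('I_n * 'I_n) + ('I_n * option (G * G)) |
  if t is inr (_, Some p) then p \in edges G else true].

Lemma att_edge_inj : injective att_edge.
Proof.
move=> [[a b]|[a [[u v]|]]] [[a' b']|[a' [[u' v']|]]] //=;
  by case=> *; subst.
Qed.

Lemma att_linked x y : linked (att_edge @: att_index) x y = att_adj x y.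
Proof.
have mem t : t \in att_index -> att_edge t \in att_edge @: att_index.
  exact: imset_f.
apply/idP/idP.
  have sub u v : (u, v) \in att_edge @: att_index -> att_adj u v.
    case/imsetP => -[[a b]|[a [[s t]|]]] /=; rewrite !inE /= => stG [-> ->] //=;
      rewrite ?eqxx//=.
    by case/andP: stG.
  by case/orP => /sub//; rewrite att_sym.
rewrite /linked; case: x => [b|[a [u|]]]; case: y => [b'|[a' [u'|]]] //=.
- by move=> _; rewrite (mem (inl (a', b))) ?orbT// inE.
- move=> /andP[/eqP<-]; rewrite -linked_edges => /orP[] h.
    by rewrite (mem (inr (a, Some (u, u'))))// inE.
  by rewrite (mem (inr (a, Some (u', u)))) ?orbT// inE.
- by move=> /andP[/eqP<- /eqP->]; rewrite (mem (inr (a, None))) ?orbT// inE.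
- by move=> _; rewrite (mem (inl (a, b'))) // inE.
- by move=> /andP[/eqP<- /eqP->]; rewrite (mem (inr (a, None)))// inE.
Qed.

Lemma att_oriented : oriented (att_edge @: att_index).
Proof.
move=> x y xy; split.
  have : att_adj x y by rewrite -att_linked /linked xy.
  by apply: contraTneq => ->; rewrite att_irrefl.
case/imsetP: xy => t tA xyE; apply/imsetP => -[t' t'A yxE].
move: tA t'A xyE yxE.
case: t t' => [[a b]|[a [[u v]|]]] [[a' b']|[a' [[u' v']|]]] //= tA t'A [-> ->] //.
case=> _ e1 _ e2; move: tA t'A; rewrite !inE /= -e1 -e2 => /andP[_ uv] /andP[_ vu].
by have := ltn_trans uv vu; rewrite ltnn.
Qed.

Lemma big_attach (R : Type) (idx : R) (op : Monoid.com_law idx)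
    (w : attach -> attach -> R) : (forall u v, w u v = w v u) ->
  \big[op/idx]_(p in edges attach) w p.1 p.2 =
  \big[op/idx]_(a < n) op (\big[op/idx]_(b < n) w (inr (a, None)) (inl b))
    (op (w (inr (a, None)) (inr (a, Some r)))
        (\big[op/idx]_(p in edges G) w (inr (a, Some p.1)) (inr (a, Some p.2)))).
Proof.
move=> wC; rewrite (big_edges _ att_oriented att_linked wC).
rewrite big_imset /=; last by move=> s t _ _; exact: att_edge_inj.
rewrite big_mkcond big_sumType /= big_split /= ; congr (op _ _).
  rewrite pair_bigA /=; apply: eq_bigr => -[a b] _.
  by rewrite inE.
transitivity (\big[op/idx]_(a < n) \big[op/idx]_(o : option (G * G))
  (if inr (a, o) \in att_index then
   w (att_edge (inr (a, o))).1 (att_edge (inr (a, o))).2 else idx)).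
  by rewrite pair_bigA /=; apply: eq_bigr => -[a o].
apply: eq_bigr => a _; rewrite (bigD1 None)//= inE; congr (op _ _).
rewrite (reindex_omap Some id) => [|[]//]; rewrite [RHS]big_mkcond /=.
by apply: eq_big => [p|p _]; rewrite ?eqxx// inE.
Qed.

Lemma card_attach_edges : #|edges attach| = (n * n + n * #|edges G|.+1)%N.
Proof.
rewrite -sum1_card (big_attach _ (w := fun _ _ => 1%N))//.
transitivity (\sum_(a < n) (n + #|edges G|.+1)).
  by apply: eq_bigr => a _; rewrite /= big_const_ord iter_addn_0 mul1n sum1_card add1n.
by rewrite sum_nat_const card_ord mulnDr.
Qed.

Lemma attach_colorable c : (1 < c)%N -> colorable G c -> colorable attach c.
Proof.
case: c => [|c] // c1 /colorableP[f fP]; apply/colorableP.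
have [al ral] : exists al, al != f r.
  have [fr|fr] := eqVneq (f r) ord0; last by exists ord0; rewrite eq_sym.
  by exists ord_max; rewrite fr -val_eqE /= -lt0n -ltnS.
have [be bal] : exists be, be != al.
  by exists (f r); rewrite eq_sym.
exists (fun x : attach => match x with
  | inl _ => be | inr (_, None) => al | inr (_, Some v) => f v end).
move=> [b|[a [u|]]] [b'|[a' [u'|]]] //=.
- by case/andP => _; exact: fP.
- by case/andP => _ /eqP->; rewrite eq_sym.
- by rewrite eq_sym.
- by case/andP => _ /eqP->.
Qed.

Hypothesis n0 : (0 < n)%N.

Lemma attach_colorable_inv c : colorable attach c -> colorable G c.
Proof.
move=> /colorableP[f fP]; apply/colorableP.
exists (fun v => f (inr (Ordinal n0, Some v))) => u v uv; apply: fP => /=.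
exact: uv.
Qed.

Lemma attach_connected : connected_graph G -> connected_graph attach.
Proof.
move=> [_ cG]; split; first by apply/card_gt0P; exists (inl (Ordinal n0)).
pose c0 : attach := inl (Ordinal n0).
have csym : connect_sym (@adj attach) by apply: sym_connect_sym; exact: att_sym.
have cA a : connect (@adj attach) (inr (a, None)) c0 by exact: connect1.
have toc0 x : connect (@adj attach) x c0.
  case: x => [b|[a [u|]]]; last exact: cA.
    apply: (@connect_trans _ _ (inr (Ordinal n0, None))); last exact: cA.
    exact: connect1.
  apply: (@connect_trans _ _ (inr (a, None))); last exact: cA.
  apply: (@connect_trans _ _ (inr (a, Some r))); last first.
    by apply: connect1 => /=; rewrite !eqxx.
  have /connectP[s sp ->] := cG u r.
  elim: s u sp => [|v s IHs] u //= /andP[uv sp]; apply: connect_trans (IHs _ sp).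
  by apply: connect1 => /=; rewrite eqxx.
by move=> u v; apply: connect_trans (toc0 u) _; rewrite csym.
Qed.

End Attach.

Local Open Scope ring_scope.

Section HomDensity.
Context {R : realFieldType}.

Definition fhom (X : finType) (H : sgraph) (w : X -> X -> R) : R :=
  dens (edges H) w.

(** Given the positions of the free side of K_{n,n}, the n hanging copies of G
    are independent and identically distributed. *)
Lemma fhom_attach (X : finType) (G : sgraph) (r : G) n (w : X -> X -> R) :
  (0 < #|X|)%N -> (forall x y, w x y = w y x) ->
  fhom (attach r n) w = Knn n (pendens (edges G) r w) w.
Proof.
move=> X0 wC; rewrite /fhom /dens /Knn.
pose Psi (y : {ffun 'I_n -> X}) (z : {ffun option G -> X}) :=
  (\prod_(b < n) w (z None) (y b)) * (w (z None) (z (Some r)) *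
    \prod_(p in edges G) w (z (Some p.1)) (z (Some p.2))).
rewrite avg_ffun_sum; apply: eq_avg => y.
transitivity (avg (fun h : {ffun 'I_n * option G -> X} =>
    \prod_(a < n) Psi y [ffun o => h (a, o)])).
  apply: eq_avg => h; rewrite /wt.
  rewrite (big_attach _ (w := fun u v : attach r n => w (_ u) (_ v))); last by move=> *; exact: wC.
  apply: eq_bigr => a _; rewrite /Psi !ffunE.
  congr (_ * (_ * _)).
    by apply: eq_bigr => b _; rewrite !ffunE.
  by apply: eq_bigr => p _; rewrite !ffunE.
rewrite (avg_curry (fun a => Psi y)) prodr_const card_ord; congr (_ ^+ n).
rewrite avg_ffun_option; apply: eq_avg => x; rewrite mulrC pendensE// -avgZ.
apply: eq_avg => f; rewrite /Psi !ffunE; congr (_ * (_ * _)).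
by apply: eq_bigr => b _; rewrite !ffunE.
Qed.

End HomDensity.

(** * Sampling graphons *)

From mathcomp Require Import all_classical all_reals all_analysis.
From mathcomp Require Import measurable_realfun.

Local Open Scope classical_set_scope.
Local Open Scope ring_scope.

Section Cube.
Context {R : realType}.
Local Notation mR := (measurableTypeR R).
Local Notation mu := (@lebesgue_measure R).
Local Notation cube n := (@unit_cube R n).

Definition box n (B : 'I_n -> set mR) : set (n.-tuple mR) :=
  [set t | forall i, B i (tnth t i)].

Lemma measurable_box n (B : 'I_n -> set mR) :
  (forall i, measurable (B i)) -> measurable (box B).
Proof.
move=> mB; rewrite (_ : box B = \bigcap_(i in [set: 'I_n])
    ((fun t : n.-tuple mR => tnth t i) @^-1` B i)).
  apply: fin_bigcap_measurable; first exact: finite_finset.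
  by move=> i _; rewrite -[X in measurable X]setTI; exact: measurable_tnth.
by apply/seteqP; split=> t /= tB => [i _|i]; exact: tB.
Qed.

Definition boxes n : set (set (n.-tuple mR)) :=
  [set A | exists2 B : 'I_n -> set mR, (forall i, measurable (B i)) & A = box B].
Arguments boxes : clear implicits.

Lemma measurable_boxes n : @measurable _ (n.-tuple mR) = <<s boxes n >>.
Proof.
apply/seteqP; split.
  apply: smallest_sub; first exact: smallest_sigma_algebra.
  case: n => [|n]; first by rewrite big_ord0.
  rewrite -bigcup_mkord_ord; apply: bigcup_sub => i _ A [B mB <-].
  apply: sub_sigma_algebra; exists (fun j => if j == inord i then B else setT).
    by move=> j; case: ifP.
  apply/seteqP; split=> t /=.
    by move=> [_ Bt] j; case: ifP => // /eqP->.
  by move=> /(_ (inord i)); rewrite eqxx.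
apply: smallest_sub; first exact: sigma_algebra_measurable.
by move=> A [B mB ->]; exact: measurable_box.
Qed.

Lemma boxes_setI n : setI_closed (boxes n).
Proof.
move=> A A' [B mB ->] [B' mB' ->]; exists (fun i => B i `&` B' i).
  by move=> i; exact: measurableI.
apply/seteqP; split=> t /=; first by move=> [h h'] i; split.
by move=> h; split=> i; have [] := h i.
Qed.

Lemma measurable_cube n : measurable (cube n).
Proof.
rewrite (_ : cube n = box (fun=> [set` `[0, 1]%R]))//.
by apply: measurable_box => i; exact: measurable_itv.
Qed.

Lemma lebesgue_cube_box n (B : 'I_n -> set mR) : (forall i, measurable (B i)) ->
  lebesgue_tuple R n (box B `&` cube n) = (\prod_i mu (B i `&` `[0%R, 1%R]))%E.
Proof.
move=> mB; rewrite -lebesgue_tuple_box; last first.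
  by move=> i; exact: measurableI.
congr (lebesgue_tuple R n _); apply/seteqP; split=> t /=.
  by move=> [h h'] i; split; [exact: h | exact: h'].
by move=> h; split=> i; have [] := h i.
Qed.

Lemma mu01 : mu `[0%R, 1%R] = 1%E.
Proof. by rewrite lebesgue_measure_itv /= lte01 sube0. Qed.

Lemma lebesgue_cube n : lebesgue_tuple R n (cube n) = 1%E.
Proof.
rewrite (_ : cube n = box (fun _ => setT) `&` cube n); last first.
  by rewrite (_ : box _ = setT) ?setTI//; apply/seteqP; split.
rewrite lebesgue_cube_box//; apply: big1 => i _.
by rewrite setTI mu01.
Qed.

Lemma integral_mrestr d (T : measurableType d) (m : {measure set T -> \bar R})
    (D : set T) (mD : measurable D) (F : T -> \bar R) :
  measurable_fun setT F -> (forall x, 0 <= F x)%E ->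
  (\int[mrestr m mD]_x F x = \int[m]_(x in D) F x)%E.
Proof.
move=> mF F0.
rewrite (@ge0_negligible_integral _ _ _ _ setT (~` D))//.
- rewrite setTD setCK; apply: eq_measure_integral => A mA AD.
  by rewrite /= /mrestr setIidl.
- exact: measurableC.
- by rewrite /= /mrestr setICl measure0.
Qed.

Section Coordinates.
Variables (n N : nat) (s : 'I_n -> 'I_N).

Definition pick_coords (x : N.-tuple mR) : n.-tuple mR := [tuple tnth x (s i) | i < n].

Lemma measurable_pick_coords : measurable_fun setT pick_coords.
Proof.
apply/measurable_fun_tnthP => i.
rewrite (_ : _ \o _ = fun x : N.-tuple mR => tnth x (s i)).
  exact: measurable_tnth.
by apply/funext => x /=; rewrite tnth_mktuple.
Qed.

Hypothesis sI : injective s.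

(** On the cube, distinct coordinates are independent and uniform. *)
Lemma lebesgue_pick_coords A : measurable A ->
  lebesgue_tuple R N (pick_coords @^-1` A `&` cube N) =
  lebesgue_tuple R n (A `&` cube n).
Proof.
pose m1 : {measure set (n.-tuple mR) -> \bar R} :=
  mrestr (lebesgue_tuple R n) (@measurable_cube n).
pose m2 : {measure set (n.-tuple mR) -> \bar R} :=
  measure_function_pushforward__canonical__measure_function_Measure
    (mrestr (lebesgue_tuple R N) (@measurable_cube N)) measurable_pick_coords.
move=> mA; apply: esym.
apply: (measure_unique (boxes n) (fun=> setT) (@measurable_boxes n) (@boxes_setI n)
  _ _ m1 m2 _ _ A mA).
- move=> _; exists (fun=> setT) => //.
  by apply/seteqP; split.
- by rewrite bigcup_const//; exists 0%N.
- move=> _ [B mB ->]; rewrite /m1 /m2 /= /mrestr /pushforward.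
  pose B' j := \bigcap_(i in [set i | s i = j]) B i.
  have -> : pick_coords @^-1` box B = box B'.
    apply/seteqP; split=> x /=.
      by move=> h j i /= <-; have := h i; rewrite tnth_mktuple.
    by move=> h i; rewrite tnth_mktuple; exact: h.
  rewrite !lebesgue_cube_box//; last first.
    by move=> j; apply: fin_bigcap_measurable => //; exact: finite_finset.
  rewrite (partition_big s xpredT)//=; apply: eq_bigr => j _.
  case: (pickP (fun i => s i == j)) => [i /eqP si|none]; last first.
    rewrite big_pred0// (_ : B' j = setT) ?setTI ?mu01//.
    by apply/seteqP; split=> // x _ i /= sij; have := none i; rewrite sij eqxx.
  rewrite (big_pred1 i) => [|i']; last by rewrite /= -si (inj_eq sI).
  congr (mu (_ `&` _)); apply/seteqP; split=> x; last by apply.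
  by move=> Bx i' /=; rewrite -si => /sI->.
- move=> _; have -> : m1 setT = 1%E.
    by rewrite (_ : m1 setT = lebesgue_tuple R n (setT `&` cube n))// setTI lebesgue_cube.
  exact: ltry.
Qed.

Lemma integral_pick_coords (F : n.-tuple mR -> R) :
  measurable_fun (cube n) F -> (forall x, cube n x -> 0 <= F x) ->
  \int[lebesgue_tuple R N]_(x in cube N) F (pick_coords x) =
  \int[lebesgue_tuple R n]_(x in cube n) F x.
Proof.
move=> mF F0; pose F' := (EFin \o F) \_ (cube n).
have mF' : measurable_fun setT F'.
  apply: (measurable_restrictT (EFin \o F) (@measurable_cube n)).1.
  exact/measurable_EFinP.
have F'0 x : (0 <= F' x)%E.
  by rewrite /F' patchE; case: ifPn => // /set_mem/F0; rewrite /= lee_fin.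
congr fine.
transitivity (\int[lebesgue_tuple R N]_(x in cube N) (F' \o pick_coords) x)%E.
  apply: eq_integral => x /set_mem xc; rewrite /F' /= patchE mem_set//.
  by move=> i; rewrite tnth_mktuple; exact: xc.
transitivity (\int[lebesgue_tuple R n]_(x in cube n) F' x)%E; last first.
  by apply: eq_integral => x xc; rewrite /F' patchE xc.
rewrite -(integral_mrestr _ (@measurable_cube N)); last 2 first.
- exact: (measurableT_comp mF' measurable_pick_coords).
- by move=> x; exact: F'0.
rewrite -(integral_mrestr _ (@measurable_cube n))//.
rewrite -[X in (integral _ X _ = _)%E](preimage_setT pick_coords).
rewrite -(ge0_integral_pushforward measurable_pick_coords)//.
  apply: eq_measure_integral => [|? A mA _]; first exact: measurable_pick_coords.
  exact: lebesgue_pick_coords.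
Qed.

End Coordinates.

Lemma bounded_integrable n (F : n.-tuple mR -> R) : measurable_fun (cube n) F ->
  (forall x, cube n x -> 0 <= F x <= 1) ->
  (lebesgue_tuple R n).-integrable (cube n) (EFin \o F).
Proof.
move=> mF F01; apply: measurable_bounded_integrable => //.
- exact: measurable_cube.
- by have := ltry (1 : R); rewrite -(lebesgue_cube n).
- exists 1; split; first exact: num_real.
  move=> M M1 x /F01/andP[F0 F1]; rewrite /= ger0_norm// (le_trans F1)// ltW//.
Qed.

Lemma Rintegral_cube_cst n (c : R) : c = \int[lebesgue_tuple R n]_(x in cube n) c.
Proof.
rewrite (Rintegral_cst _ (@measurable_cube n)).
by rewrite (_ : _ (cube n) = 1%E) ?mulr1//; exact: lebesgue_cube.
Qed.

Lemma Rintegral_sum n (I : Type) (s : seq I) (F : I -> n.-tuple mR -> R) :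
  (forall i, (lebesgue_tuple R n).-integrable (cube n) (EFin \o F i)) ->
  \int[lebesgue_tuple R n]_(x in cube n) (\sum_(i <- s) F i x) =
  \sum_(i <- s) \int[lebesgue_tuple R n]_(x in cube n) F i x.
Proof.
move=> iF; rewrite {1}/Rintegral.
under eq_integral do rewrite -sumEFin.
rewrite (integral_sum (@measurable_cube n) iF) -sum_fine// => i _.
apply: integrable_fin_num => //; exact: measurable_cube.
Qed.

End Cube.

Section Sampling.
Context {R : realType} (H : sgraph).
Local Notation mR := (measurableTypeR R).
Local Notation cube n := (@unit_cube R n).

Definition sample_weight N (W : graphon R) (x : N.-tuple mR) (a b : 'I_N) : R :=
  W (tnth x a) (tnth x b).

Definition sample_hom N (W : graphon R) (f : {ffun H -> 'I_N}) (x : N.-tuple mR) : R :=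
  wt (edges H) (sample_weight W x) f.

Lemma sample_weight01 N (W : graphon R) (x : N.-tuple mR) a b : cube N x ->
  0 <= sample_weight W x a b <= 1.
Proof. by move=> xc; have := gfun_itv W (xc a) (xc b); rewrite in_itv. Qed.

Lemma sample_hom01 N (W : graphon R) (f : {ffun H -> 'I_N}) (x : N.-tuple mR) :
  cube N x -> 0 <= sample_hom W f x <= 1.
Proof.
move=> xc; rewrite /sample_hom /wt prodr_ge0 => [|p _]; last first.
  by case/andP: (sample_weight01 W (f p.1) (f p.2) xc).
rewrite -[leRHS](@expr1n R #|edges H|) -prodr_const; apply: ler_prod => p _.
exact: sample_weight01.
Qed.

Lemma measurable_sample_hom N (W : graphon R) (f : {ffun H -> 'I_N}) :
  measurable_fun (cube N) (sample_hom W f).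
Proof.
rewrite /sample_hom /wt (_ : (fun x => _) = fun x : N.-tuple mR =>
    \prod_(p <- enum (edges H)) W (tnth x (f p.1)) (tnth x (f p.2))); last first.
  by apply/funext => x; rewrite big_enum.
apply: measurable_prod => p _.
pose D := [set p : mR * mR | p.1 \in `[0, 1] /\ p.2 \in `[0, 1]].
have mD : measurable D.
  rewrite (_ : D = [set` `[0, 1]%R] `*` [set` `[0, 1]%R])//.
  by apply: measurableX; exact: measurable_itv.
apply: (@measurable_comp _ _ _ _ _ _ D (fun q => W q.1 q.2) _
  (fun x : N.-tuple mR => (tnth x (f p.1), tnth x (f p.2)))) => //.
- by move=> _ [x xc <-]; split; exact: xc.
- exact: gfun_measurable.
- apply: measurable_funTS; apply/measurable_fun_pairP; split; exact: measurable_tnth.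
Qed.

Lemma integral_sample_hom N (W : graphon R) (f : {ffun H -> 'I_N}) : injective f ->
  \int[lebesgue_tuple R N]_(x in cube N) sample_hom W f x = hom_density H W.
Proof.
move=> fI; pose s (i : 'I_#|H|) := f (enum_val i).
have sI : injective s by move=> i j /fI/enum_val_inj.
pose F (y : #|H|.-tuple mR) := \prod_(p in edges H)
  W (tnth y (enum_rank p.1)) (tnth y (enum_rank p.2)).
have FE : F = sample_hom W (finfun (@enum_rank H)).
  by apply/funext => y; apply: eq_bigr => p _; rewrite /sample_weight !ffunE.
rewrite /hom_density -(integral_pick_coords sI (F := F)).
- apply: eq_Rintegral => x _; apply: eq_bigr => p _.
  by rewrite !tnth_mktuple /s !enum_rankK.
- by rewrite FE; exact: measurable_sample_hom.
- by move=> y yc; rewrite FE; case/andP: (sample_hom01 W (finfun (@enum_rank H)) yc).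
Qed.

Lemma hom_density_ge0 (W : graphon R) : 0 <= hom_density H W.
Proof.
apply: Rintegral_ge0 => x xc; apply: prodr_ge0 => p _.
by have := gfun_itv W (xc (enum_rank p.1)) (xc (enum_rank p.2)); rewrite in_itv => /andP[].
Qed.

Lemma integral_sample_hom_le1 N (W : graphon R) (f : {ffun H -> 'I_N}) :
  \int[lebesgue_tuple R N]_(x in cube N) sample_hom W f x <= 1.
Proof.
have -> : 1 = \int[lebesgue_tuple R N]_(x in cube N) (1 : R).
  exact: Rintegral_cube_cst.
apply: le_Rintegral; first exact: measurable_cube.
- apply: bounded_integrable; first exact: measurable_sample_hom.
  exact: sample_hom01.
- by apply: bounded_integrable => // x _; rewrite ler01 lexx.
- by move=> x /(sample_hom01 W f)/andP[].
Qed.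

(** A uniform random map is injective up to a birthday error. *)
Lemma avg_noninjective N : (0 < N)%N ->
  avg (fun f : {ffun H -> 'I_N} => (~~ injectiveb f)%:R) <= (#|H| * #|H|)%:R / N%:R :> R.
Proof.
move=> N0; have N0' : (0 < #|'I_N|)%N by rewrite card_ord.
apply: (@le_trans _ _ (avg (fun f : {ffun H -> 'I_N} =>
   \sum_(p : H * H | p.1 != p.2) (f p.1 == f p.2)%:R))).
  apply: ler_avg => f; case: (boolP (injectiveb f)) => [_|/injectivePn[u [v uv fuv]]].
    exact: sumr_ge0.
  rewrite (bigD1 (u, v))//= fuv eqxx lerDl; exact: sumr_ge0.
rewrite avg_sum (eq_bigr (fun=> N%:R^-1)) => [|p pp].
  rewrite sumr_const -[leLHS]mulr_natl ler_wpM2r ?invr_ge0// ler_nat.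
  by rewrite -card_prod max_card.
rewrite (avg_upd p.1 _ N0') -[RHS](@avg_cst _ {ffun H -> 'I_N}); last first.
  by rewrite card_ffun expn_gt0 N0'.
have pp' : (p.2 == p.1) = false by rewrite eq_sym (negbTE pp).
apply: eq_avg => f; rewrite avgE card_ord (bigD1 (f p.2))//=.
rewrite !ffunE eqxx pp' eqxx big1 ?addr0 ?mul1r// => t tf.
by rewrite !ffunE eqxx pp' (negbTE tf).
Qed.

(** Sampling transfers a linear bound from finite weighted graphs to graphons:
    the expected density of H in a sample differs from its density by the
    birthday error. *)
Lemma sampling_bound k N (W : 'I_k -> graphon R) (c : R) : (0 < N)%N ->
  (forall x : N.-tuple mR, cube N x -> c <= \sum_i fhom H (sample_weight (W i) x)) ->
  c <= \sum_i hom_density H (W i) + k%:R * ((#|H| * #|H|)%:R / N%:R).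
Proof.
move=> N0 cle.
have iS i (f : {ffun H -> 'I_N}) : (lebesgue_tuple R N).-integrable (cube N)
    (EFin \o sample_hom (W i) f).
  by apply: bounded_integrable; [exact: measurable_sample_hom | exact: sample_hom01].
pose M : R := #|{ffun H -> 'I_N}|%:R.
have M0 : 0 < M by rewrite ltr0n card_ffun expn_gt0 card_ord N0.
have homE x : \sum_i fhom H (sample_weight (W i) x) =
    (\sum_(q : 'I_k * {ffun H -> 'I_N}) sample_hom (W q.1) q.2 x) / M.
  rewrite -(pair_bigA _ (fun i f => sample_hom (W i) f x)) /= mulr_suml.
  by apply: eq_bigr => i _; rewrite /fhom /dens avgE.
have intE : c * M <= \sum_(q : 'I_k * {ffun H -> 'I_N})
    \int[lebesgue_tuple R N]_(x in cube N) sample_hom (W q.1) q.2 x.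
  rewrite -Rintegral_sum; last by move=> q; exact: iS.
  have -> : c * M = \int[lebesgue_tuple R N]_(x in cube N) (c * M).
    exact: Rintegral_cube_cst.
  apply: le_Rintegral; first exact: measurable_cube.
  - apply: measurable_bounded_integrable => //; first exact: measurable_cube.
      by have := ltry (1 : R); rewrite -(lebesgue_cube N).
    exists `|c * M|; split; first exact: num_real.
    by move=> A cA x _; exact: ltW.
  - rewrite (_ : _ \o _ = fun x => (\sum_(q : 'I_k * {ffun H -> 'I_N})
        (sample_hom (W q.1) q.2 x)%:E)%E); last first.
      by apply/funext => x; rewrite /= sumEFin.
    by apply: integrable_sum => [|q _]; [exact: measurable_cube | exact: iS].
  - by move=> x xc; rewrite -ler_pdivlMr// -homE; exact: cle.
rewrite -(ler_pM2r M0); apply: (le_trans intE).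
rewrite -(pair_bigA _ (fun i f => \int[lebesgue_tuple R N]_(x in cube N) sample_hom (W i) f x)) /=.
apply: (@le_trans _ _ (\sum_(i < k) (hom_density H (W i) + (#|H| * #|H|)%:R / N%:R) * M)); last first.
  rewrite -mulr_suml ler_wpM2r ?(ltW M0)// big_split /= sumr_const card_ord.
  by rewrite -[_ *+ k]mulr_natl.
apply: ler_sum => i _.
apply: (@le_trans _ _ (\sum_(f : {ffun H -> 'I_N}) (hom_density H (W i) + (~~ injectiveb f)%:R))).
  apply: ler_sum => f _; case: (boolP (injectiveb f)) => [/injectiveP fI|_].
    by rewrite integral_sample_hom// addr0.
  apply: le_trans (integral_sample_hom_le1 _ _) _.
  by rewrite lerDr hom_density_ge0.
rewrite big_split /= sumr_const -[_ *+ _]mulr_natr -/M mulrDl lerD2l -ler_pdivrMr//.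
by have := avg_noninjective N0; rewrite avgE.
Qed.

(** Averaging the inequality over random samples of N points and letting N grow. *)
Lemma common_of_finite k :
  (forall N (w : 'I_k -> 'I_N -> 'I_N -> R), (0 < N)%N ->
    (forall i a b, w i a b = w i b a) -> (forall i a b, 0 <= w i a b) ->
    (forall a b, \sum_i w i a b = 1) ->
    (k%:R : R) ^ (1 - (#|edges H|)%:Z) <= \sum_i fhom H (w i)) ->
  common R k H.
Proof.
move=> fin W W1; set c := _ ^ _ in fin *.
have bound N : (0 < N)%N ->
    c <= \sum_i hom_density H (W i) + k%:R * ((#|H| * #|H|)%:R / N%:R).
  move=> N0; apply: sampling_bound => // x xc; apply: fin => //.
  - by move=> i a b; apply: gfun_sym.
  - by move=> i a b; case/andP: (sample_weight01 (W i) a b xc).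
  - by move=> a b; apply: W1.
rewrite leNgt; apply/negP => lt.
set s := \sum_i _ in bound lt; pose C : R := k%:R * (#|H| * #|H|)%:R.
have C0 : 0 <= C by rewrite mulr_ge0.
have sc : 0 < c - s by rewrite subr_gt0.
pose N := (Num.bound (C / (c - s))).+1.
have := bound N isT; apply/negP; rewrite -ltNge mulrA -/C.
rewrite addrC -ltrBrDr ltr_pdivrMr ?ltr0n// mulrC -ltr_pdivrMr//.
apply: lt_trans (archi_boundP _) _; first by rewrite divr_ge0// ltW.
by rewrite ltr_nat.
Qed.

End Sampling.

Local Close Scope classical_set_scope.

(** * Connected common graphs of given chromatic number *)

Lemma unit_sym : symmetric (fun _ _ : unit => false). Proof. by []. Qed.
Lemma unit_irrefl : irreflexive (fun _ _ : unit => false). Proof. by []. Qed.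
Definition K1 := SGraph unit_sym unit_irrefl.

Lemma K1_connected : connected_graph K1.
Proof. by split=> [|[] []]; [rewrite card_unit | exact: connect0]. Qed.

Lemma K1_chromatic : chromatic_number K1 = 1%N.
Proof.
apply: chromatic_numberP; first by apply/colorableP; exists (fun=> ord0).
by move=> [|c] // /colorableP[f _]; case: (f tt).
Qed.

Lemma expz_edges (R : realType) (k m : nat) : (0 < k)%N ->
  (k%:R : R) ^ (1 - m%:Z) = k%:R * k%:R^-1 ^+ m.
Proof.
move=> k0; rewrite expfzDr ?pnatr_eq0 -?lt0n// expr1z.
by rewrite exprVn exprnN.
Qed.

Lemma K1_common (R : realType) k : (0 < k)%N -> common R k K1.
Proof.
move=> k0; apply: common_of_finite => N w N0 _ _ _.
have E0 : edges K1 = finset.set0 by apply/setP => p; rewrite !inE.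
rewrite E0 cards0 subr0 expr1z.
rewrite (eq_bigr (fun=> 1)) ?sumr_const ?card_ord// => i _.
rewrite /fhom /dens E0 (eq_avg (g := fun=> 1)) ?avg_cst//.
  by rewrite card_ffun expn_gt0 card_ord N0.
by move=> f; rewrite /wt finset.big_set0.
Qed.

Lemma attach_common (R : realType) k (G : sgraph) (r : G) : (1 < k)%N ->
  triangle_free G -> exists2 n, (0 < n)%N & common R k (attach r n).
Proof.
move=> k2 tG.
have tE a b c : linked (edges G) a b -> linked (edges G) b c -> ~~ linked (edges G) a c.
  by rewrite !linked_edges; exact: tG.
have [n n0 fin] := @common_finite R G k (edges G) r k2 (@edges_oriented G) tE.
exists n => //; apply: common_of_finite => N w N0 wC w0 w1.
have X0 : (0 < #|'I_N|)%N by rewrite card_ord.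
rewrite expz_edges ?(ltnW k2)// card_attach_edges.
apply: le_trans (fin _ w X0 wC w0 w1) _.
by apply: ler_sum => i _; rewrite fhom_attach.
Qed.

Theorem theorem2 (R : realType) (k l : nat) (hk : (2 <= k)%N) (hl : (0 < l)%N) :
  exists H : sgraph,
    connected_graph H /\ common R k H /\ chromatic_number H = l.
Proof.
case: l hl => [//|[_|l _]].
  exists K1; split; first exact: K1_connected.
  by split; [apply: K1_common; exact: ltnW | exact: K1_chromatic].
have [G [cG tG Gl Gmin]] := @triangle_free_chromatic l.+2 isT.
have /card_gt0P[r _] := cG.1.
have [n n0 comm] := @attach_common R k G r hk tG.
exists (attach r n); split; first exact: attach_connected.
split=> //; apply: chromatic_numberP; first exact: attach_colorable.
by move=> c /(attach_colorable_inv n0)/Gmin.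
Qed.
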